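(* Let $\mathbb X$ be a complex Banach space, let $\mathcal F\subset BC(\mathbb R^+,\mathbb X)$ be a function space satisfying Condition $F^+$, and let $\Lambda$ be a closed subset of the real line. Then $\Lambda^e_{\mathcal F}(\mathbb X)$ is a closed subspace of $\mathbb Y:=BC(\mathbb R^+,\mathbb X)/\mathcal F$, and $\sigma(\tilde{\mathcal D}_\Lambda)\subset i\Lambda$.
   Context: $\mathbb R^+=[0,\infty)$; $BC(\mathbb R^+,\mathbb X)$ is the Banach space of bounded continuous functions $\mathbb R^+\to\mathbb X$ with the sup-norm; $C_0(\mathbb R^+,\mathbb X)$ is its subspace of functions with $\lim_{t\to\infty}f(t)=0$. Condition $F^+$: a linear subspace $\mathcal F\subset BC(\mathbb R^+,\mathbb X)$ satisfies Condition $F^+$ if (1) it is closed and contains $C_0(\mathbb R^+,\mathbb X)$; (2) if $g\in\mathcal F$ and $\xi\in\mathbb R$, then $t\mapsto e^{i\xi t}g(t)$ is in $\mathcal F$; (3) for each $h\in\mathcal F$, $\mathrm{Re}\,\lambda>0$, $\mathrm{Re}\,\eta<0$, the functions $y(t)=\int_t^\infty e^{\lambda(t-s)}h(s)\,ds$ and $z(t)=\int_0^te^{\eta(t-s)}h(s)\,ds$, $t\in\mathbb R^+$, are in $\mathcal F$; (4) for each bounded linear operator $B$ on $\mathbb X$ and $f\in\mathcal F$, $Bf(\cdot)\in\mathcal F$. Write $\tilde f$ for the class of $f$ in $\mathbb Y=BC(\mathbb R^+,\mathbb X)/\mathcal F$. $D(\tilde{\mathcal D})$ is the set of all classes that contain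 a differentiable function $g\in BC(\mathbb R^+,\mathbb X)$ with $g'\in BC(\mathbb R^+,\mathbb X)$, and then $\tilde{\mathcal D}\tilde g=\widetilde{g'}$. For $\mathrm{Re}\,\lambda\ne0$, $R(\lambda,\tilde{\mathcal D})=(\lambda-\tilde{\mathcal D})^{-1}$, with $R(\lambda,\tilde{\mathcal D})\tilde f$ the class of $t\mapsto\int_t^\infty e^{\lambda(t-s)}f(s)\,ds$ if $\mathrm{Re}\,\lambda>0$ and of $t\mapsto-\int_0^te^{\lambda(t-s)}f(s)\,ds$ if $\mathrm{Re}\,\lambda<0$. The reduced spectrum $sp^+_{\mathcal F}(f)=sp^+_{\mathcal F}(\tilde f)$ is the set of $\xi\in\mathbb R$ such that $\lambda\mapsto R(\lambda,\tilde{\mathcal D})\tilde f$, on $\mathbb C\setminus i\mathbb R$, has no holomorphic extension to any neighborhood of $i\xi$ in $\mathbb C$. $\Lambda^e_{\mathcal F}(\mathbb X)=\{\tilde f\in\mathbb Y: sp^+_{\mathcal F}(\tilde f)\subset\Lambda,\ \lim_{\alpha\downarrow0}\alpha R(\alpha+i\xi,\tilde{\mathcal D})\tilde f=\tilde0\text{ for all }\xi\in\Lambda\}$. $\tilde{\mathcal D}_\Lambda$ is the restriction (part) of $\tilde{\mathcal D}$ to $\Lambda^e_{\mathcal F}(\mathbb X)$, i.e. with domain $\{\tilde f\in D(\tilde{\mathcal D})\cap\Lambda^e_{\mathcal F}(\mathbb X):\tilde{\mathcal D}\tilde f\in\Lambda^e_{\mathcal F}(\mathbb X)\}$. *)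

(* Defs.v *)
From Stdlib Require Export Reals.
From Stdlib Require Import Lra ClassicalEpsilon FunctionalExtensionality
  PropExtensionality ProofIrrelevance.
From Coquelicot Require Export Coquelicot.
Open Scope R_scope.

Definition Cexp (z : C) : C :=
  (exp (Re z) * cos (Im z), exp (Re z) * sin (Im z)).

(* Coquelicot integrates and differentiates functions of a real variable only
   with values in real spaces, so a complex Banach space is also viewed as a real
   one, with the same carrier, uniform structure and norm. *)
Section RestrictScalars.
Variable X : CompleteNormedModule C_AbsRing.

Definition real_scal (r : R) (x : X) : X := scal (RtoC r) x.

Lemma real_scal_assoc (a b : R) (x : X) :
  real_scal a (real_scal b x) = real_scal (mult a b) x.
Proof.
  unfold real_scal. rewrite scal_assoc. f_equal. symmetry. apply RtoC_mult.
Qed.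

Lemma real_scal_one (x : X) : real_scal one x = x.
Proof. exact (scal_one x). Qed.

Lemma real_scal_plus_l (a : R) (x y : X) :
  real_scal a (plus x y) = plus (real_scal a x) (real_scal a y).
Proof. exact (scal_distr_l (RtoC a) x y). Qed.

Lemma real_scal_plus_r (a b : R) (x : X) :
  real_scal (plus a b) x = plus (real_scal a x) (real_scal b x).
Proof.
  unfold real_scal. eapply eq_trans; [|exact (scal_distr_r (RtoC a) (RtoC b) x)].
  f_equal. apply RtoC_plus.
Qed.

Definition real_ModuleSpace_mixin : ModuleSpace.mixin_of R_Ring X :=
  ModuleSpace.Mixin R_Ring X real_scal
    real_scal_assoc real_scal_one real_scal_plus_l real_scal_plus_r.

Definition real_ModuleSpace : ModuleSpace R_Ring :=
  ModuleSpace.Pack R_Ring X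
    (ModuleSpace.Class R_Ring X (AbelianGroup.class X) real_ModuleSpace_mixin) X.

Definition real_NormedModuleAux : NormedModuleAux R_AbsRing :=
  NormedModuleAux.Pack R_AbsRing X
    (NormedModuleAux.Class R_AbsRing X
      (ModuleSpace.class R_Ring real_ModuleSpace) (UniformSpace.class X)) X.

Lemma real_norm_scal (r : R) (x : X) :
  norm (real_scal r x) <= Rabs r * norm x.
Proof.
  unfold real_scal. rewrite <- Cmod_R. exact (norm_scal (RtoC r) x).
Qed.

Definition real_NormedModule_mixin :
  NormedModule.mixin_of R_AbsRing real_NormedModuleAux :=
  NormedModule.Mixin R_AbsRing real_NormedModuleAux
    (fun x : X => norm x) (norm_factor (V := X))
    (norm_triangle (V := X)) real_norm_scal
    (norm_compat1 (V := X)) (norm_compat2 (V := X)) (norm_eq_zero (V := X)).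

Definition restrict_scalars : CompleteNormedModule R_AbsRing :=
  CompleteNormedModule.Pack R_AbsRing X
    (CompleteNormedModule.Class R_AbsRing X
      (NormedModule.Class R_AbsRing X
        (NormedModuleAux.class R_AbsRing real_NormedModuleAux)
        real_NormedModule_mixin)
      (CompleteNormedModule.mixin C_AbsRing X
        (CompleteNormedModule.class C_AbsRing X))) X.

End RestrictScalars.

(* A module with a norm becomes a uniform space through the balls
   [norm (y - x) < eps]. *)
Section NormTopology.
Variables (K : AbsRing) (V : ModuleSpace K) (N : V -> R).
Hypothesis N_triangle : forall x y, N (plus x y) <= N x + N y.
Hypothesis N_scal : forall (k : K) x, N (scal k x) <= abs k * N x.
Hypothesis N_eq_zero : forall x, N x = 0 -> x = zero.

Definition norm_ball (x : V) (eps : R) (y : V) : Prop := N (minus y x) < eps.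

Lemma N_zero : N zero = 0.
Proof.
  assert (H0 : N zero <= 0).
  { rewrite <- (scal_zero_l (V := V) zero) at 1.
    eapply Rle_trans; [apply N_scal|]. apply Req_le.
    rewrite <- (Rmult_0_l (N zero)). f_equal. exact (abs_zero (K := K)). }
  assert (H1 := N_triangle zero zero). rewrite plus_zero_l in H1. lra.
Qed.

Lemma N_opp (x : V) : N (opp x) <= N x.
Proof.
  rewrite <- scal_opp_one. eapply Rle_trans; [apply N_scal|].
  replace (abs (opp one)) with 1 by (symmetry; exact (abs_opp_one (K := K))). lra.
Qed.

Lemma norm_ball_center (x : V) (e : posreal) : norm_ball x e x.
Proof.
  unfold norm_ball. rewrite minus_eq_zero.
  eapply Rle_lt_trans; [apply Req_le, N_zero | apply cond_pos].
Qed.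

Lemma norm_ball_sym (x y : V) (e : R) : norm_ball x e y -> norm_ball y e x.
Proof.
  unfold norm_ball. intro H. rewrite <- opp_minus.
  eapply Rle_lt_trans; [apply N_opp | exact H].
Qed.

Lemma norm_ball_triangle (x y z : V) (e1 e2 : R) :
  norm_ball x e1 y -> norm_ball y e2 z -> norm_ball x (e1 + e2) z.
Proof.
  unfold norm_ball. intros H1 H2. rewrite (minus_trans y z x).
  eapply Rle_lt_trans; [apply N_triangle | lra].
Qed.

Definition norm_UniformSpace_mixin : UniformSpace.mixin_of V :=
  UniformSpace.Mixin V zero norm_ball
    norm_ball_center norm_ball_sym norm_ball_triangle.

Definition norm_NormedModuleAux : NormedModuleAux K :=
  NormedModuleAux.Pack K V
    (NormedModuleAux.Class K V (ModuleSpace.class K V)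
      norm_UniformSpace_mixin) V.

Lemma norm_ball_compat1 (x y : norm_NormedModuleAux) (eps : R) :
  N (minus y x) < eps -> ball x eps y.
Proof. exact (fun H => H). Qed.

Lemma norm_ball_compat2 (x y : norm_NormedModuleAux) (eps : posreal) :
  ball x eps y -> N (minus y x) < 1 * eps.
Proof. rewrite Rmult_1_l. exact (fun H => H). Qed.

Definition norm_NormedModule_mixin :
  NormedModule.mixin_of K norm_NormedModuleAux :=
  NormedModule.Mixin K norm_NormedModuleAux N 1 N_triangle N_scal
    norm_ball_compat1 norm_ball_compat2 N_eq_zero.

End NormTopology.

(* An element of BC(R^+, X) is encoded by the extension of the function to R that
   is constant on (-oo, 0]. Every bounded continuous function on [0, oo) has
   exactly one such extension, so that Leibniz equality is equality on [0, oo). *)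
Record BC (X : CompleteNormedModule C_AbsRing) := mkBC {
  bc_fun :> R -> X;
  bc_const : forall t, t <= 0 -> bc_fun t = bc_fun 0;
  bc_cont : forall t, continuous bc_fun t;
  bc_bounded : exists M, forall t, norm (bc_fun t) <= M
}.
Arguments mkBC {X} _ _ _ _.
Arguments bc_fun {X} _ _.

Section BCSpace.
Variable X : CompleteNormedModule C_AbsRing.

Lemma BC_ext (f g : BC X) : (forall t, f t = g t) -> f = g.
Proof.
  destruct f as [f f1 f2 f3], g as [g g1 g2 g3]; simpl; intro H.
  assert (E : f = g) by (apply functional_extensionality; exact H).
  destruct E. f_equal; apply proof_irrelevance.
Qed.

Definition BC_zero : BC X.
Proof.
  refine (mkBC (fun _ => zero) _ _ _).
  - reflexivity.
  - intro t. apply continuous_const.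
  - exists 0. intros _. apply Req_le, (norm_zero (V := X)).
Defined.

Definition BC_plus (f g : BC X) : BC X.
Proof.
  refine (mkBC (fun t => plus (f t) (g t)) _ _ _).
  - intros t Ht. rewrite (bc_const X f t Ht), (bc_const X g t Ht). reflexivity.
  - intro t.
    exact (continuous_plus (V := X) f g t (bc_cont X f t) (bc_cont X g t)).
  - destruct (bc_bounded X f) as [M HM], (bc_bounded X g) as [M' HM'].
    exists (M + M'). intro t. eapply Rle_trans; [apply (norm_triangle (V := X))|].
    apply Rplus_le_compat; auto.
Defined.

Definition BC_scal (k : C) (f : BC X) : BC X.
Proof.
  refine (mkBC (fun t => scal k (f t)) _ _ _).
  - intros t Ht. rewrite (bc_const X f t Ht). reflexivity.
  - intro t. apply (continuous_scal_r (V := X) k f t). apply bc_cont.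
  - destruct (bc_bounded X f) as [M HM].
    exists (Cmod k * M). intro t. eapply Rle_trans; [apply (norm_scal (V := X) k (f t))|].
    apply Rmult_le_compat_l; [apply Cmod_ge_0 | auto].
Defined.

Definition BC_opp (f : BC X) : BC X := BC_scal (opp one) f.

Lemma BC_plus_comm (f g : BC X) : BC_plus f g = BC_plus g f.
Proof. apply BC_ext; intro t. apply plus_comm. Qed.
Lemma BC_plus_assoc (f g h : BC X) :
  BC_plus f (BC_plus g h) = BC_plus (BC_plus f g) h.
Proof. apply BC_ext; intro t. apply plus_assoc. Qed.
Lemma BC_plus_zero_r (f : BC X) : BC_plus f BC_zero = f.
Proof. apply BC_ext; intro t. apply plus_zero_r. Qed.
Lemma BC_plus_opp_r (f : BC X) : BC_plus f (BC_opp f) = BC_zero.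
Proof.
  apply BC_ext; intro t. simpl. eapply eq_trans; [|apply (plus_opp_r (f t))].
  f_equal. exact (scal_opp_one (V := X) (f t)).
Qed.
Lemma BC_scal_assoc (a b : C) (f : BC X) :
  BC_scal a (BC_scal b f) = BC_scal (mult a b) f.
Proof. apply BC_ext; intro t. apply (scal_assoc (V := X) a b (f t)). Qed.
Lemma BC_scal_one (f : BC X) : BC_scal one f = f.
Proof. apply BC_ext; intro t. apply (scal_one (V := X) (f t)). Qed.
Lemma BC_scal_distr_l (a : C) (f g : BC X) :
  BC_scal a (BC_plus f g) = BC_plus (BC_scal a f) (BC_scal a g).
Proof. apply BC_ext; intro t. apply (scal_distr_l (V := X) a (f t) (g t)). Qed.
Lemma BC_scal_distr_r (a b : C) (f : BC X) :
  BC_scal (plus a b) f = BC_plus (BC_scal a f) (BC_scal b f).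
Proof. apply BC_ext; intro t. apply (scal_distr_r (V := X) a b (f t)). Qed.

Canonical BC_AbelianMonoid : AbelianMonoid :=
  AbelianMonoid.Pack (BC X)
    (AbelianMonoid.Mixin (BC X) BC_plus BC_zero
      BC_plus_comm BC_plus_assoc BC_plus_zero_r) (BC X).

Canonical BC_AbelianGroup : AbelianGroup :=
  AbelianGroup.Pack (BC X)
    (AbelianGroup.Class (BC X) (AbelianMonoid.class BC_AbelianMonoid)
      (AbelianGroup.Mixin BC_AbelianMonoid BC_opp BC_plus_opp_r)) (BC X).

Canonical BC_ModuleSpace : ModuleSpace C_AbsRing :=
  ModuleSpace.Pack C_AbsRing (BC X)
    (ModuleSpace.Class C_AbsRing (BC X) (AbelianGroup.class BC_AbelianGroup)
      (ModuleSpace.Mixin C_AbsRing BC_AbelianGroup BC_scal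
        BC_scal_assoc BC_scal_one BC_scal_distr_l BC_scal_distr_r)) (BC X).

Definition sup_norm (f : BC X) : R :=
  real (Lub_Rbar (fun r => exists t, r = norm (f t))).

Lemma sup_norm_finite (f : BC X) :
  is_lub_Rbar (fun r => exists t, r = norm (f t)) (sup_norm f).
Proof.
  unfold sup_norm.
  generalize (Lub_Rbar_correct (fun r => exists t, r = norm (f t))).
  destruct (Lub_Rbar (fun r => exists t, r = norm (f t))) as [l| |];
    intros [H1 H2]; simpl.
  - split; assumption.
  - destruct (bc_bounded X f) as [M HM].
    destruct (H2 (Finite M)). intros r [t ->]. apply HM.
  - destruct (H1 (norm (f 0))). exists 0. reflexivity.
Qed.

Lemma sup_norm_ub (f : BC X) (t : R) : norm (f t) <= sup_norm f.
Proof. apply (proj1 (sup_norm_finite f)). exists t. reflexivity. Qed.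

Lemma sup_norm_le (f : BC X) (M : R) :
  (forall t, norm (f t) <= M) -> sup_norm f <= M.
Proof.
  intro H. apply (proj2 (sup_norm_finite f) (Finite M)). intros r [t ->]. apply H.
Qed.

Lemma sup_norm_triangle (f g : BC X) :
  sup_norm (plus f g) <= sup_norm f + sup_norm g.
Proof.
  apply sup_norm_le. intro t. eapply Rle_trans; [apply (norm_triangle (V := X))|].
  apply Rplus_le_compat; apply sup_norm_ub.
Qed.

Lemma sup_norm_scal (k : C_AbsRing) (f : BC X) :
  sup_norm (scal k f) <= abs k * sup_norm f.
Proof.
  apply sup_norm_le. intro t. eapply Rle_trans; [apply (norm_scal (V := X) k (f t))|].
  apply Rmult_le_compat_l; [apply abs_ge_0 | apply sup_norm_ub].
Qed.

Lemma sup_norm_eq_zero (f : BC X) : sup_norm f = 0 -> f = zero.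
Proof.
  intro H. apply BC_ext. intro t. apply (norm_eq_zero (V := X) (f t)).
  generalize (sup_norm_ub f t) (norm_ge_0 (V := X) (f t)). lra.
Qed.

Canonical BC_UniformSpace : UniformSpace :=
  UniformSpace.Pack (BC X)
    (norm_UniformSpace_mixin C_AbsRing BC_ModuleSpace sup_norm
      sup_norm_triangle sup_norm_scal) (BC X).

Canonical BC_NormedModuleAux : NormedModuleAux C_AbsRing :=
  NormedModuleAux.Pack C_AbsRing (BC X)
    (NormedModuleAux.Class C_AbsRing (BC X)
      (ModuleSpace.class C_AbsRing BC_ModuleSpace)
      (UniformSpace.class BC_UniformSpace)) (BC X).

Canonical BC_NormedModule : NormedModule C_AbsRing :=
  NormedModule.Pack C_AbsRing (BC X)
    (NormedModule.Class C_AbsRing (BC X)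
      (NormedModuleAux.class C_AbsRing BC_NormedModuleAux)
      (norm_NormedModule_mixin C_AbsRing BC_ModuleSpace sup_norm
        sup_norm_triangle sup_norm_scal sup_norm_eq_zero)) (BC X).

End BCSpace.

Record closed_subspace {K : AbsRing} {V : NormedModule K} (W : V -> Prop) : Prop := {
  subspace_zero : W zero;
  subspace_plus : forall x y, W x -> W y -> W (plus x y);
  subspace_scal : forall (k : K) x, W x -> W (scal k x);
  subspace_closed : closed W
}.

Record coset {K : AbsRing} {V : NormedModule K} (W : V -> Prop) := mkCoset {
  coset_set : V -> Prop;
  coset_ex : exists x, forall y, coset_set y <-> W (minus y x)
}.
Arguments coset_set {K V W} _ _.
Arguments coset_ex {K V W} _.

Lemma minus_plus_plus {G : AbelianGroup} (a b c d : G) :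
  minus (plus a b) (plus c d) = plus (minus a c) (minus b d).
Proof.
  unfold minus. rewrite opp_plus, <- !plus_assoc. f_equal.
  rewrite !plus_assoc. f_equal. apply plus_comm.
Qed.

Lemma minus_minus_self {G : AbelianGroup} (a b : G) :
  minus (minus a b) a = opp b.
Proof.
  unfold minus. rewrite (plus_comm (plus a _) (opp a)), plus_assoc.
  eapply eq_trans; [|exact (plus_zero_l (opp b))]. f_equal. exact (plus_opp_l a).
Qed.

Section Quotient.
Variables (K : AbsRing) (V : NormedModule K) (W : V -> Prop).
Hypothesis HW : closed_subspace W.

Definition coset_of (x : V) : coset W :=
  mkCoset K V W (fun y => W (minus y x)) (ex_intro _ x (fun y => iff_refl _)).

Definition repr (q : coset W) : V :=
  proj1_sig (constructive_indefinite_description _ (coset_ex q)).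

Lemma coset_ext (p q : coset W) :
  (forall y, coset_set p y <-> coset_set q y) -> p = q.
Proof.
  destruct p as [p Hp], q as [q Hq]; simpl; intro H.
  assert (E : p = q).
  { apply functional_extensionality; intro y.
    apply propositional_extensionality, H. }
  destruct E. f_equal; apply proof_irrelevance.
Qed.

Lemma class_repr (q : coset W) : coset_of (repr q) = q.
Proof.
  apply coset_ext. intro y. symmetry.
  exact (proj2_sig (constructive_indefinite_description _ (coset_ex q)) y).
Qed.

Lemma subspace_opp (x : V) : W x -> W (opp x).
Proof.
  intro H. replace (opp x) with (scal (opp one) x) by exact (scal_opp_one x).
  apply (subspace_scal W HW); assumption.
Qed.

Lemma class_eq (x y : V) : coset_of x = coset_of y <-> W (minus x y).
Proof.
  split.
  - intro H. change (coset_set (coset_of y) x). rewrite <- H. simpl.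
    rewrite minus_eq_zero. exact (subspace_zero W HW).
  - intro H. apply coset_ext. intro z. simpl. split; intro Hz.
    + rewrite (minus_trans x z y). apply (subspace_plus W HW); assumption.
    + rewrite (minus_trans y z x). apply (subspace_plus W HW); [exact Hz |].
      rewrite <- opp_minus. apply subspace_opp. exact H.
Qed.

Lemma repr_class (x : V) : W (minus (repr (coset_of x)) x).
Proof. apply class_eq. apply class_repr. Qed.

Definition quot_plus (p q : coset W) : coset W := coset_of (plus (repr p) (repr q)).
Definition quot_opp (p : coset W) : coset W := coset_of (opp (repr p)).
Definition quot_scal (k : K) (p : coset W) : coset W := coset_of (scal k (repr p)).

Lemma class_plus (x y : V) :
  quot_plus (coset_of x) (coset_of y) = coset_of (plus x y).
Proof.
  apply class_eq.
  exact (eq_ind_r W (subspace_plus W HW _ _ (repr_class x) (repr_class y))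
    (minus_plus_plus (repr (coset_of x)) (repr (coset_of y)) x y)).
Qed.

Lemma class_scal (k : K) (x : V) : quot_scal k (coset_of x) = coset_of (scal k x).
Proof.
  apply class_eq.
  exact (eq_ind _ W (subspace_scal W HW k _ (repr_class x)) _
    (scal_minus_distr_l k (repr (coset_of x)) x)).
Qed.

Lemma class_opp (x : V) : quot_opp (coset_of x) = coset_of (opp x).
Proof.
  unfold quot_opp. eapply eq_trans; [|eapply eq_trans; [exact (class_scal (opp one) x)|]].
  - unfold quot_scal. f_equal. symmetry. exact (scal_opp_one (repr (coset_of x))).
  - f_equal. exact (scal_opp_one x).
Qed.

Lemma coset_ind_class (P : coset W -> Prop) :
  (forall x, P (coset_of x)) -> forall q, P q.
Proof. intros H q. rewrite <- (class_repr q). apply H. Qed.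

Lemma quot_plus_comm (p q : coset W) : quot_plus p q = quot_plus q p.
Proof. unfold quot_plus. f_equal. exact (plus_comm _ _). Qed.
Lemma quot_plus_assoc (p q r : coset W) :
  quot_plus p (quot_plus q r) = quot_plus (quot_plus p q) r.
Proof.
  revert p q r; do 3 (refine (coset_ind_class _ _); intro).
  rewrite !class_plus. f_equal. exact (plus_assoc _ _ _).
Qed.
Lemma quot_plus_zero_r (p : coset W) : quot_plus p (coset_of zero) = p.
Proof.
  revert p; refine (coset_ind_class _ _); intro.
  rewrite class_plus. f_equal. exact (plus_zero_r _).
Qed.
Lemma quot_plus_opp_r (p : coset W) : quot_plus p (quot_opp p) = coset_of zero.
Proof.
  revert p; refine (coset_ind_class _ _); intro.
  rewrite class_opp, class_plus. f_equal. exact (plus_opp_r _).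
Qed.
Lemma quot_scal_assoc (a b : K) (p : coset W) :
  quot_scal a (quot_scal b p) = quot_scal (mult a b) p.
Proof.
  revert p; refine (coset_ind_class _ _); intro.
  rewrite !class_scal. f_equal. exact (scal_assoc a b _).
Qed.
Lemma quot_scal_one (p : coset W) : quot_scal one p = p.
Proof.
  revert p; refine (coset_ind_class _ _); intro.
  rewrite class_scal. f_equal. exact (scal_one _).
Qed.
Lemma quot_scal_distr_l (a : K) (p q : coset W) :
  quot_scal a (quot_plus p q) = quot_plus (quot_scal a p) (quot_scal a q).
Proof.
  revert p q; do 2 (refine (coset_ind_class _ _); intro).
  rewrite class_plus, !class_scal, class_plus. f_equal. exact (scal_distr_l a _ _).
Qed.
Lemma quot_scal_distr_r (a b : K) (p : coset W) :
  quot_scal (plus a b) p = quot_plus (quot_scal a p) (quot_scal b p).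
Proof.
  revert p; refine (coset_ind_class _ _); intro.
  rewrite !class_scal, class_plus. f_equal. exact (scal_distr_r a b _).
Qed.

Definition quot_AbelianMonoid : AbelianMonoid :=
  AbelianMonoid.Pack (coset W)
    (AbelianMonoid.Mixin (coset W) quot_plus (coset_of zero)
      quot_plus_comm quot_plus_assoc quot_plus_zero_r) (coset W).

Definition quot_AbelianGroup : AbelianGroup :=
  AbelianGroup.Pack (coset W)
    (AbelianGroup.Class (coset W) (AbelianMonoid.class quot_AbelianMonoid)
      (AbelianGroup.Mixin quot_AbelianMonoid quot_opp quot_plus_opp_r)) (coset W).

Definition quot_ModuleSpace : ModuleSpace K :=
  ModuleSpace.Pack K (coset W)
    (ModuleSpace.Class K (coset W) (AbelianGroup.class quot_AbelianGroup)
      (ModuleSpace.Mixin K quot_AbelianGroup quot_scal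
        quot_scal_assoc quot_scal_one quot_scal_distr_l quot_scal_distr_r))
    (coset W).

Definition quot_norm (q : coset W) : R :=
  real (Glb_Rbar (fun r => exists x, coset_set q x /\ r = norm x)).

Lemma mem_class (q : coset W) (x : V) : coset_set q x <-> coset_of x = q.
Proof.
  revert q; refine (coset_ind_class _ _); intro y. rewrite class_eq. reflexivity.
Qed.

Lemma quot_norm_finite (q : coset W) :
  is_glb_Rbar (fun r => exists x, coset_set q x /\ r = norm x) (quot_norm q).
Proof.
  unfold quot_norm.
  generalize (Glb_Rbar_correct (fun r => exists x, coset_set q x /\ r = norm x)).
  destruct (Glb_Rbar (fun r => exists x, coset_set q x /\ r = norm x)) as [l| |];
    intros [H1 H2]; simpl.
  - split; assumption.
  - destruct (H1 (norm (repr q))). exists (repr q). split; [|reflexivity].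
    apply mem_class, class_repr.
  - destruct (H2 (Finite 0)). intros r [x [_ ->]]. apply norm_ge_0.
Qed.

Lemma quot_norm_le (x : V) : quot_norm (coset_of x) <= norm x.
Proof.
  apply (proj1 (quot_norm_finite (coset_of x))). exists x.
  split; [apply mem_class|]; reflexivity.
Qed.

Lemma quot_norm_approx (q : coset W) (eps : R) :
  0 < eps -> exists x, coset_of x = q /\ norm x < quot_norm q + eps.
Proof.
  intro He.
  destruct (classic (exists x, coset_of x = q /\ norm x < quot_norm q + eps))
    as [H|H]; [exact H|].
  assert (L : Rbar_le (Finite (quot_norm q + eps)) (Finite (quot_norm q))).
  { apply (proj2 (quot_norm_finite q)). intros r [x [Hx ->]]. simpl.
    apply Rnot_lt_le. intro Hlt. apply H. exists x.
    split; [apply mem_class|]; assumption. }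
  simpl in L. lra.
Qed.

Lemma quot_norm_triangle (p q : quot_ModuleSpace) :
  quot_norm (plus p q) <= quot_norm p + quot_norm q.
Proof.
  apply le_epsilon. intros eps He.
  destruct (quot_norm_approx p (eps / 2)) as [x [Ex Hx]]; [lra|].
  destruct (quot_norm_approx q (eps / 2)) as [y [Ey Hy]]; [lra|].
  change (plus p q) with (quot_plus p q). rewrite <- Ex, <- Ey, class_plus.
  rewrite Ex, Ey. generalize (quot_norm_le (plus x y)) (norm_triangle x y). lra.
Qed.

Lemma quot_norm_scal (k : K) (q : quot_ModuleSpace) :
  quot_norm (scal k q) <= abs k * quot_norm q.
Proof.
  apply le_epsilon. intros eps He.
  assert (Hk := abs_ge_0 k).
  destruct (quot_norm_approx q (eps / (abs k + 1))) as [x [Ex Hx]].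
  { apply Rdiv_lt_0_compat; lra. }
  change (scal k q) with (quot_scal k q). rewrite <- Ex, class_scal, Ex.
  eapply Rle_trans; [apply quot_norm_le|].
  eapply Rle_trans; [apply norm_scal|].
  apply Rle_trans with (abs k * (quot_norm q + eps / (abs k + 1))).
  { apply Rmult_le_compat_l; lra. }
  rewrite Rmult_plus_distr_l. apply Rplus_le_compat_l.
  replace eps with ((abs k + 1) * (eps / (abs k + 1))) at 2 by (field; lra).
  apply Rmult_le_compat_r; [|lra].
  apply Rlt_le, Rdiv_lt_0_compat; lra.
Qed.

Lemma quot_norm_eq_zero (q : quot_ModuleSpace) : quot_norm q = 0 -> q = zero.
Proof.
  intro H. rewrite <- (class_repr q). apply class_eq.
  apply (subspace_closed W HW). intros [e He].
  destruct (quot_norm_approx q e (cond_pos e)) as [x [Ex Hx]].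
  rewrite H, Rplus_0_l in Hx.
  apply (He (minus (minus (repr q) zero) x)).
  - apply norm_compat1. eapply Rle_lt_trans; [|exact Hx]. apply Req_le.
    eapply eq_trans; [|exact (norm_opp x)]. f_equal.
    exact (minus_minus_self (minus (repr q) zero) x).
  - refine (eq_ind_r (fun v => W (minus v x)) _ (minus_zero_r (repr q))).
    apply class_eq. rewrite class_repr. symmetry. exact Ex.
Qed.

Definition quotient : NormedModule K :=
  NormedModule.Pack K (coset W)
    (NormedModule.Class K (coset W)
      (NormedModuleAux.class K
        (norm_NormedModuleAux K quot_ModuleSpace quot_norm
          quot_norm_triangle quot_norm_scal))
      (norm_NormedModule_mixin K quot_ModuleSpace quot_norm
        quot_norm_triangle quot_norm_scal quot_norm_eq_zero)) (coset W).

End Quotient.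
Arguments quotient {K V W} HW.

(* A possibly multivalued linear operator on [V] is given by its graph [A]:
   [A x y] means that x is in the domain and that y is a value of A at x. *)
Section Operators.
Context {V : NormedModule C_AbsRing}.

(* (lam - A)^{-1} f, the solution g of lam g - A g = f; meaningful when there is
   exactly one. *)
Definition resolvent (A : V -> V -> Prop) (lam : C) (f : V) : V :=
  epsilon (inhabits zero) (fun g => A g (minus (scal lam g) f)).

Definition part (A : V -> V -> Prop) (E : V -> Prop) (x y : V) : Prop :=
  E x /\ E y /\ A x y.

(* For A in E: lam - A is a bijection of the domain onto E with bounded inverse. *)
Definition resolvent_set (E : V -> Prop) (A : V -> V -> Prop) (lam : C) : Prop :=
  (forall f, E f -> exists! g, E g /\ A g (minus (scal lam g) f)) /\
  (exists M, forall f g, E f -> E g -> A g (minus (scal lam g) f) ->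
     norm g <= M * norm f).

Definition spectrum (E : V -> Prop) (A : V -> V -> Prop) (lam : C) : Prop :=
  ~ resolvent_set E A lam.

Definition holomorphic_on (U : C -> Prop) (Phi : C -> V) : Prop :=
  forall z : C, U z -> ex_derive (K := C_AbsRing) Phi z.

End Operators.

Section HalfLine.
Context {X : CompleteNormedModule C_AbsRing}.
Implicit Types (F : BC X -> Prop) (f g h : BC X).

(* The restriction of phi to [0, oo) is an element of F; the values of phi on the
   negative half-line are irrelevant. *)
Definition belongs F (phi : R -> X) : Prop :=
  exists f, F f /\ forall t, 0 <= t -> f t = phi t.

Record condition_Fplus F : Prop := {
  Fplus_subspace : closed_subspace F;
  Fplus_C0 : forall f,
    filterlim f (Rbar_locally p_infty) (locally (zero : X)) -> F f;
  Fplus_mult : forall g (xi : R), F g ->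
    belongs F (fun t => scal (Cexp (0, xi * t)) (g t));
  Fplus_int_infty : forall h (lam : C), F h -> 0 < Re lam ->
    belongs F (fun t => RInt_gen (V := restrict_scalars X)
      (fun s => scal (Cexp (lam * RtoC (t - s))%C) (h s))
      (at_point t) (Rbar_locally p_infty));
  Fplus_int_zero : forall h (eta : C), F h -> Re eta < 0 ->
    belongs F (fun t => RInt (V := restrict_scalars X)
      (fun s => scal (Cexp (eta * RtoC (t - s))%C) (h s)) 0 t);
  Fplus_oper : forall (B : X -> X) f, is_linear B -> F f ->
    belongs F (fun t => B (f t))
}.

(* g' is the derivative of g on [0, oo), one-sided at 0. *)
Definition derivative_on_Rplus (g g' : BC X) : Prop :=
  forall t, 0 <= t ->
    filterdiff (K := R_AbsRing) (V := restrict_scalars X) g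
      (within (Rle 0) (locally t)) (fun s => scal s (g' t : restrict_scalars X)).

Section Classes.
Context {F : BC X -> Prop} (HF : condition_Fplus F).

Definition Y : NormedModule C_AbsRing := quotient (Fplus_subspace F HF).

Definition cls (f : BC X) : Y := coset_of C_AbsRing (BC_NormedModule X) F f.

(* The derivation on Y is kept as a graph: two differentiable functions in the
   same class may have derivatives in different classes, e.g. for F = C_0,
   0 and sin(t^2)/(1+t). *)
Definition Dtilde (p q : Y) : Prop :=
  exists g g' : BC X, derivative_on_Rplus g g' /\ cls g = p /\ cls g' = q.

Definition reduced_spectrum (p : Y) (xi : R) : Prop :=
  ~ exists (U : C -> Prop) (Phi : C -> Y),
      open U /\ U (0, xi) /\ holomorphic_on U Phi /\
      forall lam, U lam -> Re lam <> 0 -> Phi lam = resolvent Dtilde lam p.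

Definition Lambda_e (Lambda : R -> Prop) (p : Y) : Prop :=
  (forall xi, reduced_spectrum p xi -> Lambda xi) /\
  (forall xi, Lambda xi ->
     filterlim (fun alpha : R => scal (RtoC alpha) (resolvent Dtilde (alpha, xi) p))
       (at_right 0) (locally (zero : Y))).

Definition D_Lambda (Lambda : R -> Prop) : Y -> Y -> Prop :=
  part Dtilde (Lambda_e Lambda).

End Classes.
End HalfLine.

(* Main.v *)
(* For Re z <> 0 the equation D g = z g - f has a unique solution in BC/F, of norm at
   most |f| / |Re z|; hence R(z) is a pseudo-resolvent off the imaginary axis, and
   everything is deduced from this, D itself being multivalued in general. A point i xi is
   outside the spectrum of f as soon as R(z) f has a limit as z tends to each point of the
   axis near i xi. The heart of the proof is a bound for these limits: if R(z) f extends
   continuously to the axis near i xi, then the value v at i xi satisfies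
   |v| <= (104 / r) |f|, where r is the size of the neighbourhood. This follows from Cauchy's
   theorem on a square with the weight r^2 + (z - i xi)^2, whose zeros on the axis balance
   the growth 1 / |Re z|. With the resolvent identity the bound shows that the extension is
   holomorphic and that the set of f with extensions off Lambda is closed. At z = i xi with
   xi outside Lambda, the map f |-> v is then a bounded inverse of z - D on Lambda_e. *)

Require Import Defs.
From Stdlib Require Import Lra Lia List ClassicalEpsilon FunctionalExtensionality
  PropExtensionality.

(** * Linear identities in complex modules *)

(** The bound near the axis has to be explicit, in terms of the radius alone. The vectors [f] with
    an extension near [i xi] are not yet known to form a closed set, so neither Banach-Steinhaus nor
    the closed graph theorem is at hand, and the extension of a single [f] carries no a priori
    estimate. The contour integral is taken of [Res z (Res w f)] rather than of [Res z f / (z - w)].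
    By the resolvent identity they agree up to sign and the term [Res w f / (z - w)], but the former
    has no pole at [w]. Hence Cauchy's theorem on rectangles off the axis suffices, and the residue
    turns into the integral of a scalar rational function, of which only the imaginary part is
    estimated. The working notion is the existence of limits at the axis, not holomorphy: limits
    pass easily to sums, resolvents and, by the bound, to norm limits of [f]. Holomorphy is
    recovered at the end by applying the same bound to [Res w f - Res w' f]. *)

Section ModuleEquations.
Context {V : ModuleSpace C_Ring}.

(** Syntax for proof by reflection: a linear identity between vectors reduces to one identity in C
    for each atom. *)
Inductive mexp :=
| MVar (n : nat) | MZero | MPlus (a b : mexp) | MMinus (a b : mexp)
| MOpp (a : mexp) | MScal (k : C) (a : mexp).

Fixpoint mdenote (env : list V) (e : mexp) : V :=
  match e with
  | MVar n => nth n env zero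
  | MZero => zero
  | MPlus a b => plus (mdenote env a) (mdenote env b)
  | MMinus a b => minus (mdenote env a) (mdenote env b)
  | MOpp a => opp (mdenote env a)
  | MScal k a => scal k (mdenote env a)
  end.

Fixpoint mcoef (e : mexp) (n : nat) : C :=
  match e with
  | MVar m => if Nat.eqb m n then 1%C else 0%C
  | MZero => 0%C
  | MPlus a b => (mcoef a n + mcoef b n)%C
  | MMinus a b => (mcoef a n - mcoef b n)%C
  | MOpp a => (- mcoef a n)%C
  | MScal k a => (k * mcoef a n)%C
  end.

Fixpoint mcomb (c : nat -> C) (env : list V) : V :=
  match env with
  | nil => zero
  | v :: r => plus (scal (c 0%nat) v) (mcomb (fun n => c (S n)) r)
  end.

Lemma mcomb_ext (env : list V) (c d : nat -> C) :
  (forall n, (n < length env)%nat -> c n = d n) -> mcomb c env = mcomb d env.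
Proof.
  revert c d; induction env as [|v r IH]; intros c d H; simpl; [reflexivity|].
  rewrite (H 0%nat) by (simpl; lia). f_equal. apply IH. intros n Hn.
  apply H. simpl; lia.
Qed.

Lemma mcomb_zero (env : list V) : mcomb (fun _ => 0%C) env = zero.
Proof.
  induction env as [|v r IH]; simpl; [reflexivity|]. rewrite IH, plus_zero_r.
  exact (scal_zero_l v).
Qed.

Lemma mcomb_plus (env : list V) (c d : nat -> C) :
  mcomb (fun n => c n + d n)%C env = plus (mcomb c env) (mcomb d env).
Proof.
  revert c d; induction env as [|v r IH]; intros c d; simpl.
  - rewrite plus_zero_r; reflexivity.
  - rewrite (IH (fun n => c (S n)) (fun n => d (S n))).
    replace (scal (c 0%nat + d 0%nat)%C v)
      with (plus (scal (c 0%nat) v) (scal (d 0%nat) v))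
      by (symmetry; exact (scal_distr_r (c 0%nat) (d 0%nat) v)).
    rewrite <- !plus_assoc. f_equal. rewrite !plus_assoc. f_equal. apply plus_comm.
Qed.

Lemma mcomb_scal (env : list V) (k : C) (c : nat -> C) :
  mcomb (fun n => k * c n)%C env = scal k (mcomb c env).
Proof.
  revert c; induction env as [|v r IH]; intros c; simpl.
  - symmetry; apply (scal_zero_r (V := V)).
  - rewrite (IH (fun n => c (S n))), scal_distr_l. f_equal.
    symmetry. exact (scal_assoc k (c 0%nat) v).
Qed.

Lemma mcomb_opp (env : list V) (c : nat -> C) :
  mcomb (fun n => - c n)%C env = opp (mcomb c env).
Proof.
  rewrite <- scal_opp_one. rewrite <- (mcomb_scal env (opp one)).
  apply mcomb_ext. intros n _. change (- c n = - (1) * c n)%C. ring.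
Qed.

Lemma mcomb_var (env : list V) (m : nat) :
  mcomb (fun n => if Nat.eqb m n then 1%C else 0%C) env = nth m env zero.
Proof.
  revert m; induction env as [|v r IH]; intros [|m]; simpl; try reflexivity.
  - rewrite mcomb_zero, plus_zero_r. exact (scal_one v).
  - rewrite IH. eapply eq_trans; [|apply plus_zero_l]. f_equal.
    exact (scal_zero_l v).
Qed.

Lemma mdenote_comb (env : list V) (e : mexp) :
  mdenote env e = mcomb (mcoef e) env.
Proof.
  induction e as [n| |a IHa b IHb|a IHa b IHb|a IHa|k a IHa]; simpl.
  - symmetry; apply mcomb_var.
  - symmetry; apply mcomb_zero.
  - rewrite IHa, IHb. symmetry; apply (mcomb_plus env (mcoef a) (mcoef b)).
  - rewrite IHa, IHb. unfold minus. rewrite <- mcomb_opp.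
    symmetry; apply (mcomb_plus env (mcoef a) (fun n => - mcoef b n)%C).
  - rewrite IHa. symmetry; apply mcomb_opp.
  - rewrite IHa. symmetry; apply mcomb_scal.
Qed.

Fixpoint mcoefs_eq (a b : mexp) (n : nat) : Prop :=
  match n with
  | O => True
  | S m => mcoef a m = mcoef b m /\ mcoefs_eq a b m
  end.

Lemma module_eq (env : list V) (a b : mexp) :
  mcoefs_eq a b (length env) -> mdenote env a = mdenote env b.
Proof.
  intro H. rewrite !mdenote_comb. apply mcomb_ext. revert H.
  induction (length env) as [|N IH]; intros H n Hn; [lia|].
  destruct H as [H1 H2]. destruct (Nat.eq_dec n N) as [->|]; [exact H1|].
  apply IH; [exact H2 | lia].
Qed.

End ModuleEquations.

Ltac mem_idx x env :=
  lazymatch env with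
  | cons x _ => constr:(O)
  | cons _ ?r => let n := mem_idx x r in constr:(S n)
  end.

Ltac mem_add x env :=
  match env with
  | _ => let _ := mem_idx x env in env
  | _ => constr:(cons x env)
  end.

Ltac mod_atoms env e :=
  lazymatch e with
  | plus ?a ?b => let env := mod_atoms env a in mod_atoms env b
  | minus ?a ?b => let env := mod_atoms env a in mod_atoms env b
  | opp ?a => mod_atoms env a
  | scal _ ?a => mod_atoms env a
  | zero => env
  | ?x => mem_add x env
  end.

Ltac mod_reify env e :=
  lazymatch e with
  | plus ?a ?b => let a := mod_reify env a in let b := mod_reify env b in constr:(MPlus a b)
  | minus ?a ?b => let a := mod_reify env a in let b := mod_reify env b in constr:(MMinus a b)
  | opp ?a => let a := mod_reify env a in constr:(MOpp a)
  | scal ?k ?a => let a := mod_reify env a in constr:(MScal k a)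
  | zero => constr:(MZero)
  | ?x => let n := mem_idx x env in constr:(MVar n)
  end.

(* [tac] is left with one identity in C for each vector occurring in the equation. *)
Tactic Notation "module_by" constr(V) tactic(tac) :=
  lazymatch goal with
  | |- ?l = ?r =>
      let T := type of l in
      let env := mod_atoms (@nil T) l in
      let env := mod_atoms env r in
      let a := mod_reify env l in
      let b := mod_reify env r in
      refine (module_eq (V := V) env a b _);
      cbn [mcoefs_eq mcoef length Nat.eqb]; repeat split; tac
  end.

Tactic Notation "module_ring" constr(V) := module_by V ring.

(** * Norm estimates in complex normed modules *)

Section NormFacts.
Context {V : NormedModule C_AbsRing}.

Lemma norm_scal_le (k : C) (x : V) : norm (scal k x) <= Cmod k * norm x.
Proof. exact (norm_scal k x). Qed.

(** The norm axiom is only an inequality; applied to [/ k] it gives the reverse one. *)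
Lemma norm_scal_eq (k : C) (x : V) : norm (scal k x) = Cmod k * norm x.
Proof.
  apply Rle_antisym; [apply norm_scal_le|].
  destruct (Ceq_dec k 0%C) as [->|Hk].
  - rewrite Cmod_0, Rmult_0_l. apply norm_ge_0.
  - assert (E : x = scal (/ k)%C (scal k x)) by (module_by V (field; exact Hk)).
    rewrite E at 1.
    apply Rle_trans with (Cmod k * (Cmod (/ k) * norm (scal k x))).
    + apply Rmult_le_compat_l; [apply Cmod_ge_0 | apply norm_scal_le].
    + rewrite Cmod_inv by exact Hk. apply Req_le. field.
      apply Cmod_gt_0 in Hk. lra.
Qed.

Lemma norm_minus_sym (x y : V) : norm (minus x y) = norm (minus y x).
Proof. rewrite <- norm_opp. f_equal. apply opp_minus. Qed.

Lemma norm_minus_self (x : V) : norm (minus x x) = 0.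
Proof. rewrite minus_eq_zero. exact (norm_zero (V := V)). Qed.

Lemma norm_minus_le (x y : V) : norm (minus x y) <= norm x + norm y.
Proof.
  unfold minus. eapply Rle_trans; [apply norm_triangle|]. rewrite norm_opp. lra.
Qed.

Lemma norm_minus_trans (z x y : V) :
  norm (minus x y) <= norm (minus x z) + norm (minus z y).
Proof. rewrite (minus_trans z x y). apply norm_triangle. Qed.

Lemma norm_le_minus (x y : V) : norm x <= norm (minus x y) + norm y.
Proof.
  replace x with (plus (minus x y) y) at 1 by module_ring V. apply norm_triangle.
Qed.

Lemma minus_zero_eq (x y : V) : minus x y = zero -> x = y.
Proof.
  intro H. replace x with (plus (minus x y) y) by module_ring V.
  rewrite H. apply plus_zero_l.
Qed.

Lemma filterlim_norm_elim {T} {P : (T -> Prop) -> Prop} {FF : Filter P} (f : T -> V) (l : V) :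
  filterlim f P (locally l) ->
  forall e, 0 < e -> P (fun x => norm (minus (f x) l) < e).
Proof.
  intros H e He. apply (H (fun y => norm (minus y l) < e)).
  apply (locally_le_locally_norm l). exists (mkposreal e He). intros y Hy. exact Hy.
Qed.

Lemma filterlim_norm_intro {T} {P : (T -> Prop) -> Prop} {FF : Filter P} (f : T -> V) (l : V) :
  (forall e, 0 < e -> P (fun x => norm (minus (f x) l) < e)) ->
  filterlim f P (locally l).
Proof.
  intros H Q HQ. apply (locally_norm_le_locally l) in HQ. destruct HQ as [e He].
  unfold filtermap. generalize (H e (cond_pos e)). apply filter_imp.
  intros x Hx. apply He. exact Hx.
Qed.

Lemma closed_norm (W : V -> Prop) :
  (forall x, (forall e, 0 < e -> exists y, W y /\ norm (minus x y) < e) -> W x) ->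
  closed W.
Proof.
  intros H x Hx. apply H. intros e He.
  destruct (classic (exists y, W y /\ norm (minus x y) < e)) as [E|E]; [exact E|].
  exfalso. apply Hx. apply (locally_le_locally_norm x).
  exists (mkposreal e He). intros y Hy Wy. apply E. exists y. split; [exact Wy|].
  rewrite norm_minus_sym. exact Hy.
Qed.

End NormFacts.

(** * Cauchy's theorem on rectangles *)

Lemma Cmod_le_Rabs (z : C) : Cmod z <= Rabs (Re z) + Rabs (Im z).
Proof.
  replace z with (RtoC (Re z) + Ci * RtoC (Im z))%C at 1
    by (destruct z as [a b]; unfold Ci, RtoC, Cmult, Cplus; simpl; f_equal; ring).
  eapply Rle_trans; [apply Cmod_triangle|].
  rewrite Cmod_mult, !Cmod_R.
  replace (Cmod Ci) with 1; [lra|].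
  unfold Cmod, Ci; simpl. replace (_ + _) with 1 by ring. symmetry; apply sqrt_1.
Qed.

Lemma im_le_Cmod (z : C) : Rabs (Im z) <= Cmod z.
Proof. eapply Rle_trans; [apply Rmax_r | apply Rmax_Cmod]. Qed.

Lemma Cmod_Ci : Cmod Ci = 1.
Proof. unfold Cmod, Ci; simpl. replace (_ + _) with 1 by ring. apply sqrt_1. Qed.

Lemma is_RInt_linear {U W : NormedModule R_AbsRing} (L : U -> W) (f : R -> U) (a b : R) (l : U) :
  is_linear L -> is_RInt f a b l -> is_RInt (fun t => L (f t)) a b (L l).
Proof.
  intros HL H. unfold is_RInt.
  apply filterlim_ext with (fun ptd => L (scal (sign (b - a)) (Riemann_sum f ptd))).
  - intro ptd. rewrite (linear_scal L HL). f_equal.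
    apply (SF_cons_ind (T := R)) with (s := ptd); clear ptd.
    + intros x0. exact (linear_zero L HL).
    + intros [x0 y0] s IH.
      rewrite !Riemann_sum_cons, (linear_plus L HL), (linear_scal L HL), IH. reflexivity.
  - eapply filterlim_comp; [exact H|]. apply (linear_cont L l HL).
Qed.

Section Contour.
Context {E : CompleteNormedModule C_AbsRing}.
Notation V := (CompleteNormedModule.NormedModule C_AbsRing E).
Notation VR := (restrict_scalars E).

Lemma quadratic_is_derive (f : R -> V) (x : R) (l : V) (d M : R) :
  0 < d ->
  (forall h, Rabs h < d ->
     norm (minus (minus (f (x + h)) (f x)) (scal (RtoC h) l)) <= M * Rabs h ^ 2) ->
  is_derive (V := VR) f x l.
Proof.
  intros Hd H. split; [apply (is_linear_scal_l (V := VR) l)|].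
  intros x' Hx'. apply (is_filter_lim_locally_unique (V := R_NormedModule)) in Hx'. subst x'.
  intro eps.
  assert (HM : 0 < Rmax 0 M + 1) by (generalize (Rmax_l 0 M); lra).
  assert (Hr : 0 < Rmin d (eps / (Rmax 0 M + 1))).
  { apply Rmin_glb_lt; [exact Hd | apply Rdiv_lt_0_compat; [apply cond_pos | lra]]. }
  exists (mkposreal _ Hr).
  change (forall y : R, Rabs (y - x) < Rmin d (eps / (Rmax 0 M + 1)) ->
    norm (minus (minus (f y) (f x)) (scal (RtoC (y - x)) l)) <= eps * Rabs (y - x)).
  intros y Hy'. specialize (H (y - x)). replace (x + (y - x)) with y in H by ring.
  eapply Rle_trans; [apply H; eapply Rlt_le_trans; [exact Hy' | apply Rmin_l]|].
  assert (B : Rabs (y - x) < eps / (Rmax 0 M + 1))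
    by (eapply Rlt_le_trans; [exact Hy' | apply Rmin_r]).
  assert (B' : (Rmax 0 M + 1) * Rabs (y - x) <= eps).
  { apply Rlt_le. apply Rmult_lt_compat_r with (r := Rmax 0 M + 1) in B; [|lra].
    replace (eps / (Rmax 0 M + 1) * (Rmax 0 M + 1)) with (pos eps) in B by (field; lra).
    lra. }
  assert (P := Rabs_pos (y - x)). assert (Q := Rmax_r 0 M).
  replace (M * Rabs (y - x) ^ 2) with ((M * Rabs (y - x)) * Rabs (y - x)) by ring.
  apply Rmult_le_compat_r; [exact P|]. nra.
Qed.

Lemma derive_continuous (f : R -> V) (x : R) (l : V) :
  is_derive (V := VR) f x l -> continuous (U := VR) f x.
Proof.
  intro H. apply (ex_derive_continuous (K := R_AbsRing) (V := VR)).
  exists l. exact H.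
Qed.

Lemma norm_is_RInt_le (f : R -> V) (a b M : R) (l : V) :
  a <= b -> (forall x, a <= x <= b -> norm (f x) <= M) ->
  is_RInt (V := VR) f a b l -> norm l <= (b - a) * M.
Proof. exact (norm_RInt_le_const (V := VR) f a b l M). Qed.

Lemma continuous_scal_C (k : C) (f : R -> V) t :
  continuous (U := VR) f t -> continuous (U := VR) (fun t => scal k (f t)) t.
Proof. intro H. exact (continuous_scal_r (V := V) k f t H). Qed.

Section Rectangle.
Variables (G G' : C -> V) (a b d M : R).
Hypotheses (Hab : a < b) (Hd : 0 < d).
Let S (z : C) := a - d < Re z < b + d /\ -1 - d < Im z < 1 + d.
(** A uniform second-order Taylor estimate stands in for holomorphy: it can be integrated over a
    side as it is, and it makes [G'] Lipschitz. *)
Hypothesis HG : forall z w, S z -> S w ->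
  norm (minus (minus (G w) (G z)) (scal (w - z)%C (G' z))) <= M * Cmod (w - z) ^ 2.

Let Hd2 : 0 < d / 2.
Proof. lra. Qed.

Let in_S x y : a - d / 2 <= x <= b + d / 2 -> -1 <= y <= 1 ->
  forall h k, Rabs h < d / 2 -> Rabs k < d / 2 -> S (x + h, y + k).
Proof.
  intros Hx Hy h k Hh Hk. apply Rabs_def2 in Hh. apply Rabs_def2 in Hk.
  split; simpl; lra.
Qed.

(** Adding the Taylor remainders from [z] to [w] and from [w] to [z] cancels the values of [G] and
    leaves [(w - z) (G' w - G' z)]. *)
Let G'_lip (z w : C) : S z -> S w -> norm (minus (G' w) (G' z)) <= 2 * M * Cmod (w - z).
Proof.
  intros Hz Hw. destruct (Ceq_dec w z) as [->|N].
  { rewrite norm_minus_self. replace (z - z)%C with (RtoC 0) by ring.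
    rewrite Cmod_0. lra. }
  assert (P : 0 < Cmod (w - z)).
  { apply Cmod_gt_0. intro E0. apply N. replace w with ((w - z) + z)%C by ring.
    rewrite E0. ring. }
  apply Rmult_le_reg_l with (Cmod (w - z)); [exact P|].
  rewrite <- norm_scal_eq.
  replace (scal (w - z)%C (minus (G' w) (G' z))) with
    (plus (minus (minus (G w) (G z)) (scal (w - z)%C (G' z)))
      (minus (minus (G z) (G w)) (scal (z - w)%C (G' w)))) by module_ring V.
  eapply Rle_trans; [apply (norm_triangle (V := V))|].
  generalize (HG z w Hz Hw) (HG w z Hw Hz).
  replace (z - w)%C with (- (w - z))%C at 2 by ring. rewrite Cmod_opp. nra.
Qed.

Let G_lip_derive_y x y : a - d / 2 <= x <= b + d / 2 -> -1 <= y <= 1 ->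
  is_derive (V := VR) (fun t => G (x, t)) y (scal Ci (G' (x, y))).
Proof.
  intros Hx Hy. apply (quadratic_is_derive _ _ _ (d / 2) M Hd2). intros h Hh.
  assert (S0 := in_S x y Hx Hy 0 0). assert (S1 := in_S x y Hx Hy 0 h).
  rewrite Rabs_R0, !Rplus_0_r in S0. rewrite Rabs_R0, !Rplus_0_r in S1.
  specialize (HG _ _ (S0 Hd2 Hd2) (S1 Hd2 Hh)).
  replace ((x, (y + h)%R) - (x, y))%C with (Ci * RtoC h)%C in HG
    by (unfold Ci, RtoC, Cminus, Cmult, Cplus, Copp; simpl; f_equal; ring).
  rewrite Cmod_mult, Cmod_Ci, Cmod_R, Rmult_1_l in HG.
  replace (scal (RtoC h) (scal Ci (G' (x, y)))) with (scal (Ci * RtoC h)%C (G' (x, y)))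
    by module_ring V.
  exact HG.
Qed.

Let G_derive_x x y : a <= x <= b -> -1 <= y <= 1 ->
  is_derive (V := VR) (fun s => G (s, y)) x (G' (x, y)).
Proof.
  intros Hx Hy. apply (quadratic_is_derive _ _ _ (d / 2) M Hd2). intros h Hh.
  assert (Hx' : a - d / 2 <= x <= b + d / 2) by lra.
  assert (S0 := in_S x y Hx' Hy 0 0). assert (S1 := in_S x y Hx' Hy h 0).
  rewrite Rabs_R0, !Rplus_0_r in S0. rewrite Rabs_R0, !Rplus_0_r in S1.
  specialize (HG _ _ (S0 Hd2 Hd2) (S1 Hh Hd2)).
  replace (((x + h)%R, y) - (x, y))%C with (RtoC h)%C in HG
    by (unfold RtoC, Cminus, Cplus, Copp; simpl; f_equal; ring).
  rewrite Cmod_R in HG. exact HG.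
Qed.

Let G'_cont_y x y : a - d / 2 <= x <= b + d / 2 -> -1 <= y <= 1 ->
  continuous (U := VR) (fun t => G' (x, t)) y.
Proof.
  intros Hx Hy. apply (filterlim_norm_intro (V := V)). intros e He.
  assert (Hr : 0 < Rmin (d / 2) (e / (2 * Rmax 0 M + 1))).
  { apply Rmin_glb_lt; [exact Hd2 | apply Rdiv_lt_0_compat; [lra|]].
    generalize (Rmax_l 0 M); lra. }
  exists (mkposreal _ Hr).
  change (forall t : R, Rabs (t - y) < Rmin (d / 2) (e / (2 * Rmax 0 M + 1)) ->
    norm (minus (G' (x, t)) (G' (x, y))) < e).
  intros t Ht'.
  assert (S0 := in_S x y Hx Hy 0 0). assert (S1 := in_S x y Hx Hy 0 (t - y)).
  rewrite Rabs_R0, !Rplus_0_r in S0. rewrite Rabs_R0, !Rplus_0_r in S1.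
  replace (y + (t - y)) with t in S1 by ring.
  eapply Rle_lt_trans; [apply G'_lip; [apply S0; lra|apply S1; [lra|]]|].
  { eapply Rlt_le_trans; [exact Ht' | apply Rmin_l]. }
  replace ((x, t) - (x, y))%C with (Ci * RtoC (t - y))%C
    by (unfold Ci, RtoC, Cminus, Cmult, Cplus, Copp; simpl; f_equal; ring).
  rewrite Cmod_mult, Cmod_Ci, Cmod_R, Rmult_1_l.
  assert (B : Rabs (t - y) < e / (2 * Rmax 0 M + 1))
    by (eapply Rlt_le_trans; [exact Ht' | apply Rmin_r]).
  assert (Q := Rmax_r 0 M). assert (Q' := Rmax_l 0 M).
  apply Rmult_lt_compat_l with (r := 2 * Rmax 0 M + 1) in B; [|lra].
  replace ((2 * Rmax 0 M + 1) * (e / (2 * Rmax 0 M + 1))) with e in B by (field; lra).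
  assert (P := Rabs_pos (t - y)). nra.
Qed.

Definition vertical_int (x : R) : V := RInt (V := VR) (fun y => scal Ci (G (x, y))) (-1) 1.

Lemma vertical_int_correct x : a - d / 2 <= x <= b + d / 2 ->
  is_RInt (V := VR) (fun y => scal Ci (G (x, y))) (-1) 1 (vertical_int x).
Proof.
  intro Hx. apply (RInt_correct (V := VR)), (ex_RInt_continuous (V := VR)).
  rewrite Rmin_left, Rmax_right by lra. intros y Hy.
  apply continuous_scal_C.
  eapply derive_continuous, G_lip_derive_y; assumption.
Qed.

(* The two horizontal sides come from differentiating the integral over the vertical
   side in its abscissa: the derivative is the integral of a y-derivative. *)
Lemma rectangle_integral :
  is_RInt (V := VR) (fun x => minus (G (x, 1)) (G (x, -1))) a b
    (minus (vertical_int b) (vertical_int a)).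
Proof.
  set (H := fun x => minus (G (x, 1)) (G (x, -1)) : V).
  assert (HR : forall x, a - d / 2 <= x <= b + d / 2 ->
    is_RInt (V := VR) (fun y => scal Ci (G' (x, y))) (-1) 1 (H x)).
  { intros x Hx.
    apply (is_RInt_derive (V := VR) (fun t => G (x, t))).
    - rewrite Rmin_left, Rmax_right by lra. intros y Hy. apply G_lip_derive_y; assumption.
    - rewrite Rmin_left, Rmax_right by lra. intros y Hy.
      apply continuous_scal_C. apply G'_cont_y; assumption. }
  (* As [H x] is also the integral of [i G'] over the vertical side, the left-hand side is the
     integral of the Taylor remainder over a segment of length 2. *)
  assert (HI : forall x x', a - d / 2 <= x <= b + d / 2 -> a - d / 2 <= x' <= b + d / 2 ->
    norm (minus (minus (vertical_int x') (vertical_int x)) (scal (RtoC (x' - x)) (H x)))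
      <= 2 * M * Rabs (x' - x) ^ 2).
  { intros x x' Hx Hx'.
    replace (2 * M * Rabs (x' - x) ^ 2) with ((1 - -1) * (M * Rabs (x' - x) ^ 2)) by ring.
    apply (norm_is_RInt_le (fun y => minus (minus (scal Ci (G (x', y))) (scal Ci (G (x, y))))
      (scal (RtoC (x' - x)) (scal Ci (G' (x, y))))) (-1) 1); [lra| |].
    - intros y Hy.
      replace (minus _ _) with (scal Ci (minus (minus (G (x', y)) (G (x, y)))
         (scal (RtoC (x' - x)) (G' (x, y))))) by module_ring V.
      rewrite norm_scal_eq, Cmod_Ci, Rmult_1_l.
      assert (S0 : S (x, y)) by (split; simpl; lra).
      assert (S1 : S (x', y)) by (split; simpl; lra).
      generalize (HG _ _ S0 S1).
      replace ((x', y) - (x, y))%C with (RtoC (x' - x))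
        by (unfold RtoC, Cminus, Cplus, Copp; simpl; f_equal; ring).
      rewrite Cmod_R. exact (fun h => h).
    - apply (is_RInt_minus (V := VR)); [apply (is_RInt_minus (V := VR))|].
      + apply vertical_int_correct; assumption.
      + apply vertical_int_correct; assumption.
      + apply (is_RInt_scal (V := VR)). apply HR; assumption. }
  assert (HD : forall x, a <= x <= b -> is_derive (V := VR) vertical_int x (H x)).
  { intros x Hx. apply (quadratic_is_derive _ _ _ (d / 2) (2 * M) Hd2).
    intros h Hh. apply Rabs_def2 in Hh. specialize (HI x (x + h)).
    replace (x + h - x) with h in HI by ring. apply HI; lra. }
  apply (is_RInt_derive (V := VR)); rewrite Rmin_left, Rmax_right by lra;
    intros x Hx; [apply HD, Hx|].
  apply (filterlim_norm_intro (V := V)). intros e He.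
  assert (Gx : forall y, -1 <= y <= 1 ->
    locally x (fun s => norm (minus (G (s, y)) (G (x, y))) < e / 2)).
  { intros y Hy. assert (K := G_derive_x x y Hx Hy). apply derive_continuous in K.
    apply (filterlim_norm_elim (V := V) _ _ K (e / 2)). lra. }
  assert (Gx1 := Gx 1). assert (Gx2 := Gx (-1)).
  lapply Gx1; [clear Gx1; intro Gx1 | lra]. lapply Gx2; [clear Gx2; intro Gx2 | lra].
  generalize (filter_and _ _ Gx1 Gx2).
  apply filter_imp. change (forall s : R, norm (minus (G (s, 1)) (G (x, 1))) < e / 2 /\
    norm (minus (G (s, -1)) (G (x, -1))) < e / 2 ->
    norm (minus (minus (G (s, 1)) (G (s, -1))) (minus (G (x, 1)) (G (x, -1)))) < e).
  intros s [H1 H2].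
  replace (minus (minus (G (s, 1)) (G (s, -1))) (minus (G (x, 1)) (G (x, -1)))) with
    (minus (minus (G (s, 1)) (G (x, 1))) (minus (G (s, -1)) (G (x, -1)))) by module_ring V.
  eapply Rle_lt_trans; [apply norm_minus_le|]. lra.
Qed.

End Rectangle.
End Contour.

(** * Pseudo-resolvents off the imaginary axis *)

Notation CU := (AbsRing_UniformSpace C_AbsRing).

(** The filter takes both half-planes at once: a limit along it means that the boundary values from
    the left and from the right agree. *)
Definition off_axis (eta : R) : (C -> Prop) -> Prop :=
  within (fun z => Re z <> 0) (locally (T := CU) (0, eta)).

Global Instance off_axis_filter eta : Filter (off_axis eta).
Proof. exact (within_filter _ _ _ (filter_filter (ProperFilter := locally_filter (T := CU) (0, eta)))). Qed.

Lemma off_axis_intro eta (P : C -> Prop) (d : R) :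
  0 < d -> (forall z, Re z <> 0 -> Cmod (z - (0, eta)) < d -> P z) -> off_axis eta P.
Proof.
  intros Hd H. exists (mkposreal d Hd). intros z Hz Hre. apply H; [exact Hre | exact Hz].
Qed.

Lemma off_axis_elim eta (P : C -> Prop) :
  off_axis eta P ->
  exists d, 0 < d /\ forall z, Re z <> 0 -> Cmod (z - (0, eta)) < d -> P z.
Proof.
  intros [d H]. exists d. split; [apply cond_pos|]. intros z Hre Hz. exact (H z Hz Hre).
Qed.

Global Instance off_axis_proper eta : ProperFilter (off_axis eta).
Proof.
  constructor; [|apply off_axis_filter].
  intros P HP. apply off_axis_elim in HP. destruct HP as [d [Hd H]].
  exists (d / 2, eta). apply H; simpl; [lra|].
  replace ((d / 2)%R, eta) with ((0, eta) + RtoC (d / 2))%C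
    by (unfold RtoC, Cplus; simpl; f_equal; ring).
  replace ((0, eta) + RtoC (d / 2) - (0, eta))%C with (RtoC (d / 2)) by ring.
  rewrite Cmod_R, Rabs_pos_eq; lra.
Qed.

Lemma off_axis_id eta : filterlim (fun z : C => z) (off_axis eta) (locally (T := CU) (0, eta)).
Proof.
  intros P [d HP]. exists d. intros z Hz _. exact (HP z Hz).
Qed.

Lemma filterlim_Cplus {T} {F : (T -> Prop) -> Prop} {FF : Filter F} (f g : T -> C) (k l : C) :
  filterlim f F (locally (T := CU) k) -> filterlim g F (locally (T := CU) l) ->
  filterlim (fun x => f x + g x)%C F (locally (T := CU) (k + l)%C).
Proof.
  intros Hf Hg.
  exact (filterlim_comp_2 f g plus Hf Hg
    (filterlim_plus (V := AbsRing_NormedModule C_AbsRing) k l)).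
Qed.

Lemma filterlim_Cmult {T} {F : (T -> Prop) -> Prop} {FF : Filter F} (f g : T -> C) (k l : C) :
  filterlim f F (locally (T := CU) k) -> filterlim g F (locally (T := CU) l) ->
  filterlim (fun x => f x * g x)%C F (locally (T := CU) (k * l)%C).
Proof.
  intros Hf Hg.
  exact (filterlim_comp_2 f g scal Hf Hg
    (filterlim_scal (V := AbsRing_NormedModule C_AbsRing) k l)).
Qed.

Lemma filterlim_Cinv {T} {F : (T -> Prop) -> Prop} {FF : Filter F} (f : T -> C) (k : C) :
  k <> 0%C -> filterlim f F (locally (T := CU) k) ->
  filterlim (fun x => / f x)%C F (locally (T := CU) (/ k)%C).
Proof.
  intros Hk Hf. assert (Pk := proj1 (Cmod_gt_0 k) Hk).
  apply (filterlim_norm_intro (V := AbsRing_NormedModule C_AbsRing)). intros e He.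
  set (d := Rmin (Cmod k / 2) (e * (Cmod k * Cmod k / 2))).
  assert (Hd : 0 < d) by (apply Rmin_glb_lt; [lra | apply Rmult_lt_0_compat; nra]).
  generalize (filterlim_norm_elim (V := AbsRing_NormedModule C_AbsRing) f k Hf d Hd).
  apply filter_imp. intros x Hx.
  change (Cmod (f x - k) < d) in Hx. change (Cmod (/ f x - / k) < e).
  assert (D1 := Rmin_l (Cmod k / 2) (e * (Cmod k * Cmod k / 2))).
  assert (D2 := Rmin_r (Cmod k / 2) (e * (Cmod k * Cmod k / 2))). fold d in D1, D2.
  assert (Pf : Cmod k / 2 < Cmod (f x)).
  { assert (T0 := Cmod_triangle (k - f x) (f x)).
    replace (k - f x + f x)%C with k in T0 by ring.
    replace (k - f x)%C with (- (f x - k))%C in T0 by ring. rewrite Cmod_opp in T0. lra. }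
  assert (Nf : f x <> 0%C) by (apply Cmod_gt_0; lra).
  replace (/ f x - / k)%C with (- (f x - k) * / (f x * k))%C by (field; split; assumption).
  rewrite Cmod_mult, Cmod_opp, Cmod_inv, Cmod_mult by (apply Cmult_neq_0; assumption).
  apply Rmult_lt_reg_r with (Cmod (f x) * Cmod k); [nra|].
  rewrite Rmult_assoc, Rinv_l by nra. nra.
Qed.

Lemma off_axis_neq (w : C) (t : R) : Re w <> 0 -> (w - (0, t))%C <> 0%C.
Proof.
  intros Hw E0. apply Hw. replace (Re w) with (Re (w - (0, t))%C) by (simpl; unfold Re; ring).
  rewrite E0. reflexivity.
Qed.

(** The maps [R z] may have a kernel; for a multivalued operator it is the set of its values at
    0. *)
Record pseudo_resolvent {V : NormedModule C_AbsRing} (R : C -> V -> V) : Prop := {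
  pr_plus : forall z x y, Re z <> 0 -> R z (plus x y) = plus (R z x) (R z y);
  pr_scal : forall z k x, Re z <> 0 -> R z (scal k x) = scal k (R z x);
  pr_bound : forall z x, Re z <> 0 -> norm (R z x) <= norm x / Rabs (Re z);
  pr_eq : forall z w x, Re z <> 0 -> Re w <> 0 ->
    minus (R z x) (R w x) = scal (w - z)%C (R z (R w x))
}.

Section PseudoResolvent.
Context {E : CompleteNormedModule C_AbsRing}.
Notation V := (CompleteNormedModule.NormedModule C_AbsRing E).
Notation VR := (restrict_scalars E).
Context {Res : C -> V -> V} (HR : pseudo_resolvent Res).

Lemma pr_minus z x y : Re z <> 0 -> Res z (minus x y) = minus (Res z x) (Res z y).
Proof.
  intro Hz. replace (minus x y) with (plus x (scal (- (1))%C y)) by module_ring V.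
  rewrite (pr_plus _ HR) by assumption. rewrite (pr_scal _ HR) by assumption. module_ring V.
Qed.

Lemma pr_bound_le z x a : 0 < a -> a <= Rabs (Re z) -> norm (Res z x) <= / a * norm x.
Proof.
  intros Ha Hz. eapply Rle_trans; [apply (pr_bound _ HR)|].
  { intro E0. rewrite E0, Rabs_R0 in Hz. lra. }
  rewrite Rmult_comm. apply Rmult_le_compat_l; [apply norm_ge_0|].
  apply Rinv_le_contravar; assumption.
Qed.

(** The resolvent identity, used twice, gives an exact expansion with a quadratic remainder. It
    holds even when [z] and [w] lie on opposite sides of the axis. *)
Lemma pr_taylor z w u : Re z <> 0 -> Re w <> 0 ->
  minus (Res w u) (Res z u) =
  plus (scal (z - w)%C (Res z (Res z u)))
    (scal ((w - z) * (w - z))%C (Res w (Res z (Res z u)))).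
Proof.
  intros Hz Hw. rewrite (pr_eq _ HR) by assumption.
  assert (K := pr_eq _ HR w z (Res z u) Hw Hz).
  replace (Res w (Res z u)) with
    (plus (minus (Res w (Res z u)) (Res z (Res z u))) (Res z (Res z u))) by module_ring V.
  rewrite K. module_ring V.
Qed.

Lemma pr_comm z w u : Re z <> 0 -> Re w <> 0 -> Res z (Res w u) = Res w (Res z u).
Proof.
  intros Hz Hw. destruct (Ceq_dec w z) as [->|N]; [reflexivity|].
  assert (N' : (w - z)%C <> 0%C).
  { intro E0. apply N. replace w with ((w - z) + z)%C by ring. rewrite E0. ring. }
  replace (Res z (Res w u)) with (scal (/ (w - z))%C (scal (w - z)%C (Res z (Res w u))))
    by (module_by V (field; exact N')).
  rewrite <- (pr_eq _ HR) by assumption.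
  replace (minus (Res z u) (Res w u)) with (scal (- (1))%C (minus (Res w u) (Res z u)))
    by module_ring V.
  rewrite (pr_eq _ HR) by assumption. module_by V (field; exact N').
Qed.

Lemma pr_quotient z w f : Re z <> 0 -> Re w <> 0 -> (w - z)%C <> 0%C ->
  Res z (Res w f) = scal (/ (w - z))%C (minus (Res z f) (Res w f)).
Proof.
  intros Hz Hw N. rewrite (pr_eq _ HR) by assumption. module_by V (field; exact N).
Qed.

Definition weight (z : C) : C := (1 + z * z)%C.

Definition weighted (u : V) (z : C) : V := scal (weight z) (Res z u).

(** The remainder is exactly [(w - z)^2] times a combination of at most three resolvents of [u],
    each bounded by [/ c]; the factors 17 and 8 bound [1 + w^2] and [w + z] for moduli at most 4. *)
Lemma weighted_taylor (u : V) (c : R) : 0 < c -> exists M, forall z w,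
  c <= Rabs (Re z) -> c <= Rabs (Re w) -> Cmod z <= 4 -> Cmod w <= 4 ->
  norm (minus (minus (weighted u w) (weighted u z))
    (scal (w - z)%C (minus (scal (2 * z)%C (Res z u)) (scal (weight z) (Res z (Res z u))))))
  <= M * Cmod (w - z) ^ 2.
Proof.
  intro Hc.
  exists (17 * (/ c * (/ c * (/ c * norm u))) + / c * norm u + 8 * (/ c * (/ c * norm u))).
  intros z w Hz Hw Bz Bw.
  assert (Nz : Re z <> 0) by (intro E0; rewrite E0, Rabs_R0 in Hz; lra).
  assert (Nw : Re w <> 0) by (intro E0; rewrite E0, Rabs_R0 in Hw; lra).
  unfold weighted, weight.
  replace (Res w u) with (plus (minus (Res w u) (Res z u)) (Res z u)) by module_ring V.
  rewrite pr_taylor by assumption.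
  set (A := Res z u). set (Q := Res z A). set (T := Res w Q).
  assert (BA : norm A <= / c * norm u) by (apply pr_bound_le; assumption).
  assert (Ic : 0 < / c) by (apply Rinv_0_lt_compat; exact Hc).
  assert (BQ : norm Q <= / c * (/ c * norm u)).
  { eapply Rle_trans; [apply (pr_bound_le _ _ c); assumption|]. apply Rmult_le_compat_l; lra. }
  assert (BT : norm T <= / c * (/ c * (/ c * norm u))).
  { eapply Rle_trans; [apply (pr_bound_le _ _ c); assumption|]. apply Rmult_le_compat_l; lra. }
  replace (minus _ _) with (scal ((w - z) * (w - z))%C
    (minus (plus (scal (1 + w * w)%C T) A) (scal (w + z)%C Q))) by module_ring V.
  rewrite norm_scal_eq, Cmod_mult.
  replace (Cmod (w - z) * Cmod (w - z)) with (Cmod (w - z) ^ 2) by ring.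
  rewrite (Rmult_comm _ (Cmod (w - z) ^ 2)).
  apply Rmult_le_compat_l; [apply pow2_ge_0|].
  eapply Rle_trans; [apply norm_minus_le|]. apply Rplus_le_compat.
  - eapply Rle_trans; [apply (norm_triangle (V := V))|].
    apply Rplus_le_compat; [|exact BA]. rewrite norm_scal_eq.
    apply Rmult_le_compat; [apply Cmod_ge_0 | apply norm_ge_0 | | exact BT].
    eapply Rle_trans; [apply Cmod_triangle|]. rewrite Cmod_mult, Cmod_1.
    generalize (Cmod_ge_0 w). nra.
  - rewrite norm_scal_eq.
    apply Rmult_le_compat; [apply Cmod_ge_0 | apply norm_ge_0 | | exact BQ].
    eapply Rle_trans; [apply Cmod_triangle|]. lra.
Qed.

Lemma weighted_rectangle (u : V) (a b c : R) :
  a < b -> 0 < c -> (c <= a /\ b <= 1 \/ -1 <= a /\ b <= - c) ->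
  exists I : R -> V,
    (forall x, a <= x <= b ->
      is_RInt (V := VR) (fun y => scal Ci (weighted u (x, y))) (-1) 1 (I x)) /\
    is_RInt (V := VR) (fun x => minus (weighted u (x, 1)) (weighted u (x, -1))) a b
      (minus (I b) (I a)).
Proof.
  intros Hab Hc H.
  assert (Hc1 : c < 1) by (destruct H; lra).
  (* With [c / 2] in place of [c] a margin around the rectangle still stays off the axis. *)
  destruct (weighted_taylor u (c / 2)) as [M HM]; [lra|].
  assert (HS : forall z w : C,
    a - c / 2 < Re z < b + c / 2 /\ -1 - c / 2 < Im z < 1 + c / 2 ->
    a - c / 2 < Re w < b + c / 2 /\ -1 - c / 2 < Im w < 1 + c / 2 ->
    norm (minus (minus (weighted u w) (weighted u z))
      (scal (w - z)%C ((fun z => minus (scal (2 * z)%C (Res z u))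
        (scal (weight z) (Res z (Res z u)))) z))) <= M * Cmod (w - z) ^ 2).
  { assert (B : forall z : C,
      a - c / 2 < Re z < b + c / 2 /\ -1 - c / 2 < Im z < 1 + c / 2 ->
      c / 2 <= Rabs (Re z) /\ Cmod z <= 4).
    { intros z [Z1 Z2]. split.
      - unfold Rabs. destruct (Rcase_abs (Re z)); lra.
      - eapply Rle_trans; [apply Cmod_le_Rabs|].
        unfold Rabs. destruct (Rcase_abs (Re z)); destruct (Rcase_abs (Im z)); lra. }
    intros z w Hz Hw. destruct (B z Hz), (B w Hw). apply HM; assumption. }
  set (W' := fun z => minus (scal (2 * z)%C (Res z u)) (scal (weight z) (Res z (Res z u)))) in HS.
  exists (vertical_int (weighted u)). split.
  - intros x Hx. apply (vertical_int_correct _ W' a b (c / 2) M); try split; try lra. exact HS.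
  - apply (rectangle_integral _ W' a b (c / 2) M); try lra. exact HS.
Qed.

End PseudoResolvent.

(** * The bound near the axis *)

(* Real and imaginary parts of [(1 + z^2) / (z - w)] at [z = x + i y], in the form
   [(z + w) + (1 + w^2) / (z - w)]. *)
Definition cauchy_re (w x y : R) : R :=
  x + w + (1 + w * w) * ((x - w) / ((x - w) * (x - w) + y * y)).
Definition cauchy_im (w x y : R) : R :=
  y - (1 + w * w) * (y / ((x - w) * (x - w) + y * y)).

Lemma cauchy_kernel_eq (w x y : R) : 0 < (x - w) * (x - w) + y * y ->
  weight (x, y) = ((cauchy_re w x y, cauchy_im w x y) * ((x, y) - RtoC w))%C.
Proof.
  intro H. unfold weight, cauchy_re, cauchy_im, Cmult, Cplus, Cminus, Copp, RtoC; simpl.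
  f_equal; field; lra.
Qed.

Lemma cauchy_kernel_norm (w x y c : R) : 0 < c -> 0 < (x - w) * (x - w) + y * y ->
  c <= Cmod ((x, y) - RtoC w) ->
  Cmod (cauchy_re w x y, cauchy_im w x y) <= / c * Cmod (weight (x, y)).
Proof.
  intros Hc H Hz. rewrite (cauchy_kernel_eq w x y H), Cmod_mult.
  set (k := Cmod (cauchy_re _ _ _, _)). assert (0 <= k) by apply Cmod_ge_0.
  apply Rmult_le_reg_l with c; [exact Hc|].
  rewrite <- Rmult_assoc, Rinv_r, Rmult_1_l by lra. nra.
Qed.

Lemma scal_is_RInt {E : CompleteNormedModule C_AbsRing} (u : CompleteNormedModule.NormedModule _ E)
    (p q : R -> R) (a b P Q : R) :
  is_RInt p a b P -> is_RInt q a b Q ->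
  is_RInt (V := restrict_scalars E) (fun t => scal ((p t, q t) : C) u) a b (scal ((P, Q) : C) u).
Proof.
  set (V := CompleteNormedModule.NormedModule C_AbsRing E).
  intros Hp Hq.
  assert (S0 : forall r s : R, scal ((r, s) : C) u =
    plus (scal (RtoC r) u) (scal (RtoC s) (scal Ci u))).
  { intros r s. replace ((r, s) : C) with (RtoC r + RtoC s * Ci)%C
      by (unfold RtoC, Ci, Cmult, Cplus; simpl; f_equal; ring).
    module_ring V. }
  rewrite S0.
  eapply (is_RInt_ext (V := restrict_scalars E)); [intros t _; symmetry; apply S0|].
  apply (is_RInt_plus (V := restrict_scalars E)).
  - exact (is_RInt_linear _ _ _ _ _ (is_linear_scal_l (V := restrict_scalars E) u) Hp).
  - exact (is_RInt_linear _ _ _ _ _ (is_linear_scal_l (V := restrict_scalars E) (scal Ci u)) Hq).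
Qed.

Section AxisBound.
Context {E : CompleteNormedModule C_AbsRing}.
Notation V := (CompleteNormedModule.NormedModule C_AbsRing E).
Notation VR := (restrict_scalars E).
Context {Res : C -> V -> V} (HR : pseudo_resolvent Res).

(** Compactness of the segment, as for Lebesgue numbers. Each [t] controls [G] within [2 * d t], so
    that a point of height within [d t] of [t] and abscissa below half the common lower bound [m] of
    the chosen radii is still controlled. *)
Lemma inner_sides_small (G : C -> V) (e : R) : 0 < e ->
  (forall t, -1 <= t <= 1 -> exists v : V, filterlim G (off_axis t) (locally v)) ->
  exists a, 0 < a < 1 /\ forall y, -1 <= y <= 1 -> norm (minus (G (a, y)) (G (-a, y))) <= e.
Proof.
  intros He H.
  assert (Hd : forall t, exists d : posreal, -1 <= t <= 1 -> exists v : V, forall z,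
    Re z <> 0 -> Cmod (z - (0, t)) < 2 * d -> norm (minus (G z) v) < e / 2).
  { intro t. destruct (classic (-1 <= t <= 1)) as [Ht|Ht].
    - destruct (H t Ht) as [v Hv].
      assert (K := filterlim_norm_elim _ _ Hv (e / 2)). lapply K; [clear K; intro K | lra].
      apply off_axis_elim in K. destruct K as [d [Hd K]].
      assert (Hd2 : 0 < d / 2) by lra. exists (mkposreal _ Hd2). intros _. exists v.
      intros z Hz1 Hz2. apply K; [exact Hz1|]. simpl in Hz2. lra.
    - exists (mkposreal 1 Rlt_0_1). contradiction. }
  set (d := fun t => proj1_sig (constructive_indefinite_description _ (Hd t))).
  assert (Hd' : forall t, -1 <= t <= 1 -> exists v : V, forall z,
    Re z <> 0 -> Cmod (z - (0, t)) < 2 * d t -> norm (minus (G z) v) < e / 2).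
  { intro t. exact (proj2_sig (constructive_indefinite_description _ (Hd t))). }
  destruct (compactness_value_1d (-1) 1 d) as [m Hm].
  assert (Pm := cond_pos m). assert (M1 := Rmin_l (m / 2) (1 / 2)).
  assert (M2 := Rmin_r (m / 2) (1 / 2)).
  assert (M3 : 0 < Rmin (m / 2) (1 / 2)) by (apply Rmin_glb_lt; lra).
  exists (Rmin (m / 2) (1 / 2)). split; [lra|]. set (a := Rmin (m / 2) (1 / 2)) in *.
  intros y Hy. destruct (NNPP _ (Hm y Hy)) as [t [Ht [Ht1 Ht2]]].
  destruct (Hd' t Ht) as [v Hv].
  assert (B : forall x, x <> 0 -> Rabs x <= a -> norm (minus (G (x, y)) v) < e / 2).
  { intros x Hx Hxa. apply Hv; [exact Hx|].
    eapply Rle_lt_trans; [apply Cmod_le_Rabs|].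
    replace (Re ((x, y) - (0, t))%C) with x by (simpl; ring).
    replace (Im ((x, y) - (0, t))%C) with (y - t) by (simpl; ring). lra. }
  eapply Rle_trans; [apply (norm_minus_trans v)|].
  rewrite (norm_minus_sym v).
  assert (B1 := B a). assert (B2 := B (- a)).
  rewrite Rabs_Ropp, Rabs_pos_eq in B2 by lra. rewrite Rabs_pos_eq in B1 by lra.
  specialize (B1 ltac:(lra) ltac:(lra)). specialize (B2 ltac:(lra) ltac:(lra)). lra.
Qed.

(** * The Cauchy kernel on the sides of the square *)

Section Kernel.
Variables (w : R) (f : V).
Hypothesis Hw : 0 < w <= 1 / 2.
Let u : V := Res (RtoC w) f.
Let k x y : C := (cauchy_re w x y, cauchy_im w x y).

(** This is [pr_quotient] with [k = (1 + z^2) / (z - w)]. The left-hand side is regular at [w], so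
    the pole of the scalar term is cancelled by that of the other one. *)
Lemma weighted_kernel x y : x <> 0 -> 0 < (x - w) * (x - w) + y * y ->
  weighted (Res := Res) u (x, y) = minus (scal (k x y) u) (scal (k x y) (Res (x, y) f)).
Proof.
  intros Hx H. unfold weighted.
  assert (N : (RtoC w - (x, y))%C <> 0%C).
  { intro E0. assert (E1 : w - x = 0) by exact (f_equal Re E0).
    assert (E2 : 0 - y = 0) by exact (f_equal Im E0). nra. }
  assert (N' : ((x, y) - RtoC w)%C <> 0%C).
  { intro E0. apply N. replace (RtoC w - (x, y))%C with (- ((x, y) - RtoC w))%C by ring.
    rewrite E0. ring. }
  unfold u. rewrite (pr_quotient HR); [|exact Hx | simpl; lra | exact N].
  rewrite (cauchy_kernel_eq w x y H). fold (k x y).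
  generalize (k x y) (Res (x, y) f) (Res (RtoC w) f). intros c v1 v2.
  module_by V (field; exact N).
Qed.

(** Here [|z - w| >= 1/2], [|1 + z^2| <= 5] and [|Re z| = 1], whence the constant 10. *)
Lemma vertical_kernel_le x y : Rabs x = 1 -> -1 <= y <= 1 ->
  0 < (x - w) * (x - w) + y * y /\ norm (scal (k x y) (Res (x, y) f)) <= 10 * norm f.
Proof.
  intros Hx Hy.
  assert (Hxw : 1 / 2 <= Rabs (x - w)).
  { revert Hx. unfold Rabs. destruct (Rcase_abs x), (Rcase_abs (x - w)); lra. }
  assert (P : 0 < (x - w) * (x - w) + y * y).
  { assert (0 < (x - w) * (x - w)); [|nra].
    clear - Hxw. unfold Rabs in Hxw. destruct (Rcase_abs (x - w)); nra. }
  split; [exact P|].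
  rewrite norm_scal_eq.
  replace (10 * norm f) with ((/ (1 / 2) * 5) * (/ 1 * norm f)) by field.
  apply Rmult_le_compat; [apply Cmod_ge_0 | apply norm_ge_0 | |].
  - eapply Rle_trans; [apply (cauchy_kernel_norm w x y (1 / 2)); [lra | exact P|]|].
    + assert (K := re_le_Cmod ((x, y) - RtoC w)%C).
      replace (Re ((x, y) - RtoC w)%C) with (x - w) in K by (simpl; ring). lra.
    + apply Rmult_le_compat_l; [lra|]. unfold weight.
      eapply Rle_trans; [apply Cmod_triangle|]. rewrite Cmod_mult, Cmod_1.
      assert (B := Cmod_le_Rabs (x, y)). simpl in B. rewrite Hx in B.
      assert (Rabs y <= 1) by (apply Rabs_le; lra).
      assert (0 <= Cmod (x, y)) by apply Cmod_ge_0. nra.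
  - apply (pr_bound_le HR); [lra|]. simpl. lra.
Qed.

(** At [y^2 = 1] the weight factors as [x (x + 2 i y)], of modulus at most [3 |x|]; this cancels the
    bound [1 / |x|] of the resolvent, and [|z - w| >= 1]. *)
Lemma horizontal_kernel_le x y : 0 < Rabs x <= 1 -> Rabs y = 1 ->
  0 < (x - w) * (x - w) + y * y /\ norm (scal (k x y) (Res (x, y) f)) <= 3 * norm f.
Proof.
  intros Hx Hy.
  assert (Y2 : y * y = 1).
  { clear - Hy. unfold Rabs in Hy. destruct (Rcase_abs y); nra. }
  assert (P : 0 < (x - w) * (x - w) + y * y)
    by (rewrite Y2; generalize (Rle_0_sqr (x - w)); unfold Rsqr; lra).
  split; [exact P|].
  rewrite norm_scal_eq.
  replace (3 * norm f) with ((/ 1 * (3 * Rabs x)) * (/ Rabs x * norm f)) by (field; lra).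
  apply Rmult_le_compat; [apply Cmod_ge_0 | apply norm_ge_0 | |].
  - eapply Rle_trans; [apply (cauchy_kernel_norm w x y 1); [lra | exact P|]|].
    + assert (K := im_le_Cmod ((x, y) - RtoC w)%C).
      replace (Im ((x, y) - RtoC w)%C) with y in K by (simpl; ring). lra.
    + apply Rmult_le_compat_l; [lra|]. unfold weight.
      replace (1 + (x, y) * (x, y))%C with (RtoC x * (RtoC x + (0, (2 * y)%R)))%C
        by (unfold RtoC, Cplus, Cmult; simpl; f_equal; lra).
      rewrite Cmod_mult, Cmod_R, (Rmult_comm 3). apply Rmult_le_compat_l; [lra|].
      eapply Rle_trans; [apply Cmod_triangle|]. rewrite Cmod_R.
      assert (B := Cmod_le_Rabs (0, 2 * y)). simpl in B.
      rewrite Rabs_R0, Rabs_mult, Hy, (Rabs_pos_eq 2) in B by lra. lra.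
  - apply (pr_bound_le HR); simpl; lra.
Qed.

End Kernel.
(** A boundary value for [f] yields one for [Res w f], because [Res z (Res w f)] is a difference
    quotient of [Res z f] whose denominator stays away from 0. *)
Lemma pr_quotient_lim (w : C) (f v : V) (t : R) : Re w <> 0 ->
  filterlim (fun z => Res z f) (off_axis t) (locally v) ->
  filterlim (fun z => Res z (Res w f)) (off_axis t)
    (locally (scal (/ (w - (0, t)))%C (minus v (Res w f)))).
Proof.
  intros Hw Hf.
  assert (N := off_axis_neq w t Hw).
  apply filterlim_ext_loc with (fun z => scal (/ (w - z))%C (minus (Res z f) (Res w f))).
  - apply (off_axis_intro t _ (Cmod (w - (0, t)))); [apply Cmod_gt_0, N|].
    intros z Hz Hd. symmetry. apply (pr_quotient HR); [exact Hz | exact Hw|].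
    intro E0. replace w with z in Hd; [lra|].
    replace z with (w - (w - z))%C by ring. rewrite E0. ring.
  - apply (filterlim_comp_2 (F := off_axis t) (fun z => / (w - z))%C
      (fun z => minus (Res z f) (Res w f)) scal (G := locally (T := CU) (/ (w - (0, t)))%C)
      (H := locally (minus v (Res w f)))).
    + apply filterlim_Cinv; [exact N|].
      apply filterlim_Cplus; [apply (filterlim_const (U := CU))|].
      replace (- (0, t))%C with (- (1) * (0, t))%C by ring.
      apply filterlim_ext with (fun z => - (1) * z)%C; [intro; ring|].
      apply filterlim_Cmult; [apply (filterlim_const (U := CU)) | apply off_axis_id].
    + apply (filterlim_comp_2 (F := off_axis t) (fun z => Res z f) (fun _ => opp (Res w f)) plus
        (G := locally v) (H := locally (opp (Res w f)))); [exact Hf | apply filterlim_const|].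
      apply (filterlim_plus v).
    + apply (filterlim_scal (V := V)).
Qed.

Lemma weighted_lim (u v : V) (t : R) :
  filterlim (fun z => Res z u) (off_axis t) (locally v) ->
  filterlim (weighted (Res := Res) u) (off_axis t) (locally (scal (weight (0, t)) v)).
Proof.
  intro H. unfold weighted.
  apply (filterlim_comp_2 (F := off_axis t) weight (fun z => Res z u) scal
    (G := locally (T := CU) (weight (0, t))) (H := locally v)); [|exact H|].
  - apply filterlim_Cplus; [apply (filterlim_const (U := CU))|].
    apply filterlim_Cmult; apply off_axis_id.
  - apply (filterlim_scal (V := V)).
Qed.

Lemma cauchy_continuous_y w x y : 0 < (x - w) * (x - w) + y * y ->
  continuous (cauchy_re w x) y /\ continuous (cauchy_im w x) y.
Proof.
  intro H. split; apply (ex_derive_continuous (K := R_AbsRing) (V := R_NormedModule));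
    unfold cauchy_re, cauchy_im; auto_derive;
    repeat split; apply Rgt_not_eq; exact H.
Qed.

Lemma cauchy_continuous_x w x y : 0 < (x - w) * (x - w) + y * y ->
  continuous (fun s => cauchy_re w s y) x /\ continuous (fun s => cauchy_im w s y) x.
Proof.
  intro H. split; apply (ex_derive_continuous (K := R_AbsRing) (V := R_NormedModule));
    unfold cauchy_re, cauchy_im; auto_derive;
    repeat split; apply Rgt_not_eq; exact H.
Qed.

(** The polynomial part [z + w] contributes 2, the pole at least 1/4. This surplus matters: over the
    length 2 it gives 9/2, while the horizontal sides can take away at most 4. *)
Lemma vertical_kernel_ge w y : 0 < w <= 1 / 2 -> -1 <= y <= 1 ->
  9 / 4 <= cauchy_re w 1 y - cauchy_re w (-1) y.
Proof.
  intros Hw Hy. unfold cauchy_re.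
  set (d1 := (1 - w) * (1 - w) + y * y). set (d2 := (-1 - w) * (-1 - w) + y * y).
  assert (D1 : 0 < d1 <= 2) by (unfold d1; nra).
  assert (D2 : 0 < d2) by (unfold d2; nra).
  assert (B1 : 1 / 4 <= (1 - w) / d1).
  { apply Rmult_le_reg_r with d1; [lra|]. unfold Rdiv at 2. rewrite Rmult_assoc, Rinv_l by lra. lra. }
  assert (B2 : 0 <= - ((-1 - w) / d2)).
  { replace (- ((-1 - w) / d2)) with ((1 + w) / d2) by (field; lra).
    apply Rlt_le, Rdiv_lt_0_compat; lra. }
  set (q1 := (1 - w) / d1) in *. set (q2 := (-1 - w) / d2) in *. nra.
Qed.

Lemma horizontal_kernel_im_le w x : cauchy_im w x 1 - cauchy_im w x (-1) <= 2.
Proof.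
  unfold cauchy_im.
  replace ((x - w) * (x - w) + -1 * -1) with ((x - w) * (x - w) + 1 * 1) by ring.
  set (d := (x - w) * (x - w) + 1 * 1). assert (Hd : 0 < d)
    by (unfold d; generalize (Rle_0_sqr (x - w)); unfold Rsqr; lra).
  replace (-1 / d) with (- (1 / d)) by (field; lra).
  assert (0 < 1 / d) by (apply Rdiv_lt_0_compat; lra). nra.
Qed.

(* Cauchy's theorem for [(1 + z^2) Res z u], [u = Res w f], on the unit square cut
   along the axis. Since [Res z u = (Res z f - u) / (w - z)], it expresses [u], times a
   residue, by boundary values of [Res z f], whose blow-up at the axis is
   compensated by the weight [1 + z^2]. *)
Lemma near_axis_bound (w : R) (f : V) : 0 < w <= 1 / 2 ->
  (forall t, -1 <= t <= 1 -> exists v, filterlim (fun z => Res z f) (off_axis t) (locally v)) ->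
  norm (Res (RtoC w) f) <= 104 * norm f.
Proof.
  intros Hw Hreg. set (u := Res (RtoC w) f). set (W := weighted (Res := Res) u).
  assert (Hc : forall e, 0 < e -> norm u <= 104 * norm f + e).
  2: { apply le_epsilon. exact Hc. }
  intros e He.
  (* Integrated over length 2 the gap becomes [e / 2], and the final division by a scalar of modulus
     at least 1/2 turns it into [e]. *)
  destruct (inner_sides_small W (e / 4)) as [a [Ha Hgap]]; [lra| |].
  { intros t Ht. destruct (Hreg t Ht) as [v Hv].
    eexists. apply weighted_lim. apply pr_quotient_lim; [simpl; lra | exact Hv]. }
  destruct (weighted_rectangle HR u a 1 a) as [I1 [V1 H1]]; [lra | lra | left; lra |].
  destruct (weighted_rectangle HR u (-1) (-a) a) as [I2 [V2 H2]]; [lra | lra | right; lra |].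
  fold W in V1, H1, V2, H2.
  set (k := fun x y => (cauchy_re w x y, cauchy_im w x y) : C).
  assert (Hden : forall x y, Rabs x = 1 -> -1 <= y <= 1 -> 0 < (x - w) * (x - w) + y * y).
  { intros x y Hx Hy. apply (vertical_kernel_le w f Hw x y Hx Hy). }
  assert (A1 : Rabs 1 = 1) by (apply Rabs_pos_eq; lra).
  assert (A2 : Rabs (-1) = 1) by (rewrite Rabs_left; lra).
  assert (Hden' : forall x y, Rabs y = 1 -> 0 < (x - w) * (x - w) + y * y).
  { intros x y Hy. assert (y * y = 1) by (clear - Hy; unfold Rabs in Hy; destruct (Rcase_abs y); nra).
    generalize (Rle_0_sqr (x - w)); unfold Rsqr; lra. }
  assert (EP : ex_RInt (fun y => - (cauchy_im w 1 y - cauchy_im w (-1) y)) (-1) 1).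
  { apply (ex_RInt_continuous (V := R_CompleteNormedModule)).
    rewrite Rmin_left, Rmax_right by lra. intros y Hy.
    apply (continuous_opp (V := R_NormedModule)), (continuous_minus (V := R_NormedModule));
      apply cauchy_continuous_y, Hden; assumption. }
  assert (EQ : ex_RInt (fun y => cauchy_re w 1 y - cauchy_re w (-1) y) (-1) 1).
  { apply (ex_RInt_continuous (V := R_CompleteNormedModule)).
    rewrite Rmin_left, Rmax_right by lra. intros y Hy.
    apply (continuous_minus (V := R_NormedModule));
      apply cauchy_continuous_y, Hden; assumption. }
  destruct EP as [P EP]. destruct EQ as [Q EQ].
  assert (N1 : norm (minus (scal ((P, Q) : C) u) (minus (I1 1) (I2 (-1)))) <= (1 - -1) * (20 * norm f)).
  { apply (norm_is_RInt_le (fun y => minus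
      (scal ((- (cauchy_im w 1 y - cauchy_im w (-1) y), cauchy_re w 1 y - cauchy_re w (-1) y) : C) u)
      (minus (scal Ci (W (1, y))) (scal Ci (W (-1, y)))))); [lra| |].
    - intros y Hy.
      destruct (vertical_kernel_le w f Hw 1 y A1 Hy) as [D1 B1].
      destruct (vertical_kernel_le w f Hw (-1) y A2 Hy) as [D2 B2].
      unfold W, u. rewrite !(weighted_kernel w f Hw) by (assumption || lra). fold u.
      fold (k 1 y). fold (k (-1) y). fold (k 1 y) in B1. fold (k (-1) y) in B2.
      replace ((- (cauchy_im w 1 y - cauchy_im w (-1) y), cauchy_re w 1 y - cauchy_re w (-1) y) : C)
        with (Ci * (k 1 y - k (-1) y))%C
        by (unfold k, Ci, Cmult, Cminus, Cplus, Copp; simpl; f_equal; ring).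
      replace (minus _ _) with (scal Ci
        (minus (scal (k 1 y) (Res (1, y) f)) (scal (k (-1) y) (Res (-1, y) f))))
        by module_ring V.
      rewrite norm_scal_eq, Cmod_Ci, Rmult_1_l.
      eapply Rle_trans; [apply norm_minus_le|]. lra.
    - apply (is_RInt_minus (V := VR)); [apply scal_is_RInt; assumption|].
      apply (is_RInt_minus (V := VR)); [apply V1 | apply V2]; lra. }
  (* One estimate serves the horizontal sides of both rectangles. [P'] is left free, since only the
     imaginary part of the total scalar is bounded below. *)
  assert (Hh : forall (l r : R) (Il Ir : V), l < r -> r - l <= 1 ->
    (forall x, l <= x <= r -> 0 < Rabs x <= 1) ->
    is_RInt (V := VR) (fun x => minus (W (x, 1)) (W (x, -1))) l r (minus Ir Il) ->
    exists P' Q' : R, Q' <= 2 /\ norm (minus (scal ((P', Q') : C) u) (minus Ir Il)) <= 6 * norm f).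
  { intros l r Il Ir Hlr Hlr1 Habs HI.
    assert (EP' : ex_RInt (fun x => cauchy_re w x 1 - cauchy_re w x (-1)) l r).
    { apply (ex_RInt_continuous (V := R_CompleteNormedModule)). intros x Hx.
      apply (continuous_minus (V := R_NormedModule) (fun x => cauchy_re w x 1)
        (fun x => cauchy_re w x (-1)));
        apply cauchy_continuous_x, Hden'; assumption. }
    assert (EQ' : ex_RInt (fun x => cauchy_im w x 1 - cauchy_im w x (-1)) l r).
    { apply (ex_RInt_continuous (V := R_CompleteNormedModule)). intros x Hx.
      apply (continuous_minus (V := R_NormedModule) (fun x => cauchy_im w x 1)
        (fun x => cauchy_im w x (-1)));
        apply cauchy_continuous_x, Hden'; assumption. }
    destruct EP' as [P' EP']. destruct EQ' as [Q' EQ']. exists P', Q'. split.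
    - apply Rle_trans with ((r - l) * 2); [|lra].
      apply (is_RInt_le _ (fun _ => 2) l r _ _ (Rlt_le _ _ Hlr) EQ' (is_RInt_const (V := R_NormedModule) l r 2)).
      intros x _. apply horizontal_kernel_im_le.
    - apply Rle_trans with ((r - l) * (6 * norm f)).
      2: { generalize (norm_ge_0 f). nra. }
      apply (norm_is_RInt_le (fun x => minus
        (scal ((cauchy_re w x 1 - cauchy_re w x (-1), cauchy_im w x 1 - cauchy_im w x (-1)) : C) u)
        (minus (W (x, 1)) (W (x, -1))))); [lra| |].
      + intros x Hx. specialize (Habs x Hx).
        assert (Nx : x <> 0) by (intro E0; rewrite E0, Rabs_R0 in Habs; lra).
        destruct (horizontal_kernel_le w f x 1 Habs A1) as [D1 B1].
        destruct (horizontal_kernel_le w f x (-1) Habs A2) as [D2 B2].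
        unfold W, u. rewrite !(weighted_kernel w f Hw) by assumption. fold u.
        fold (k x 1). fold (k x (-1)). fold (k x 1) in B1. fold (k x (-1)) in B2.
        replace ((cauchy_re w x 1 - cauchy_re w x (-1), cauchy_im w x 1 - cauchy_im w x (-1)) : C)
          with (k x 1 - k x (-1))%C
          by (unfold k, Cminus, Cplus, Copp; simpl; f_equal; ring).
        replace (minus _ _) with
          (minus (scal (k x 1) (Res (x, 1) f)) (scal (k x (-1)) (Res (x, -1) f)))
          by module_ring V.
        eapply Rle_trans; [apply norm_minus_le|]. lra.
      + apply (is_RInt_minus (V := VR)); [apply scal_is_RInt; assumption | exact HI]. }
  destruct (Hh a 1 (I1 a) (I1 1)) as [P2 [Q2 [L2 N2]]]; [lra | lra | | exact H1|].
  { intros x Hx. rewrite Rabs_pos_eq; lra. }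
  destruct (Hh (-1) (-a) (I2 (-1)) (I2 (-a))) as [P3 [Q3 [L3 N3]]]; [lra | lra | | exact H2|].
  { intros x Hx. rewrite Rabs_left; lra. }
  assert (N4 : norm (minus (I1 a) (I2 (-a))) <= (1 - -1) * (e / 4)).
  { apply (norm_is_RInt_le (fun y => minus (scal Ci (W (a, y))) (scal Ci (W (-a, y))))); [lra| |].
    - intros y Hy. rewrite <- (scal_minus_distr_l Ci (W (a, y)) (W (-a, y))).
      rewrite norm_scal_eq, Cmod_Ci, Rmult_1_l. apply Hgap. exact Hy.
    - apply (is_RInt_minus (V := VR)); [apply V1 | apply V2]; lra. }
  assert (L1 : 9 / 2 <= Q).
  { replace (9 / 2) with ((1 - -1) * (9 / 4)) by field.
    apply (is_RInt_le (fun _ => 9 / 4) _ (-1) 1 _ _ ltac:(lra)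
      (is_RInt_const (V := R_NormedModule) (-1) 1 (9 / 4)) EQ).
    intros y Hy. apply vertical_kernel_ge; lra. }
  (* This is the integral of the kernel over the boundary of the square without its gap at the axis,
     close to [2 pi i (1 + w^2)] for small [a]. The crude bound [9/2 - 2 - 2] on its imaginary part
     is enough. *)
  set (c := ((P, Q) - (P2, Q2) - (P3, Q3))%C).
  assert (Lc : 1 / 2 <= Cmod c).
  { eapply Rle_trans; [|apply im_le_Cmod]. eapply Rle_trans; [|apply Rle_abs].
    simpl. lra. }
  (* The vertical sides give 40, each pair of horizontal sides 6, the inner sides [e / 2]. *)
  assert (Nc : norm (scal c u) <= 52 * norm f + e / 2).
  { unfold c.
    replace (scal ((P, Q) - (P2, Q2) - (P3, Q3))%C u) with
      (plus (minus (minus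
        (minus (scal ((P, Q) : C) u) (minus (I1 1) (I2 (-1))))
        (minus (scal ((P2, Q2) : C) u) (minus (I1 1) (I1 a))))
        (minus (scal ((P3, Q3) : C) u) (minus (I2 (-a)) (I2 (-1)))))
        (minus (I1 a) (I2 (-a)))) by module_ring V.
    eapply Rle_trans; [apply (norm_triangle (V := V))|].
    eapply Rle_trans; [apply Rplus_le_compat_r, norm_minus_le|].
    eapply Rle_trans; [apply Rplus_le_compat_r, Rplus_le_compat_r, norm_minus_le|].
    lra. }
  rewrite norm_scal_eq in Nc. generalize (norm_ge_0 u). nra.
Qed.

End AxisBound.

(** * Boundary values on the axis *)

Section AxisLimits.
Context {E : CompleteNormedModule C_AbsRing}.
Notation V := (CompleteNormedModule.NormedModule C_AbsRing E).

Definition axis_limit (Res : C -> V -> V) (f : V) (eta : R) (v : V) : Prop :=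
  filterlim (fun z => Res z f) (off_axis eta) (locally v).

Lemma axis_limit_elim Res f eta v e : axis_limit Res f eta v -> 0 < e ->
  exists d, 0 < d /\ forall z, Re z <> 0 -> Cmod (z - (0, eta)) < d ->
    norm (minus (Res z f) v) < e.
Proof.
  intros H He. apply off_axis_elim. exact (filterlim_norm_elim _ _ H e He).
Qed.

Lemma axis_limit_minus (Res : C -> V -> V) (HR : pseudo_resolvent Res) f g eta v w :
  axis_limit Res f eta v -> axis_limit Res g eta w ->
  axis_limit Res (minus f g) eta (minus v w).
Proof.
  intros Hf Hg. unfold axis_limit.
  apply filterlim_within_ext with (fun z => minus (Res z f) (Res z g)).
  - intros z Hz. symmetry. apply (pr_minus HR). exact Hz.
  - apply (filterlim_comp_2 (F := off_axis eta) (fun z => Res z f) (fun z => opp (Res z g)) plus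
      (G := locally v) (H := locally (opp w))); [exact Hf | | apply (filterlim_plus v)].
    eapply filterlim_comp; [exact Hg | apply (filterlim_opp w)].
Qed.

Lemma axis_limit_plus (Res : C -> V -> V) (HR : pseudo_resolvent Res) f g eta v w :
  axis_limit Res f eta v -> axis_limit Res g eta w ->
  axis_limit Res (plus f g) eta (plus v w).
Proof.
  intros Hf Hg. unfold axis_limit.
  apply filterlim_within_ext with (fun z => plus (Res z f) (Res z g)).
  - intros z Hz. symmetry. apply (pr_plus _ HR). exact Hz.
  - apply (filterlim_comp_2 (F := off_axis eta) (fun z => Res z f) (fun z => Res z g) plus
      (G := locally v) (H := locally w)); [exact Hf | exact Hg | apply (filterlim_plus v)].
Qed.

Lemma axis_limit_scal (Res : C -> V -> V) (HR : pseudo_resolvent Res) (k : C) f eta v :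
  axis_limit Res f eta v -> axis_limit Res (scal k f) eta (scal k v).
Proof.
  intros Hf. unfold axis_limit.
  apply filterlim_within_ext with (fun z => scal k (Res z f)).
  - intros z Hz. symmetry. apply (pr_scal _ HR). exact Hz.
  - eapply filterlim_comp; [exact Hf | apply (filterlim_scal_r k v)].
Qed.

(** An affine change of variable that preserves the axis, sends 0 to [i eta] and turns radius [r]
    into 1; the factor [r] restores both the norm bound and the resolvent identity. *)
Lemma pr_rescale (Res : C -> V -> V) (HR : pseudo_resolvent Res) (eta r : R) : 0 < r ->
  pseudo_resolvent (fun z f => scal (RtoC r) (Res ((0, eta) + RtoC r * z)%C f)).
Proof.
  intro Hr.
  assert (HRe : forall z, Re ((0, eta) + RtoC r * z)%C = r * Re z)
    by (intro z; unfold RtoC, Cmult, Cplus, Re; simpl; ring).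
  assert (Hn : forall z, Re z <> 0 -> Re ((0, eta) + RtoC r * z)%C <> 0)
    by (intros z Hz; rewrite HRe; apply Rmult_integral_contrapositive; split; lra).
  constructor.
  - intros z x y Hz. rewrite (pr_plus _ HR) by (apply Hn, Hz). module_ring V.
  - intros z k x Hz. rewrite (pr_scal _ HR) by (apply Hn, Hz). module_ring V.
  - intros z x Hz. rewrite norm_scal_eq, Cmod_R, (Rabs_pos_eq r) by lra.
    apply Rmult_le_reg_l with (/ r); [apply Rinv_0_lt_compat, Hr|].
    rewrite <- Rmult_assoc, Rinv_l, Rmult_1_l by lra.
    eapply Rle_trans; [apply (pr_bound _ HR), Hn, Hz|].
    rewrite HRe, Rabs_mult, (Rabs_pos_eq r) by lra. apply Req_le. field.
    split; [apply Rabs_no_R0, Hz | lra].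
  - intros z w x Hz Hw. rewrite (pr_scal _ HR) by (apply Hn, Hz).
    assert (K := pr_eq _ HR _ _ x (Hn z Hz) (Hn w Hw)).
    transitivity (scal (RtoC r) (minus (Res ((0, eta) + RtoC r * z)%C x)
      (Res ((0, eta) + RtoC r * w)%C x))); [module_ring V|].
    rewrite K. module_ring V.
Qed.

Context {Res : C -> V -> V} (HR : pseudo_resolvent Res).

(** After rescaling, [near_axis_bound] holds with one constant for all small [w > 0]; letting [w]
    tend to 0 carries it over to the boundary value. *)
Lemma axis_bound (f v : V) (eta r : R) : 0 < r ->
  (forall t, Rabs (t - eta) <= r -> exists v', axis_limit Res f t v') ->
  axis_limit Res f eta v -> norm v <= 104 / r * norm f.
Proof.
  intros Hr Hreg Hv. apply le_epsilon. intros e He.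
  destruct (axis_limit_elim Res f eta v e Hv He) as [d [Hd Hlim]].
  assert (Hw0 : 0 < Rmin (1 / 2) (d / (2 * r)))
    by (apply Rmin_glb_lt; [lra | apply Rdiv_lt_0_compat; lra]).
  assert (Hw1 := Rmin_l (1 / 2) (d / (2 * r))). assert (Hw2 := Rmin_r (1 / 2) (d / (2 * r))).
  set (w := Rmin (1 / 2) (d / (2 * r))) in *.
  assert (K := near_axis_bound (pr_rescale Res HR eta r Hr) w f (conj Hw0 Hw1)).
  lapply K; clear K.
  - intro K. rewrite norm_scal_eq, Cmod_R, Rabs_pos_eq in K by lra.
    specialize (Hlim ((0, eta) + RtoC r * RtoC w)%C).
    lapply Hlim; clear Hlim.
    2: { unfold RtoC, Cmult, Cplus, Re; simpl. nra. }
    intro Hlim. lapply Hlim; clear Hlim.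
    2: { replace ((0, eta) + RtoC r * RtoC w - (0, eta))%C with (RtoC (r * w))
           by (rewrite RtoC_mult; ring).
         rewrite Cmod_R, Rabs_pos_eq by nra.
         apply Rle_lt_trans with (r * (d / (2 * r))); [apply Rmult_le_compat_l; lra|].
         replace (r * (d / (2 * r))) with (d / 2) by (field; lra). lra. }
    intro Hlim. assert (T0 := norm_le_minus v (Res ((0, eta) + RtoC r * RtoC w)%C f)).
    rewrite norm_minus_sym in T0.
    assert (K' : norm (Res ((0, eta) + RtoC r * RtoC w)%C f) <= 104 / r * norm f).
    { apply Rmult_le_reg_l with r; [exact Hr|].
      replace (r * (104 / r * norm f)) with (104 * norm f) by (field; lra). exact K. }
    lra.
  - intros t Ht. destruct (Hreg (eta + r * t)) as [v' Hv'].
    { replace (eta + r * t - eta) with (r * t) by ring.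
      rewrite Rabs_mult, Rabs_pos_eq by lra.
      assert (Rabs t <= 1) by (apply Rabs_le; lra). nra. }
    exists (scal (RtoC r) v').
    apply (filterlim_comp _ _ _ (fun z => Res ((0, eta) + RtoC r * z)%C f) (scal (RtoC r)) _
      (locally v')); [|apply (filterlim_scal_r (RtoC r) v')].
    apply (filterlim_comp _ _ _ (fun z => (0, eta) + RtoC r * z)%C (fun z => Res z f) _
      (off_axis (eta + r * t))); [|exact Hv'].
    intros P HP. apply off_axis_elim in HP. destruct HP as [d' [Hd' HP]].
    apply (off_axis_intro t _ (d' / r)); [apply Rdiv_lt_0_compat; lra|].
    intros z Hz1 Hz2. apply HP.
    + unfold RtoC, Cmult, Cplus, Re; simpl. unfold Re in Hz1.
      replace (0 + (r * fst z - 0 * snd z)) with (r * fst z) by ring.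
      apply Rmult_integral_contrapositive; split; lra.
    + replace ((0, eta) + RtoC r * z - (0, (eta + r * t)%R))%C with (RtoC r * (z - (0, t)))%C
        by (unfold RtoC, Cmult, Cminus, Cplus, Copp; simpl; f_equal; ring).
      rewrite Cmod_mult, Cmod_R, Rabs_pos_eq by lra.
      apply Rmult_lt_compat_l with (r := r) in Hz2; [|exact Hr].
      replace (r * (d' / r)) with d' in Hz2 by (field; lra). exact Hz2.
Qed.

Lemma is_linear_pr (z : C) : Re z <> 0 -> is_linear (K := C_AbsRing) (Res z).
Proof.
  intro Hz. constructor.
  - intros x y. apply (pr_plus _ HR), Hz.
  - intros k x. apply (pr_scal _ HR), Hz.
  - exists (/ Rabs (Re z)). assert (0 < Rabs (Re z)) by (apply Rabs_pos_lt, Hz). split.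
    + apply Rinv_0_lt_compat. assumption.
    + intro x. rewrite Rmult_comm. apply (pr_bound _ HR), Hz.
Qed.

(** The resolvent identity survives the passage to the axis, by continuity of [Res z]: [v] plays the
    role of a resolvent at [i eta]. *)
Lemma axis_limit_eq f eta v z : Re z <> 0 -> axis_limit Res f eta v ->
  minus (Res z f) v = scal ((0, eta) - z)%C (Res z v).
Proof.
  intros Hz Hv.
  apply (filterlim_locally_unique (F := off_axis eta) (fun w => minus (Res z f) (Res w f))).
  - apply (filterlim_comp_2 (F := off_axis eta) (fun _ => Res z f) (fun w => opp (Res w f)) plus
      (G := locally (Res z f)) (H := locally (opp v)));
      [apply filterlim_const | | apply (filterlim_plus (V := V))].
    eapply filterlim_comp; [exact Hv | apply (filterlim_opp v)].
  - apply filterlim_within_ext with (fun w => scal (w - z)%C (Res z (Res w f))).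
    { intros w Hw. symmetry. apply (pr_eq _ HR); assumption. }
    apply (filterlim_comp_2 (F := off_axis eta) (fun w => w - z)%C (fun w => Res z (Res w f)) scal
      (G := locally (T := CU) ((0, eta) - z)%C) (H := locally (Res z v)));
      [| | apply (filterlim_scal (V := V))].
    + apply filterlim_Cplus; [apply off_axis_id | apply (filterlim_const (U := CU))].
    + eapply filterlim_comp; [exact Hv|]. apply (linear_cont (Res z) v), is_linear_pr, Hz.
Qed.

(** * Vectors with boundary values on an open part of the axis *)

Section OpenSet.
Context {J : R -> Prop} (HJ : open J).

Definition regular (f : V) : Prop := forall t, J t -> exists v, axis_limit Res f t v.

Lemma open_radius eta : J eta -> exists r, 0 < r /\ forall t, Rabs (t - eta) <= r -> J t.
Proof.
  intro H. destruct (HJ eta H) as [d Hd]. assert (P := cond_pos d). exists (d / 2).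
  split; [lra|]. intros t Ht. apply Hd. change (Rabs (t - eta) < d). lra.
Qed.

(** The constant depends on the size of an interval around [eta] inside [J], and not on [f]; all
    later uniformity rests on this. *)
Lemma regular_bound eta : J eta ->
  exists M, 0 < M /\ forall f v, regular f -> axis_limit Res f eta v -> norm v <= M * norm f.
Proof.
  intro H. destruct (open_radius eta H) as [r [Hr HrJ]]. exists (104 / r). split.
  - apply Rdiv_lt_0_compat; lra.
  - intros f v Hf Hv. apply (axis_bound f v eta r Hr); [|exact Hv].
    intros t Ht. apply Hf, HrJ, Ht.
Qed.

Lemma regular_pr w f : Re w <> 0 -> regular f -> regular (Res w f).
Proof.
  intros Hw Hf t Ht. destruct (Hf t Ht) as [v Hv]. eexists.
  apply (pr_quotient_lim HR); [exact Hw | exact Hv].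
Qed.

Lemma regular_minus f g : regular f -> regular g -> regular (minus f g).
Proof.
  intros Hf Hg t Ht. destruct (Hf t Ht) as [v Hv]. destruct (Hg t Ht) as [w Hw].
  exists (minus v w). apply axis_limit_minus; assumption.
Qed.

(* The boundary value [v] of [Res z g] satisfies [v - Res w g = (w - i eta) v'], where
   [v'] is that of [Res z (Res w g)]: for [w] close to [i eta] the norm of [Res w g] is
   absorbed. *)
Lemma regular_local_bound eta : J eta ->
  exists d M, 0 < d /\ 0 < M /\ forall g w, regular g -> Re w <> 0 ->
    Cmod (w - (0, eta)) < d -> norm (Res w g) <= M * norm g.
Proof.
  intro H. destruct (regular_bound eta H) as [M [HM HB]].
  exists (/ (2 * M)), (2 * M). split; [apply Rinv_0_lt_compat; lra|]. split; [lra|].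
  intros g w Hg Hw Hd. destruct (Hg eta H) as [v Hv].
  assert (B1 := HB g v Hg Hv).
  assert (B2 := HB _ _ (regular_pr w g Hw Hg) (pr_quotient_lim HR w g v eta Hw Hv)).
  assert (N := off_axis_neq w eta Hw).
  rewrite norm_scal_eq, Cmod_inv in B2 by exact N.
  assert (PN := proj1 (Cmod_gt_0 _) N).
  set (c := Cmod (w - (0, eta))) in *. assert (T0 := norm_le_minus (Res w g) v).
  rewrite norm_minus_sym in T0.
  set (A := norm (minus v (Res w g))) in *. set (B := norm (Res w g)) in *.
  assert (HA : A <= c * (M * B)).
  { apply Rmult_le_reg_l with (/ c); [apply Rinv_0_lt_compat, PN|].
    rewrite <- (Rmult_assoc (/ c)), Rinv_l, Rmult_1_l by lra. exact B2. }
  assert (HcM : c * M <= 1 / 2).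
  { apply Rmult_lt_compat_r with (r := M) in Hd; [|exact HM].
    replace (/ (2 * M) * M) with (1 / 2) in Hd by (field; lra). lra. }
  assert (0 <= B) by apply norm_ge_0. nra.
Qed.

Lemma axis_cauchy (g : C -> V) eta :
  (forall e, 0 < e -> exists d, 0 < d /\ forall w w', Re w <> 0 -> Re w' <> 0 ->
    Cmod (w - (0, eta)) < d -> Cmod (w' - (0, eta)) < d -> norm (minus (g w') (g w)) < e) ->
  exists v, filterlim g (off_axis eta) (locally v).
Proof.
  intro H. apply (filterlim_locally_cauchy (U := E) (F := off_axis eta)).
  intro e. destruct (H e (cond_pos e)) as [d [Hd K]].
  exists (fun w => Re w <> 0 /\ Cmod (w - (0, eta)) < d). split.
  - apply (off_axis_intro eta _ d Hd). tauto.
  - intros w w' [H1 H2] [H3 H4]. apply (norm_compat1 (V := V)). apply K; assumption.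
Qed.

(** Near [i eta] the maps [Res w] are equibounded on regular vectors, so a limit of regular vectors
    inherits the Cauchy property of [Res w] at the axis. *)
Lemma regular_closed : closed regular.
Proof.
  apply closed_norm. intros f Hf eta Heta.
  destruct (regular_local_bound eta Heta) as [d [M [Hd [HM HB]]]].
  (* The local bound does not apply to [f - g] itself, [f] not being known to be regular. For fixed
     [w], however, [Res w] is bounded by [1 / |Re w|], so [f] may be replaced by a regular [g']
     chosen depending on [w]; the bad constant disappears in the limit. *)
  assert (HB' : forall g w, regular g -> Re w <> 0 -> Cmod (w - (0, eta)) < d ->
    norm (minus (Res w f) (Res w g)) <= M * norm (minus f g)).
  { intros g w Hg Hw Hwd. apply le_epsilon. intros e He.
    assert (Pw : 0 < / Rabs (Re w)) by (apply Rinv_0_lt_compat, Rabs_pos_lt, Hw).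
    destruct (Hf (e / (/ Rabs (Re w) + M))) as [g' [Hg' Hfg]]; [apply Rdiv_lt_0_compat; lra|].
    assert (B1 := HB (minus g' g) w (regular_minus g' g Hg' Hg) Hw Hwd).
    assert (B2 := pr_bound _ HR w (minus f g') Hw). unfold Rdiv in B2.
    rewrite (pr_minus HR) in B1, B2 by exact Hw.
    assert (T1 := norm_minus_trans (Res w g') (Res w f) (Res w g)).
    assert (T2 := norm_minus_trans f g' g). rewrite (norm_minus_sym g' f) in T2.
    apply Rmult_lt_compat_r with (r := / Rabs (Re w) + M) in Hfg; [|lra].
    set (q := / Rabs (Re w)) in *. clearbody q.
    replace (e / (q + M) * (q + M)) with e in Hfg by (field; lra).
    set (n1 := norm (minus f g')) in *.
    set (n2 := norm (minus f g)) in *. nra. }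
  apply axis_cauchy. intros e He.
  destruct (Hf (e / (4 * M))) as [g [Hg Hfg]]; [apply Rdiv_lt_0_compat; lra|].
  destruct (Hg eta Heta) as [v Hv].
  destruct (axis_limit_elim Res g eta v (e / 4) Hv) as [d' [Hd' Hlim]]; [lra|].
  exists (Rmin d d'). split; [apply Rmin_glb_lt; assumption|].
  assert (D1 := Rmin_l d d'). assert (D2 := Rmin_r d d').
  intros w w' Hw Hw' Hwd Hwd'.
  assert (A1 := HB' g w Hg Hw ltac:(lra)). assert (A2 := HB' g w' Hg Hw' ltac:(lra)).
  assert (A3 := Hlim w Hw ltac:(lra)). assert (A4 := Hlim w' Hw' ltac:(lra)).
  apply Rmult_lt_compat_l with (r := M) in Hfg; [|exact HM].
  replace (M * (e / (4 * M))) with (e / 4) in Hfg by (field; lra).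
  assert (T1 := norm_minus_trans (Res w' g) (Res w' f) (Res w f)).
  assert (T2 := norm_minus_trans v (Res w' g) (Res w f)).
  assert (T3 := norm_minus_trans (Res w g) v (Res w f)).
  rewrite (norm_minus_sym v (Res w g)) in T3. rewrite (norm_minus_sym (Res w g) (Res w f)) in T3. lra.
Qed.

(* The difference quotient at [w] is minus the boundary value of [Res z (Res w f)],
   so by [regular_bound] it is Cauchy because [Res w f] is. *)
Lemma regular_differentiable f eta v : J eta -> regular f -> axis_limit Res f eta v ->
  exists l, filterlim (fun w => scal (/ (w - (0, eta)))%C (minus (Res w f) v))
    (off_axis eta) (locally l).
Proof.
  intros Heta Hf Hv. destruct (regular_bound eta Heta) as [M [HM HB]].
  apply axis_cauchy. intros e He.
  destruct (axis_limit_elim Res f eta v (e / (2 * M)) Hv) as [d [Hd Hlim]];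
    [apply Rdiv_lt_0_compat; lra|].
  exists d. split; [exact Hd|]. intros w w' Hw Hw' Hwd Hwd'.
  assert (B := HB _ _ (regular_minus _ _ (regular_pr w f Hw Hf) (regular_pr w' f Hw' Hf))
    (axis_limit_minus Res HR _ _ _ _ _ (pr_quotient_lim HR w f v eta Hw Hv)
      (pr_quotient_lim HR w' f v eta Hw' Hv))).
  assert (Eq : minus (scal (/ (w' - (0, eta)))%C (minus (Res w' f) v))
    (scal (/ (w - (0, eta)))%C (minus (Res w f) v)) =
    minus (scal (/ (w - (0, eta)))%C (minus v (Res w f)))
      (scal (/ (w' - (0, eta)))%C (minus v (Res w' f)))) by module_ring V.
  refine (Rle_lt_trans _ _ _ (Req_le _ _ (f_equal norm Eq)) _).
  eapply Rle_lt_trans; [exact B|].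
  assert (A1 := Hlim w Hw Hwd). assert (A2 := Hlim w' Hw' Hwd').
  assert (T1 := norm_minus_trans v (Res w f) (Res w' f)).
  rewrite (norm_minus_sym v) in T1.
  apply Rle_lt_trans with (M * (norm (minus (Res w f) v) + norm (minus (Res w' f) v))).
  { apply Rmult_le_compat_l; lra. }
  apply Rmult_lt_reg_l with (/ M); [apply Rinv_0_lt_compat, HM|].
  rewrite <- Rmult_assoc, Rinv_l, Rmult_1_l by lra.
  replace (/ M * e) with (e / (2 * M) + e / (2 * M)) by (field; lra). lra.
Qed.

Lemma Cderive_intro (Phi : C -> V) (z : C) (l : V) :
  (forall e, 0 < e -> exists d, 0 < d /\ forall w, Cmod (w - z) < d ->
    norm (minus (minus (Phi w) (Phi z)) (scal (w - z)%C l)) <= e * Cmod (w - z)) ->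
  is_derive (K := C_AbsRing) Phi z l.
Proof.
  intro H. split; [apply (is_linear_scal_l (V := V) l)|].
  intros z' Hz'. apply (is_filter_lim_locally_unique (V := AbsRing_NormedModule C_AbsRing)) in Hz'.
  subst z'. intro e. destruct (H e (cond_pos e)) as [d [Hd K]].
  exists (mkposreal d Hd). intros w Hw. exact (K w Hw).
Qed.

Lemma pr_derive z f : Re z <> 0 -> exists d, 0 < d /\ (forall w, Cmod (w - z) < d -> Re w <> 0) /\
  forall e, 0 < e -> exists d', 0 < d' /\ forall w, Cmod (w - z) < d' ->
    norm (minus (minus (Res w f) (Res z f)) (scal (w - z)%C (opp (Res z (Res z f)))))
      <= e * Cmod (w - z).
Proof.
  intro Hz. assert (P : 0 < Rabs (Re z)) by apply Rabs_pos_lt, Hz.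
  assert (Hb : forall w, Cmod (w - z) < Rabs (Re z) / 2 -> Rabs (Re z) / 2 <= Rabs (Re w)).
  { intros w Hw. assert (K := re_le_Cmod (w - z)%C).
    replace (Re (w - z)%C) with (Re w - Re z) in K by (simpl; unfold Re; ring).
    assert (T0 := Rabs_triang_inv (Re z) (Re w)).
    rewrite Rabs_minus_sym in T0. lra. }
  exists (Rabs (Re z) / 2). split; [lra|]. split.
  { intros w Hw E0. specialize (Hb w Hw). rewrite E0, Rabs_R0 in Hb. lra. }
  intros e He. set (q := / (Rabs (Re z) / 2) * norm (Res z (Res z f))).
  assert (Hq : 0 <= q).
  { apply Rmult_le_pos; [apply Rlt_le, Rinv_0_lt_compat; lra | apply norm_ge_0]. }
  exists (Rmin (Rabs (Re z) / 2) (e / (q + 1))). split.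
  { apply Rmin_glb_lt; [lra | apply Rdiv_lt_0_compat; lra]. }
  intros w Hw.
  assert (D1 := Rmin_l (Rabs (Re z) / 2) (e / (q + 1))).
  assert (D2 := Rmin_r (Rabs (Re z) / 2) (e / (q + 1))).
  assert (Bw := Hb w ltac:(lra)).
  assert (Nw : Re w <> 0) by (intro E0; rewrite E0, Rabs_R0 in Bw; lra).
  rewrite (pr_taylor HR) by assumption.
  replace (minus _ _) with (scal ((w - z) * (w - z))%C (Res w (Res z (Res z f)))) by module_ring V.
  rewrite norm_scal_eq, Cmod_mult.
  assert (B := pr_bound_le HR w (Res z (Res z f)) (Rabs (Re z) / 2) ltac:(lra) Bw). fold q in B.
  set (c := Cmod (w - z)) in *. assert (0 <= c) by apply Cmod_ge_0.
  assert (Hc : c * (q + 1) <= e).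
  { apply Rlt_le. replace e with (e / (q + 1) * (q + 1)) by (field; lra).
    apply Rmult_lt_compat_r; lra. }
  assert (0 <= norm (Res w (Res z (Res z f)))) by apply norm_ge_0.
  rewrite (Rmult_comm e), Rmult_assoc. apply Rmult_le_compat_l; [assumption|]. nra.
Qed.

(** The extension is the boundary value on the axis over [J], and an arbitrary value elsewhere on
    the axis. At [i eta] the derivative is the limit of the off-axis difference quotients;
    increments along the axis are reduced to off-axis ones. *)
Lemma regular_extension f : regular f -> exists Phi : C -> V,
  holomorphic_on (fun z => Re z <> 0 \/ J (Im z)) Phi /\
  forall z, Re z <> 0 -> Phi z = Res z f.
Proof.
  intro Hf.
  set (Phi := fun z => if excluded_middle_informative (Re z = 0)
    then epsilon (inhabits zero) (axis_limit Res f (Im z)) else Res z f).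
  assert (Poff : forall z, Re z <> 0 -> Phi z = Res z f).
  { intros z Hz. unfold Phi. destruct (excluded_middle_informative (Re z = 0)); tauto. }
  assert (Pon : forall t, J t -> axis_limit Res f t (Phi (0, t))).
  { intros t Ht. unfold Phi. destruct (excluded_middle_informative (Re (0, t) = 0)) as [_|N].
    - apply epsilon_spec. apply Hf. exact Ht.
    - exfalso. apply N. reflexivity. }
  exists Phi. split; [|exact Poff].
  intros z Hz. destruct (Req_dec (Re z) 0) as [E0|N0].
  2: { exists (opp (Res z (Res z f))). apply Cderive_intro. intros e He.
    destruct (pr_derive z f N0) as [d [Hd [Hoff K]]].
    destruct (K e He) as [d' [Hd' K']].
    exists (Rmin d d'). split; [apply Rmin_glb_lt; assumption|]. intros w Hw.
    assert (D1 := Rmin_l d d'). assert (D2 := Rmin_r d d').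
    rewrite !Poff; [apply K'; lra | exact N0 | apply Hoff; lra]. }
  destruct z as [x eta]. simpl in E0, Hz. subst x.
  assert (Heta : J eta) by (destruct Hz as [Hz|Hz]; [lra | exact Hz]). clear Hz.
  set (v := Phi (0, eta)). assert (Hv := Pon eta Heta). fold v in Hv.
  destruct (regular_differentiable f eta v Heta Hf Hv) as [l Hl].
  exists l. apply Cderive_intro. intros e He. fold v.
  destruct (open_radius eta Heta) as [r [Hr HrJ]].
  assert (K := filterlim_norm_elim _ _ Hl e He). apply off_axis_elim in K.
  destruct K as [d [Hd K]].
  assert (Koff : forall w, Re w <> 0 -> Cmod (w - (0, eta)) < d ->
    norm (minus (minus (Res w f) v) (scal (w - (0, eta))%C l)) <= e * Cmod (w - (0, eta))).
  { intros w Hw Hwd. specialize (K w Hw Hwd).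
    assert (N := off_axis_neq w eta Hw).
    set (c := (w - (0, eta))%C) in *.
    replace (minus (minus (Res w f) v) (scal c l)) with
      (scal c (minus (scal (/ c)%C (minus (Res w f) v)) l)) by (module_by V (field; exact N)).
    rewrite norm_scal_eq, Rmult_comm. apply Rmult_le_compat_r; [apply Cmod_ge_0 | exact (Rlt_le _ _ K)]. }
  exists (Rmin d r). split; [apply Rmin_glb_lt; assumption|]. intros w Hw.
  assert (D1 := Rmin_l d r). assert (D2 := Rmin_r d r).
  destruct (Req_dec (Re w) 0) as [E1|N1].
  2: { rewrite (Poff w N1). apply Koff; [exact N1 | lra]. }
  destruct w as [x t]. simpl in E1. subst x.
  assert (Ht : J t).
  { apply HrJ. assert (T0 := im_le_Cmod ((0, t) - (0, eta))%C).
    replace (Im ((0, t) - (0, eta))%C) with (t - eta) in T0 by (simpl; ring). lra. }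
  (* The axis point [(0, t)] is approached by [(s, t)], where the off-axis estimate holds. Replacing
     one by the other costs at most [e' / B] for the value, [s * norm l] for the linear term and
     [e * s] on the right-hand side, which explains [B]. *)
  apply le_epsilon. intros e' He'.
  set (B := 1 + norm l + e). assert (HB : 0 < B) by (unfold B; generalize (norm_ge_0 l); lra).
  destruct (axis_limit_elim Res f t _ (e' / B) (Pon t Ht)) as [d1 [Hd1 L1]];
    [apply Rdiv_lt_0_compat; lra|].
  set (c0 := Cmod ((0, t) - (0, eta))) in *.
  set (s := Rmin (d1 / 2) (Rmin (e' / B) ((d - c0) / 2))).
  assert (Hs : 0 < s).
  { apply Rmin_glb_lt; [lra|]. apply Rmin_glb_lt; [apply Rdiv_lt_0_compat; lra | lra]. }
  assert (S1 : s <= d1 / 2) by apply Rmin_l.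
  assert (S2 : s <= e' / B) by (eapply Rle_trans; [apply Rmin_r | apply Rmin_l]).
  assert (S3 : s <= (d - c0) / 2) by (eapply Rle_trans; [apply Rmin_r | apply Rmin_r]).
  assert (Es : ((s, t) - (0, t))%C = RtoC s)
    by (unfold RtoC, Cminus, Cplus, Copp; simpl; f_equal; ring).
  assert (Cs : Cmod ((s, t) - (0, eta)) <= s + c0).
  { replace ((s, t) - (0, eta))%C with (RtoC s + ((0, t) - (0, eta)))%C by (rewrite <- Es; ring).
    eapply Rle_trans; [apply Cmod_triangle|]. rewrite Cmod_R, Rabs_pos_eq; unfold c0; lra. }
  assert (L2 : norm (minus (Res (s, t) f) (Phi (0, t))) < e' / B).
  { apply L1; [simpl; lra|]. rewrite Es, Cmod_R, Rabs_pos_eq; lra. }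
  assert (L3 := Koff (s, t) ltac:(simpl; lra) ltac:(lra)).
  replace (minus (minus (Phi (0, t)) v) (scal ((0, t) - (0, eta))%C l)) with
    (plus (minus (minus (minus (Res (s, t) f) v) (scal ((s, t) - (0, eta))%C l))
      (minus (Res (s, t) f) (Phi (0, t)))) (scal ((s, t) - (0, t))%C l)) by module_ring V.
  eapply Rle_trans; [apply (norm_triangle (V := V))|].
  eapply Rle_trans; [apply Rplus_le_compat_r, norm_minus_le|].
  rewrite norm_scal_eq, Es, Cmod_R, (Rabs_pos_eq s) by lra.
  replace e' with (e' / B * B) by (field; lra). unfold B at 2.
  assert (0 <= norm l) by apply norm_ge_0. nra.
Qed.

End OpenSet.

Lemma extension_axis_limit (U : C -> Prop) (Phi : C -> V) (xi : R) (f : V) :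
  open U -> U (0, xi) -> holomorphic_on U Phi ->
  (forall z, U z -> Re z <> 0 -> Phi z = Res z f) ->
  axis_limit Res f xi (Phi (0, xi)).
Proof.
  intros HU Hxi Hh Heq.
  assert (K := ex_derive_continuous (K := C_AbsRing) Phi (0, xi) (Hh _ Hxi)).
  apply filterlim_ext_loc with Phi.
  - assert (HU' := proj1 (locally_C _ _) (HU _ Hxi)).
    destruct HU' as [d Hd]. exists d. intros z Hz Hre. apply Heq; [exact (Hd z Hz) | exact Hre].
  - intros P HP. destruct (K P HP) as [d Hd]. exists d. intros z Hz _. exact (Hd z Hz).
Qed.

End AxisLimits.

(** * The equation g' = l g - f on the half-line *)

Lemma Cexp_real_mult (l : C) (r : R) : Cexp (l * RtoC r)%C =
  (exp (Re l * r) * cos (Im l * r), exp (Re l * r) * sin (Im l * r)).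
Proof.
  unfold Cexp. replace (Re (l * RtoC r)%C) with (Re l * r) by (unfold Re, Cmult, RtoC; simpl; ring).
  replace (Im (l * RtoC r)%C) with (Im l * r) by (unfold Im, Cmult, RtoC; simpl; ring). reflexivity.
Qed.

Lemma Cexp_plus (a b : C) : Cexp (a + b)%C = (Cexp a * Cexp b)%C.
Proof.
  unfold Cexp. replace (Re (a + b)%C) with (Re a + Re b) by (unfold Re, Cplus; simpl; ring).
  replace (Im (a + b)%C) with (Im a + Im b) by (unfold Im, Cplus; simpl; ring).
  rewrite exp_plus, cos_plus, sin_plus. unfold Cmult; simpl. f_equal; ring.
Qed.

Lemma Cexp_0 : Cexp 0%C = 1%C.
Proof. unfold Cexp, RtoC; simpl. rewrite exp_0, cos_0, sin_0. f_equal; ring. Qed.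

Lemma Cmod_Cexp (a : C) : Cmod (Cexp a) = exp (Re a).
Proof.
  unfold Cexp, Cmod; simpl.
  replace (_ + _) with (exp (Re a) * exp (Re a) * (Rsqr (sin (Im a)) + Rsqr (cos (Im a))))
    by (unfold Rsqr; ring).
  rewrite sin2_cos2, Rmult_1_r. apply sqrt_square, Rlt_le, exp_pos.
Qed.

Lemma Cmod_Cexp_real (l : C) (r : R) : Cmod (Cexp (l * RtoC r)%C) = exp (Re l * r).
Proof.
  rewrite Cmod_Cexp. f_equal. unfold Re, Cmult, RtoC; simpl; ring.
Qed.

Section Calculus.
Context {X : CompleteNormedModule C_AbsRing}.
Notation V := (CompleteNormedModule.NormedModule C_AbsRing X).
Notation XR := (restrict_scalars X).

Lemma is_linear_scal_Ci : is_linear (K := R_AbsRing) (U := XR) (V := XR)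
  (fun x : V => scal Ci x).
Proof.
  constructor.
  - intros x y. exact (scal_distr_l (V := V) Ci x y).
  - intros k x. change (scal Ci (scal (RtoC k) x) = scal (RtoC k) (scal Ci x)).
    module_ring V.
  - exists 1. split; [lra|]. assert (H : forall y : V, norm (scal Ci y) <= 1 * norm y); [|exact H].
    intro y. rewrite norm_scal_eq, Cmod_Ci. lra.
Qed.

Lemma scal_re_im (c : C) (v : V) :
  scal c v = plus (scal (RtoC (Re c)) v) (scal (RtoC (Im c)) (scal Ci v)).
Proof.
  replace c with (RtoC (Re c) + RtoC (Im c) * Ci)%C at 1
    by (destruct c; unfold RtoC, Ci, Cmult, Cplus; simpl; f_equal; ring).
  module_ring V.
Qed.

Lemma scal_derive (p : R -> C) (h : R -> V) (t : R) (p' : C) (h' : V) :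
  is_derive (fun s => Re (p s)) t (Re p') -> is_derive (fun s => Im (p s)) t (Im p') ->
  is_derive (V := XR) h t h' ->
  is_derive (V := XR) (fun s => scal (p s) (h s)) t (plus (scal p' (h t)) (scal (p t) h')).
Proof.
  intros H1 H2 Hh.
  assert (S0 := scal_re_im).
  apply (is_derive_ext (V := XR) (fun s => plus (scal (RtoC (Re (p s))) (h s))
    (scal (RtoC (Im (p s))) (scal Ci (h s))))); [intro s; symmetry; apply S0|].
  assert (Hi : is_derive (V := XR) (fun s => scal Ci (h s)) t (scal Ci h')).
  { unfold is_derive. eapply filterdiff_ext_lin.
    - apply (filterdiff_comp' (U := R_NormedModule) (V := XR) (W := XR) h (fun x : V => scal Ci x)).
      + exact Hh.
      + apply filterdiff_linear, is_linear_scal_Ci.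
    - intro y. change (scal Ci (scal (RtoC y) h') = scal (RtoC y) (scal Ci h')). module_ring V. }
  unfold is_derive. eapply filterdiff_ext_lin.
  - apply (filterdiff_plus_fct (K := R_AbsRing) (V := XR)).
    + exact (filterdiff_scal_fct (K := R_AbsRing) (V := XR) t _ h _ _ Rmult_comm H1 Hh).
    + exact (filterdiff_scal_fct (K := R_AbsRing) (V := XR) t _ (fun s => scal Ci (h s))
        _ _ Rmult_comm H2 Hi).
  - intro y. change (plus (plus (scal (RtoC (y * Re p')) (h t)) (scal (RtoC (Re (p t))) (scal (RtoC y) h')))
      (plus (scal (RtoC (y * Im p')) (scal Ci (h t))) (scal (RtoC (Im (p t))) (scal (RtoC y) (scal Ci h')))) =
      scal (RtoC y) (plus (scal p' (h t)) (scal (p t) h'))).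
    rewrite (S0 p'), (S0 (p t)), !RtoC_mult. module_ring V.
Qed.

Lemma Cexp_derive (l : C) (c t : R) :
  is_derive (fun s => Re (Cexp (l * RtoC (c - s))%C)) t (Re (- l * Cexp (l * RtoC (c - t)))%C) /\
  is_derive (fun s => Im (Cexp (l * RtoC (c - s))%C)) t (Im (- l * Cexp (l * RtoC (c - t)))%C).
Proof.
  rewrite Cexp_real_mult. split;
    (eapply is_derive_ext; [intro s; rewrite Cexp_real_mult; reflexivity|]);
    destruct l as [x y]; simpl; auto_derive; trivial; unfold Rminus; ring.
Qed.

Lemma exp_scal_derive (l : C) (c t : R) (h : R -> V) (h' : V) :
  is_derive (V := XR) h t h' ->
  is_derive (V := XR) (fun s => scal (Cexp (l * RtoC (c - s))%C) (h s)) t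
    (scal (Cexp (l * RtoC (c - t))%C) (minus h' (scal l (h t)))).
Proof.
  intro Hh. destruct (Cexp_derive l c t) as [H1 H2].
  assert (K := scal_derive _ h t _ h' H1 H2 Hh). cbv beta in K.
  replace (scal (Cexp (l * RtoC (c - t))%C) (minus h' (scal l (h t)))) with
    (plus (scal (- l * Cexp (l * RtoC (c - t)))%C (h t)) (scal (Cexp (l * RtoC (c - t))%C) h'))
    by module_ring V.
  exact K.
Qed.

Lemma exp_scal_continuous (l : C) (c t : R) (h : R -> V) :
  continuous (U := XR) h t ->
  continuous (U := XR) (fun s => scal (Cexp (l * RtoC (c - s))%C) (h s)) t.
Proof.
  intro Hh. destruct (Cexp_derive l c t) as [H1 H2].
  assert (C1 : continuous (fun s => Re (Cexp (l * RtoC (c - s))%C)) t)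
    by (apply (ex_derive_continuous (K := R_AbsRing) (V := R_NormedModule)); eexists; exact H1).
  assert (C2 : continuous (fun s => Im (Cexp (l * RtoC (c - s))%C)) t)
    by (apply (ex_derive_continuous (K := R_AbsRing) (V := R_NormedModule)); eexists; exact H2).
  apply (continuous_ext (U := XR) (fun s => plus (scal (RtoC (Re (Cexp (l * RtoC (c - s))%C))) (h s))
    (scal (RtoC (Im (Cexp (l * RtoC (c - s))%C))) (scal Ci (h s)))));
    [intro s; symmetry; apply scal_re_im|].
  apply (continuous_plus (V := XR)).
  - exact (continuous_scal (V := XR) _ h t C1 Hh).
  - exact (continuous_scal (V := XR) _ (fun s => scal Ci (h s)) t C2 (continuous_scal_C Ci h t Hh)).
Qed.

(* [g] is constant on the left of 0, where its one-sided derivative would jump; the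
   linear continuation is differentiable on the whole line, with derivative [g']. *)
Definition linear_extension (g g' : BC X) (t : R) : V :=
  plus (g t) (scal (RtoC (Rmin t 0)) (g' 0)).

Lemma is_derive_intro (h : R -> V) (t : R) (l : V) :
  (forall e, 0 < e -> exists d, 0 < d /\ forall s, Rabs (s - t) < d ->
    norm (minus (minus (h s) (h t)) (scal (RtoC (s - t)) l)) <= e * Rabs (s - t)) ->
  is_derive (V := XR) h t l.
Proof.
  intro H. split; [apply (is_linear_scal_l (V := XR) l)|].
  intros t' Ht'. apply (is_filter_lim_locally_unique (V := R_NormedModule)) in Ht'. subst t'.
  intro e. destruct (H e (cond_pos e)) as [d [Hd K]].
  exists (mkposreal d Hd). exact K.
Qed.

Lemma linear_extension_derive (g g' : BC X) (t : R) : derivative_on_Rplus g g' ->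
  is_derive (V := XR) (linear_extension g g') t (g' t).
Proof.
  intro H. apply is_derive_intro. intros e He. unfold linear_extension.
  destruct (Rlt_le_dec t 0) as [Ht|Ht].
  - exists (- t). split; [lra|]. intros s Hs. apply Rabs_def2 in Hs.
    rewrite (bc_const X g s), (bc_const X g t), (bc_const X g' t) by lra.
    rewrite !Rmin_left by lra.
    replace (minus _ _) with (zero : V)
      by (rewrite RtoC_minus; module_ring V).
    rewrite (norm_zero (V := V)). apply Rmult_le_pos; [lra | apply Rabs_pos].
  - destruct (H t Ht) as [_ K].
    specialize (K t).
    lapply K; clear K.
    2: { intros P HP. apply (filter_le_within (F := locally t)). exact HP. }
    intro K. destruct (K (mkposreal e He)) as [d Hd].
    (* For [t > 0] the radius stays below [t], so negative [s] occur only at [t = 0], where [g] is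
       constant and the linear term gives the remainder 0 exactly. *)
    exists (if Rlt_dec 0 t then Rmin d t else d). split.
    { assert (P := cond_pos d). destruct (Rlt_dec 0 t); [apply Rmin_glb_lt; lra | lra]. }
    intros s Hs.
    assert (Hsd : Rabs (s - t) < d).
    { destruct (Rlt_dec 0 t); [eapply Rlt_le_trans; [exact Hs | apply Rmin_l] | exact Hs]. }
    rewrite (Rmin_right t) by lra.
    destruct (Rle_lt_dec 0 s) as [Hs0|Hs0].
    + rewrite Rmin_right by lra.
      assert (Eq : minus (minus (plus (g s) (scal (RtoC 0) (g' 0)))
          (plus (g t) (scal (RtoC 0) (g' 0)))) (scal (RtoC (s - t)) (g' t)) =
        minus (minus (g s) (g t)) (scal (RtoC (s - t)) (g' t)) :> V) by module_ring V.
      refine (Rle_trans _ _ _ (Req_le _ _ (f_equal norm Eq)) _).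
      exact (Hd s Hsd Hs0).
    + assert (t = 0).
      { destruct (Rlt_dec 0 t) as [Ht0|]; [|lra].
        assert (Rabs (s - t) < t) by (eapply Rlt_le_trans; [exact Hs | apply Rmin_r]).
        apply Rabs_def2 in H0. lra. }
      subst t. rewrite (bc_const X g s) by lra. rewrite Rmin_left by lra.
      replace (minus _ _) with (zero : V) by (rewrite Rminus_0_r; module_ring V).
      rewrite (norm_zero (V := V)). apply Rmult_le_pos; [lra | apply Rabs_pos].
Qed.

Lemma derivative_on_Rplus_intro (g g' : BC X) (h : R -> V) :
  (forall t, 0 <= t -> h t = g t) ->
  (forall t, 0 <= t -> is_derive (V := XR) h t (g' t)) -> derivative_on_Rplus g g'.
Proof.
  intros Hg Hd t Ht. destruct (Hd t Ht) as [L K].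
  split; [exact L|]. intros x Hx.
  (* The differential quantifies over all limits of the filter restricted to the half-line; [t] is
     the only one. *)
  assert (Ex : x = t).
  { apply NNPP. intro N.
    assert (P : 0 < Rabs (x - t) / 2) by (generalize (Rabs_pos_lt (x - t)); lra).
    destruct (Hx (fun y => Rabs (y - x) < Rabs (x - t) / 2)) as [d Hd'].
    { exists (mkposreal _ P). intros y Hy. exact Hy. }
    assert (Ht' := Hd' t (ball_center t d) Ht). rewrite Rabs_minus_sym in Ht'. lra. }
  subst x. intro e.
  destruct (K t (fun P HP => HP) e) as [d Hd']. exists d. intros y Hy Hy0.
  specialize (Hd' y Hy). rewrite (Hg y Hy0), (Hg t Ht) in Hd'. exact Hd'.
Qed.

End Calculus.

(** * Solving the equation by variation of constants *)

Section Primitives.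
Context {X : CompleteNormedModule C_AbsRing}.
Notation V := (CompleteNormedModule.NormedModule C_AbsRing X).
Notation XR := (restrict_scalars X).

Lemma BC_of_Rplus (G : R -> V) (M : R) :
  (forall t, 0 <= t -> continuous (U := XR) G t) -> (forall t, 0 <= t -> norm (G t) <= M) ->
  exists f : BC X, forall t, f t = G (Rmax 0 t).
Proof.
  intros HG HM.
  assert (H1 : forall t, t <= 0 -> G (Rmax 0 t) = G (Rmax 0 0)).
  { intros t Ht. rewrite !Rmax_left; lra || reflexivity. }
  assert (H2 : forall t, continuous (U := X) (fun t => G (Rmax 0 t)) t).
  { intro t. apply (continuous_comp (Rmax 0) (G : R -> XR) t).
    - intros P [d Hd]. exists d. intros s Hs. apply Hd.
      change (Rabs (s - t) < d) in Hs. change (Rabs (Rmax 0 s - Rmax 0 t) < d).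
      eapply Rle_lt_trans; [|exact Hs].
      unfold Rmax, Rabs. destruct (Rle_dec 0 s), (Rle_dec 0 t);
        repeat destruct (Rcase_abs _); lra.
    - apply HG. apply Rmax_l. }
  assert (H3 : exists K, forall t, norm (G (Rmax 0 t)) <= K).
  { exists M. intro t. apply HM, Rmax_l. }
  exists (mkBC (fun t => G (Rmax 0 t)) H1 H2 H3). intro t. reflexivity.
Qed.

Lemma BC_ext_Rplus (f g : BC X) : (forall t, 0 <= t -> f t = g t) -> f = g.
Proof.
  intro H. apply BC_ext. intro t. destruct (Rle_lt_dec 0 t) as [Ht|Ht]; [apply H, Ht|].
  rewrite (bc_const X f t), (bc_const X g t) by lra. apply H. lra.
Qed.

Lemma exp_decay (mu M e : R) : 0 < mu -> 0 < e -> 0 <= M ->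
  exists T, 0 < T /\ forall t, T < t -> exp (- mu * t) * M < e.
Proof.
  intros Hmu He HM. exists ((M + 1) / (e * mu)). split.
  { apply Rdiv_lt_0_compat; nra. }
  intros t Ht.
  assert (Pt : (M + 1) < t * (e * mu)).
  { apply Rmult_lt_compat_r with (r := e * mu) in Ht; [|nra].
    replace ((M + 1) / (e * mu) * (e * mu)) with (M + 1) in Ht by (field; lra). exact Ht. }
  replace (- mu * t) with (- (mu * t)) by ring. rewrite exp_Ropp.
  assert (K := exp_ineq1_le (mu * t)). assert (K' := exp_pos (mu * t)).
  apply Rmult_lt_reg_l with (exp (mu * t)); [exact K'|].
  rewrite <- Rmult_assoc, Rinv_r, Rmult_1_l by lra. nra.
Qed.

(** The integrand is minus the derivative of [exp (l (c - s)) g(s)], so this is the fundamental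
    theorem of calculus. *)
Lemma exp_integral (g g' : BC X) (l : C) (c a b : R) : derivative_on_Rplus g g' ->
  0 <= a <= b ->
  is_RInt (V := XR) (fun s => scal (Cexp (l * RtoC (c - s))%C) (minus (scal l (g s)) (g' s) : V)) a b
    (minus (scal (Cexp (l * RtoC (c - a))%C) (g a)) (scal (Cexp (l * RtoC (c - b))%C) (g b)) : V).
Proof.
  intros Hg Hab.
  assert (Hlin : forall s, 0 <= s -> linear_extension g g' s = g s).
  { intros s Hs. unfold linear_extension. rewrite Rmin_right by exact Hs. module_ring V. }
  assert (Hcont : forall s, continuous (U := XR) (linear_extension g g') s).
  { intro s. eapply derive_continuous, linear_extension_derive, Hg. }
  assert (K := is_RInt_opp (V := XR) _ _ _ _ (is_RInt_derive (V := XR)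
    (fun s => scal (Cexp (l * RtoC (c - s))%C) (linear_extension g g' s))
    (fun s => scal (Cexp (l * RtoC (c - s))%C) (minus (g' s) (scal l (linear_extension g g' s)) : V)) a b
    (fun s _ => exp_scal_derive l c s _ _ (linear_extension_derive g g' s Hg))
    (fun s _ => exp_scal_continuous l c s _
      (continuous_minus (V := XR) _ (fun s => scal l (linear_extension g g' s)) s (bc_cont X g' s)
        (continuous_scal_C l _ s (Hcont s)))))).
  cbv beta in K. rewrite (Hlin a), (Hlin b) in K by lra.
  match type of K with is_RInt _ _ _ ?v =>
    assert (Eq : minus (scal (Cexp (l * RtoC (c - a))%C) (g a)) (scal (Cexp (l * RtoC (c - b))%C) (g b)) = v :> V)
  end.
  { change (minus (scal (Cexp (l * RtoC (c - a))%C) (g a)) (scal (Cexp (l * RtoC (c - b))%C) (g b)) =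
      opp (minus (scal (Cexp (l * RtoC (c - b))%C) (g b)) (scal (Cexp (l * RtoC (c - a))%C) (g a))) :> V).
    module_ring V. }
  rewrite Eq. eapply (is_RInt_ext (V := XR)); [|exact K].
  rewrite Rmin_left, Rmax_right by lra. intros s Hs. cbv beta.
  rewrite Hlin by lra.
  change (opp (scal (Cexp (l * RtoC (c - s))%C) (minus (g' s) (scal l (g s)))) =
    scal (Cexp (l * RtoC (c - s))%C) (minus (scal l (g s)) (g' s)) :> V).
  module_ring V.
Qed.

(** Solutions of the homogeneous equation for [Re eta < 0]; they lie in every space with Condition
    F+. *)
Lemma C0_exp (eta : C) (x : V) : Re eta < 0 -> exists e : BC X,
  filterlim e (Rbar_locally p_infty) (locally (zero : X)) /\
  forall t, 0 <= t -> e t = scal (Cexp (eta * RtoC t)%C) x.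
Proof.
  intro Heta.
  assert (Hn : forall t, norm (scal (Cexp (eta * RtoC t)%C) x) = exp (- - Re eta * t) * norm x).
  { intro t. rewrite norm_scal_eq, Cmod_Cexp_real. do 2 f_equal. ring. }
  destruct (BC_of_Rplus (fun t => scal (Cexp (eta * RtoC t)%C) x) (norm x)) as [e He].
  - intros t Ht.
    apply (continuous_ext (U := XR) (fun t => scal (Cexp (- eta * RtoC (0 - t))%C) x)).
    { intro s. do 2 f_equal. rewrite RtoC_minus. ring. }
    apply exp_scal_continuous. apply (continuous_const (V := XR) x).
  - intros t Ht. rewrite Hn. rewrite <- (Rmult_1_l (norm x)) at 2.
    apply Rmult_le_compat_r; [apply norm_ge_0|]. rewrite <- exp_0.
    destruct (Req_dec (- - Re eta * t) 0) as [->|N]; [lra|].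
    apply Rlt_le, exp_increasing. nra.
  - exists e. split.
    + apply (filterlim_norm_intro (V := V)). intros d Hd.
      destruct (exp_decay (- Re eta) (norm x) d) as [T [HT K]]; [lra | exact Hd | apply norm_ge_0|].
      exists T. intros t Ht.
      assert (Eq : minus (e t) zero = scal (Cexp (eta * RtoC t)%C) x :> V).
      { rewrite He, Rmax_right by lra. module_ring V. }
      refine (Rle_lt_trans _ _ _ (Req_le _ _ (f_equal norm Eq)) _).
      rewrite Hn. apply K, Ht.
    + intros t Ht. rewrite He, Rmax_right by lra. reflexivity.
Qed.

Lemma sup_norm_ge_0 (f : BC X) : 0 <= sup_norm X f.
Proof. eapply Rle_trans; [apply (norm_ge_0 (V := V) (f 0)) | apply sup_norm_ub]. Qed.

(** With [q = l g - g']: if [Re l > 0], boundedness forces [g] to be the integral of [q] over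
    [[t, oo)]; if [Re l < 0], [g] is [exp (l t) g(0)], a function in C_0, minus the integral over
    [[0, t]]. Condition F+ covers both. This yields uniqueness modulo [F]. *)
Lemma solution_in_F (F : BC X -> Prop) (HF : condition_Fplus F) (g g' q : BC X) (l : C) :
  Re l <> 0 -> derivative_on_Rplus g g' ->
  (forall t, q t = minus (scal l (g t)) (g' t) :> V) -> F q -> F g.
Proof.
  intros Hl Hg Hq Fq.
  assert (HI : forall c a b, 0 <= a <= b ->
    is_RInt (V := XR) (fun s => scal (Cexp (l * RtoC (c - s))%C) (q s)) a b
    (minus (scal (Cexp (l * RtoC (c - a))%C) (g a)) (scal (Cexp (l * RtoC (c - b))%C) (g b)) : V)).
  { intros c a b Hab. eapply (is_RInt_ext (V := XR)); [|exact (exp_integral g g' l c a b Hg Hab)].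
    intros s _. cbv beta. rewrite Hq. reflexivity. }
  assert (Eself : forall t, Cexp (l * RtoC (t - t))%C = 1%C).
  { intro t. rewrite Rminus_diag, Cmult_0_r. apply Cexp_0. }
  destruct (Rtotal_order (Re l) 0) as [Hneg|[H0|Hpos]]; [|contradiction|].
  - destruct (Fplus_int_zero F HF q l Fq Hneg) as [z [Fz Hz]].
    destruct (C0_exp l (g 0) Hneg) as [e [He1 He2]].
    assert (Fe := Fplus_C0 F HF e He1).
    assert (E0 : g = minus e z).
    { apply BC_ext_Rplus. intros t Ht.
      change ((g t : V) = plus (e t : V) (scal (- (1))%C (z t : V))).
      rewrite He2, Hz by exact Ht.
      rewrite (is_RInt_unique (V := XR) _ _ _ _ (HI t 0 t (conj (Rle_refl 0) Ht))).
      rewrite Eself, Rminus_0_r.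
      change (g t = plus (scal (Cexp (l * RtoC t)%C) (g 0))
        (scal (- (1))%C (minus (scal (Cexp (l * RtoC t)%C) (g 0)) (scal (RtoC 1) (g t)))) :> V).
      module_ring V. }
    rewrite E0. apply (subspace_plus F (Fplus_subspace F HF)); [exact Fe|].
    apply (subspace_opp _ _ F (Fplus_subspace F HF)). exact Fz.
  - destruct (Fplus_int_infty F HF q l Fq Hpos) as [z [Fz Hz]].
    replace g with z; [exact Fz|]. apply BC_ext_Rplus. intros t Ht. rewrite Hz by exact Ht.
    apply (is_RInt_gen_unique (V := XR)). intros P HP.
    apply (locally_norm_le_locally (V := V)) in HP. destruct HP as [d Hd].
    destruct (exp_decay (Re l) (sup_norm X g) d Hpos (cond_pos d) (sup_norm_ge_0 g)) as [T [HT K]].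
    apply Filter_prod with (fun a => a = t) (fun b => t + T < b); [reflexivity | exists (t + T); tauto |].
    intros a b -> Hb. eexists. split; [apply HI; simpl; lra|].
    apply Hd. unfold ball_norm. cbn [fst snd]. rewrite Eself.
    match goal with |- norm ?v < _ =>
      replace v with (scal (- Cexp (l * RtoC (t - b)))%C (g b) : V) by module_ring V end.
    refine (Rle_lt_trans _ _ _ (Req_le _ _ (norm_scal_eq (V := V) _ _)) _).
    rewrite Cmod_opp, Cmod_Cexp_real.
    eapply Rle_lt_trans; [apply Rmult_le_compat_l; [apply Rlt_le, exp_pos | apply (sup_norm_ub X g)]|].
    replace (Re l * (t - b)) with (- Re l * (b - t)) by ring. apply K. lra.
Qed.

(** Both signs of [Re l] are treated by one formula, [exp (l t) (L - J t)], with [J t] the integral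
    of [exp (- l s) f(s)] over [[0, t]]; only the constant [L] depends on the sign. *)
Lemma resolvent_solution (f : BC X) (l : C) : Re l <> 0 -> exists g g' : BC X,
  derivative_on_Rplus g g' /\ (forall t, g' t = minus (scal l (g t)) (f t) :> V) /\
  forall t, norm (g t : V) <= sup_norm X f / Rabs (Re l).
Proof.
  intro Hl. set (mu := Re l) in *. set (M := sup_norm X f).
  assert (HM : 0 <= M) by apply sup_norm_ge_0.
  set (k := fun s => scal (Cexp (l * RtoC (0 - s))%C) (f s) : V).
  assert (Hk : forall s, continuous (U := XR) k s).
  { intro s. apply exp_scal_continuous, bc_cont. }
  assert (Ek : forall a b, ex_RInt (V := XR) k a b).
  { intros a b. apply (ex_RInt_continuous (V := XR)). intros s _. apply Hk. }
  set (J := fun t => RInt (V := XR) k 0 t : V).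
  assert (HJ : forall a b, a <= b ->
    norm (minus (J b) (J a)) <= M * ((exp (- mu * a) - exp (- mu * b)) / mu)).
  { intros a b Hab.
    apply (norm_RInt_le (V := XR) k (fun s => M * exp (- mu * s)) a b); [exact Hab| | |].
    - intros s _. change (norm (k s) <= M * exp (- mu * s)). unfold k.
      refine (Rle_trans _ _ _ (Req_le _ _ (norm_scal_eq (V := V) _ _)) _).
      rewrite Cmod_Cexp_real. fold mu.
      replace (mu * (0 - s)) with (- mu * s) by ring. rewrite Rmult_comm.
      apply Rmult_le_compat_r; [apply Rlt_le, exp_pos | apply (sup_norm_ub X f)].
    - assert (C0 := RInt_Chasles (V := XR) k 0 a b (Ek 0 a) (Ek a b)).
      assert (Eq : minus (J b) (J a) = RInt (V := XR) k a b :> V).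
      { unfold J. rewrite <- C0.
        change (minus (plus (J a) (RInt (V := XR) k a b : V)) (J a) = RInt (V := XR) k a b :> V).
        set (v := RInt (V := XR) k a b : V). module_ring V. }
      rewrite Eq. apply (RInt_correct (V := XR)), Ek.
    - replace (M * ((exp (- mu * a) - exp (- mu * b)) / mu)) with
        (minus (- M / mu * exp (- mu * b)) (- M / mu * exp (- mu * a)))
        by (unfold minus, plus, opp; simpl; field; exact Hl).
      apply (is_RInt_derive (V := R_CompleteNormedModule) (fun s => - M / mu * exp (- mu * s))).
      + intros s _. auto_derive; [trivial | field; exact Hl].
      + intros s _. apply (ex_derive_continuous (K := R_AbsRing) (V := R_NormedModule)).
        auto_derive. trivial. }
  (* [L] is 0 for negative [mu] and the limit of [J] at infinity for positive [mu]; in each case the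
     decay cancels the growth of [exp (l t)]. *)
  assert (HL : exists L : V, forall t, 0 <= t -> norm (minus L (J t)) <= M * (exp (- mu * t) / Rabs mu)).
  { destruct (Rlt_le_dec mu 0) as [Hneg|Hpos].
    - exists zero. intros t Ht. rewrite norm_minus_sym.
      replace (zero : V) with (J 0) by exact (RInt_point (V := XR) 0 k).
      eapply Rle_trans; [apply HJ, Ht|]. apply Rmult_le_compat_l; [exact HM|].
      rewrite Rabs_left by exact Hneg. rewrite Rmult_0_r, exp_0.
      replace ((1 - exp (- mu * t)) / mu) with ((exp (- mu * t) - 1) / (- mu)) by (field; lra).
      apply Rmult_le_compat_r; [apply Rlt_le, Rinv_0_lt_compat; lra | lra].
    - assert (Hp : 0 < mu) by lra. rewrite Rabs_pos_eq by lra.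
      assert (HJ' : forall a b, a <= b -> norm (minus (J b) (J a)) <= M * (exp (- mu * a) / mu)).
      { intros a b Hab. eapply Rle_trans; [apply HJ, Hab|]. apply Rmult_le_compat_l; [exact HM|].
        apply Rmult_le_compat_r; [apply Rlt_le, Rinv_0_lt_compat; lra|].
        generalize (exp_pos (- mu * b)). lra. }
      assert (HC : exists L : X, filterlim J (Rbar_locally p_infty) (locally L)).
      { apply (filterlim_locally_cauchy (U := X) (F := Rbar_locally p_infty)). intro e.
        assert (HMm : 0 <= M / mu) by (apply Rmult_le_pos; [exact HM | apply Rlt_le, Rinv_0_lt_compat; lra]).
        destruct (exp_decay mu (M / mu) e Hp (cond_pos e) HMm) as [T [HT K]].
        exists (fun t => T < t). split; [exists T; tauto|].
        assert (S0 : forall u v, T < u -> u <= v -> norm (minus (J v) (J u)) < e).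
        { intros u v Hu Huv. eapply Rle_lt_trans; [apply HJ', Huv|].
          replace (M * (exp (- mu * u) / mu)) with (exp (- mu * u) * (M / mu)) by (field; lra).
          apply K, Hu. }
        intros u v Hu Hv. apply (norm_compat1 (V := V)).
        destruct (Rle_lt_dec u v); [apply S0; assumption|].
        rewrite (norm_minus_sym (V := V)). apply S0; lra. }
      destruct HC as [L HL]. exists L. intros t Ht. apply le_epsilon. intros e He.
      destruct (filterlim_norm_elim (V := V) J L HL e He) as [T K].
      assert (K1 := K (Rmax t T + 1)). lapply K1; [clear K1; intro K1 | generalize (Rmax_r t T); lra].
      assert (K2 := HJ' t (Rmax t T + 1)). lapply K2; [clear K2; intro K2 | generalize (Rmax_l t T); lra].
      assert (T0 := norm_minus_trans (J (Rmax t T + 1)) L (J t) : _ <= _).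
      rewrite (norm_minus_sym L (J (Rmax t T + 1))) in T0. lra. }
  destruct HL as [L HL].
  set (G := fun t => scal (Cexp (- l * RtoC (0 - t))%C) (minus L (J t)) : V).
  assert (Einv : forall r, (Cexp (- l * RtoC r) * Cexp (l * RtoC r))%C = 1%C).
  { intro r. rewrite <- Cexp_plus. replace (- l * RtoC r + l * RtoC r)%C with (RtoC 0) by ring.
    apply Cexp_0. }
  assert (DG : forall t, is_derive (V := XR) G t (minus (scal l (G t)) (f t) : V)).
  { intro t.
    pose (k' := opp (k t) : V).
    assert (DJ : is_derive (V := XR) (fun s => minus L (J s) : V) t k').
    { assert (D0 : is_derive (V := XR) J t (k t)).
      { apply (is_derive_RInt (V := XR) k J 0 t).
        - exists (mkposreal 1 Rlt_0_1). intros b _. apply (RInt_correct (V := XR)), Ek.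
        - apply Hk. }
      assert (D1 := is_derive_minus (V := XR) _ _ t _ _ (is_derive_const (V := XR) L t) D0).
      assert (Ek' : k' = minus zero (k t) :> V) by (unfold k'; module_ring V).
      rewrite Ek'. exact D1. }
    assert (D2 := exp_scal_derive (- l) 0 t _ _ DJ).
    replace (minus (scal l (G t)) (f t) : V) with
      (scal (Cexp (- l * RtoC (0 - t))%C) (minus k' (scal (- l)%C (minus L (J t)))) : V);
      [exact D2|].
    unfold G, k', k.
    replace (f t : V) with (scal (Cexp (- l * RtoC (0 - t)) * Cexp (l * RtoC (0 - t)))%C (f t : V)) at 2
      by (rewrite Einv; module_ring V).
    set (c1 := Cexp (- l * RtoC (0 - t))%C). set (c2 := Cexp (l * RtoC (0 - t))%C).
    set (v := f t : V). module_ring V. }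
  assert (BG : forall t, 0 <= t -> norm (G t) <= M / Rabs mu).
  { intros t Ht. unfold G. rewrite norm_scal_eq, Cmod_Cexp_real.
    replace (Re (- l)%C * (0 - t)) with (mu * t) by (unfold mu, Re, Copp; simpl; ring).
    eapply Rle_trans; [apply Rmult_le_compat_l; [apply Rlt_le, exp_pos | apply HL, Ht]|].
    replace (exp (mu * t) * (M * (exp (- mu * t) / Rabs mu))) with
      (exp (mu * t) * exp (- mu * t) * (M / Rabs mu)) by (field; apply Rabs_no_R0, Hl).
    rewrite <- exp_plus. replace (mu * t + - mu * t) with 0 by ring. rewrite exp_0. lra. }
  destruct (BC_of_Rplus G (M / Rabs mu)) as [g Hg].
  { intros t _. eapply derive_continuous, DG. }
  { exact BG. }
  exists g, (minus (scal l g) f).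
  assert (Hg' : forall t, (minus (scal l g) f : BC X) t = minus (scal l (g t)) (f t) :> V).
  { intro t. change (plus (scal l (g t)) (scal (- (1))%C (f t)) = minus (scal l (g t)) (f t) :> V).
    module_ring V. }
  split; [|split; [exact Hg'|]].
  - apply (derivative_on_Rplus_intro _ _ G).
    + intros t Ht. rewrite Hg, Rmax_right by exact Ht. reflexivity.
    + intros t Ht. rewrite Hg', Hg, Rmax_right by exact Ht. apply DG.
  - intro t. rewrite Hg. apply BG, Rmax_l.
Qed.

End Primitives.

(** * Completeness of BC/F and the resolvent of the derivation *)

(* Completeness in the form that passes most easily to quotients. *)
Definition geometrically_complete (V : NormedModule C_AbsRing) : Prop :=
  forall (K : R) (P : nat -> V), 0 < K ->
    (forall n, norm (minus (P (S n)) (P n)) <= K * (1 / 2) ^ n) ->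
    exists s, forall e, 0 < e -> exists N, forall n, (N <= n)%nat -> norm (minus s (P n)) < e.

Lemma geometric_small (K e : R) : 0 < K -> 0 < e ->
  exists N, forall n, (N <= n)%nat -> K * (1 / 2) ^ n < e.
Proof.
  intros HK He.
  destruct (pow_lt_1_zero (1 / 2)) with (y := e / K) as [N HN].
  - rewrite Rabs_pos_eq; lra.
  - apply Rdiv_lt_0_compat; lra.
  - exists N. intros n Hn. specialize (HN n Hn).
    rewrite Rabs_pos_eq in HN by (apply pow_le; lra).
    apply Rmult_lt_compat_l with (r := K) in HN; [|exact HK].
    replace (K * (e / K)) with e in HN by (field; lra). exact HN.
Qed.

Lemma geometric_cauchy (V : NormedModule C_AbsRing) (K : R) (P : nat -> V) : 0 < K ->
  (forall n, norm (minus (P (S n)) (P n)) <= K * (1 / 2) ^ n) ->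
  forall n m, (n <= m)%nat -> norm (minus (P m) (P n)) <= 2 * K * (1 / 2) ^ n.
Proof.
  intros HK H n m Hnm.
  assert (B : norm (minus (P m) (P n)) <= 2 * K * ((1 / 2) ^ n - (1 / 2) ^ m)).
  { induction Hnm as [|m Hnm IH].
    - rewrite norm_minus_self. lra.
    - eapply Rle_trans; [apply (norm_minus_trans (P m))|].
      specialize (H m). simpl. lra. }
  assert (0 < (1 / 2) ^ m) by (apply pow_lt; lra). nra.
Qed.

Lemma BC_complete (X : CompleteNormedModule C_AbsRing) :
  geometrically_complete (BC_NormedModule X).
Proof.
  set (V := CompleteNormedModule.NormedModule C_AbsRing X).
  intros K P HK H.
  assert (HC : forall t n m, (n <= m)%nat ->
    norm (minus (P m t : V) (P n t)) <= 2 * K * (1 / 2) ^ n).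
  { intros t n m Hnm.
    eapply Rle_trans; [|exact (geometric_cauchy _ K P HK H n m Hnm)].
    eapply Rle_trans; [|exact (sup_norm_ub X (minus (P m) (P n)) t)].
    apply Req_le, (f_equal (norm (V := V))).
    change (minus (P m t : V) (P n t) = plus (P m t : V) (scal (- (1))%C (P n t : V))).
    module_ring V. }
  assert (HL : forall t, exists v : X, filterlim (fun n => P n t) eventually (locally v)).
  { intro t. apply (filterlim_locally_cauchy (U := X) (F := eventually)). intro e.
    destruct (geometric_small (2 * K) e) as [N HN]; [lra | apply cond_pos|].
    exists (fun n => (N <= n)%nat). split; [exists N; tauto|].
    assert (S0 : forall u v, (N <= u)%nat -> (u <= v)%nat -> norm (minus (P v t : V) (P u t)) < e).
    { intros u v Hu Huv. eapply Rle_lt_trans; [apply HC, Huv | apply HN, Hu]. }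
    intros u v Hu Hv. apply (norm_compat1 (V := V)).
    destruct (Nat.le_ge_cases u v); [apply S0; assumption|].
    rewrite (norm_minus_sym (V := V)). apply S0; assumption. }
  set (L := fun t => epsilon (inhabits (zero : X))
    (fun v => filterlim (fun n => P n t) eventually (locally v))).
  assert (HL' : forall t, filterlim (fun n => P n t) eventually (locally (L t))).
  { intro t. apply epsilon_spec. apply HL. }
  assert (HB : forall t n, norm (minus (L t : V) (P n t)) <= 2 * K * (1 / 2) ^ n).
  { intros t n. apply le_epsilon. intros e He.
    destruct (filterlim_norm_elim (V := V) _ _ (HL' t) e He) as [N HN].
    assert (A1 := HN (max n N) (Nat.le_max_r _ _)).
    assert (A2 := HC t n (max n N) (Nat.le_max_l _ _)).
    assert (T0 := norm_minus_trans (P (max n N) t : V) (L t) (P n t)).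
    rewrite (norm_minus_sym (L t : V) (P (max n N) t)) in T0. lra. }
  assert (L1 : forall t, t <= 0 -> L t = L 0).
  { intros t Ht. unfold L.
    replace (fun n => P n t) with (fun n => P n 0); [reflexivity|].
    apply functional_extensionality. intro n. symmetry. exact (bc_const X (P n) t Ht). }
  assert (L2 : forall t, continuous L t).
  { intro t. apply (filterlim_norm_intro (V := V)). intros e He.
    destruct (geometric_small (2 * K) (e / 3)) as [N HN]; [lra | lra|].
    specialize (HN N (Nat.le_refl N)).
    assert (Hc := filterlim_norm_elim (V := V) (P N) _ (bc_cont X (P N) t) (e / 3)).
    lapply Hc; [clear Hc; intro Hc | lra].
    revert Hc. apply filter_imp. intros s Hs.
    change (norm (minus (P N s : V) (P N t)) < e / 3) in Hs.
    change (norm (minus (L s : V) (L t)) < e).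
    assert (T1 := norm_minus_trans (P N s : V) (L s) (L t)).
    assert (T2 := norm_minus_trans (P N t : V) (P N s) (L t)).
    rewrite (norm_minus_sym (P N t : V) (L t)) in T2.
    assert (B1 := HB s N). assert (B2 := HB t N). lra. }
  assert (L3 : exists M, forall t, norm (L t : V) <= M).
  { exists (2 * K * (1 / 2) ^ 0 + sup_norm X (P 0%nat)). intro t.
    assert (B := HB t 0%nat). assert (T0 := norm_le_minus (L t : V) (P 0%nat t)).
    assert (T1 : norm (P 0%nat t : V) <= sup_norm X (P 0%nat)) by exact (sup_norm_ub X (P 0%nat) t).
    lra. }
  exists (mkBC L L1 L2 L3). intros e He.
  destruct (geometric_small (2 * K) e) as [N HN]; [lra | exact He|].
  exists N. intros n Hn. eapply Rle_lt_trans; [|apply HN, Hn].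
  apply sup_norm_le. intro t. eapply Rle_trans; [|exact (HB t n)].
  apply Req_le, (f_equal (norm (V := V))).
  change (plus (L t : V) (scal (- (1))%C (P n t : V)) = minus (L t : V) (P n t)).
  module_ring V.
Qed.

(** The successive differences are lifted to [V] and summed from a representative of [P 0]. The
    quotient norm is an infimum, so lifts are taken with twice the bound. *)
Lemma quotient_complete (V : NormedModule C_AbsRing) (W : V -> Prop) (HW : closed_subspace W) :
  geometrically_complete V -> geometrically_complete (quotient HW).
Proof.
  intros HV K P HK H. set (Q := quotient HW) in *.
  assert (Hv : forall n, exists v : V, coset_of C_AbsRing V W v = minus (P (S n)) (P n) :> Q /\
    norm v <= 2 * K * (1 / 2) ^ n).
  { intro n. assert (Pn : 0 < K * (1 / 2) ^ n) by (apply Rmult_lt_0_compat; [lra | apply pow_lt; lra]).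
    destruct (quot_norm_approx C_AbsRing V W HW (minus (P (S n)) (P n) : Q) _ Pn) as [v [E1 E2]].
    exists v. split; [exact E1|]. specialize (H n).
    change (quot_norm C_AbsRing V W (minus (P (S n)) (P n) : Q) <= K * (1 / 2) ^ n) in H. lra. }
  set (v := fun n => proj1_sig (constructive_indefinite_description _ (Hv n))).
  assert (Hv' : forall n, coset_of C_AbsRing V W (v n) = minus (P (S n)) (P n) :> Q /\
    norm (v n) <= 2 * K * (1 / 2) ^ n).
  { intro n. exact (proj2_sig (constructive_indefinite_description _ (Hv n))). }
  set (T := fix T n := match n with O => repr C_AbsRing V W (P 0%nat) | S m => plus (T m) (v m) end).
  assert (HT : forall n, coset_of C_AbsRing V W (T n) = P n).
  { induction n as [|n IH]; [apply class_repr; exact HW|].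
    change (coset_of C_AbsRing V W (plus (T n) (v n)) = P (S n)).
    rewrite <- (class_plus C_AbsRing V W HW), IH, (proj1 (Hv' n)).
    change (plus (P n) (minus (P (S n)) (P n)) = P (S n) :> Q). module_ring Q. }
  destruct (HV (2 * K) T) as [s Hs]; [lra | |].
  { intro n. replace (minus (T (S n)) (T n)) with (v n) by (simpl; module_ring V). apply Hv'. }
  exists (coset_of C_AbsRing V W s). intros e He. destruct (Hs e He) as [N HN].
  exists N. intros n Hn. eapply Rle_lt_trans; [|apply (HN n Hn)].
  rewrite <- (HT n).
  replace (minus (coset_of C_AbsRing V W s : Q) (coset_of C_AbsRing V W (T n)))
    with (coset_of C_AbsRing V W (minus s (T n)) : Q); [apply quot_norm_le; exact HW|].
  symmetry. change (quot_plus C_AbsRing V W (coset_of C_AbsRing V W s)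
    (quot_opp C_AbsRing V W (coset_of C_AbsRing V W (T n))) = coset_of C_AbsRing V W (minus s (T n))).
  rewrite (class_opp C_AbsRing V W HW), (class_plus C_AbsRing V W HW). reflexivity.
Qed.

Section CompleteOfGeometric.
Context {V : NormedModule C_AbsRing} (HV : geometrically_complete V).

Definition filter_limit (F : (V -> Prop) -> Prop) : V :=
  epsilon (inhabits (zero : V)) (fun x : V => forall eps : posreal, F (ball x eps)).

(** Centres of balls of radius [(1 / 2)^n] belonging to the filter form a geometric sequence, since
    two such balls always meet. *)
Lemma filter_limit_correct (F : (V -> Prop) -> Prop) :
  ProperFilter F -> cauchy F -> forall eps : posreal, F (ball (filter_limit F) eps).
Proof.
  intros FF HF. unfold filter_limit. apply epsilon_spec.
  assert (Hp : forall n, 0 < (1 / 2) ^ n) by (intro n; apply pow_lt; lra).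
  set (P := fun n => proj1_sig (constructive_indefinite_description _ (HF (mkposreal _ (Hp n))))).
  assert (HP : forall n, F (ball (P n) (mkposreal _ (Hp n)))).
  { intro n. exact (proj2_sig (constructive_indefinite_description _ (HF (mkposreal _ (Hp n))))). }
  assert (Hc := norm_factor_gt_0 (V := V)). set (c := norm_factor (V := V)) in *.
  destruct (HV (2 * c) P) as [s Hs]; [lra | |].
  { intro n.
    destruct (filter_ex _ (filter_and _ _ (HP n) (HP (S n)))) as [y [Y1 Y2]].
    assert (A1 := norm_compat2 (V := V) _ _ _ Y1). assert (A2 := norm_compat2 (V := V) _ _ _ Y2).
    fold c in A1, A2. simpl in A1, A2. assert (T0 := norm_minus_trans y (P (S n)) (P n)).
    rewrite (norm_minus_sym (P (S n)) y) in T0. assert (Q := Hp n). nra. }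
  exists s. intro eps. destruct (Hs (eps / 2)) as [N1 H1]; [generalize (cond_pos eps); lra|].
  destruct (geometric_small c (eps / 2)) as [N2 H2]; [exact Hc | generalize (cond_pos eps); lra|].
  specialize (H1 (max N1 N2) (Nat.le_max_l _ _)). specialize (H2 (max N1 N2) (Nat.le_max_r _ _)).
  generalize (HP (max N1 N2)). apply filter_imp. intros y Y. apply norm_compat1.
  assert (A1 := norm_compat2 (V := V) _ _ _ Y). fold c in A1. simpl in A1.
  assert (T0 := norm_minus_trans (P (max N1 N2)) y s).
  rewrite (norm_minus_sym (P (max N1 N2)) s) in T0. lra.
Qed.

Lemma filter_limit_unique (F G : (V -> Prop) -> Prop) :
  filter_le F G -> filter_le G F -> close (filter_limit F) (filter_limit G).
Proof.
  intros H1 H2. replace G with F; [intro eps; apply ball_center|].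
  apply functional_extensionality. intro A. apply propositional_extensionality.
  split; [apply H2 | apply H1].
Qed.

Definition complete_of_geometric : CompleteNormedModule C_AbsRing :=
  CompleteNormedModule.Pack C_AbsRing V
    (CompleteNormedModule.Class C_AbsRing V (NormedModule.class C_AbsRing V)
      (CompleteSpace.Mixin _ filter_limit filter_limit_correct filter_limit_unique)) V.

End CompleteOfGeometric.

(** * The derivation on BC/F and its resolvent *)

Section DerivationResolvent.
Context {X : CompleteNormedModule C_AbsRing} {F : BC X -> Prop} (HF : condition_Fplus F).
Notation Q := (Y HF).
Notation V := (CompleteNormedModule.NormedModule C_AbsRing X).

(** Carrier and norm are those of [Y HF], so the results on complete spaces speak about the same
    classes. *)
Definition Y_complete : CompleteNormedModule C_AbsRing :=
  complete_of_geometric (quotient_complete _ F (Fplus_subspace F HF) (BC_complete X)).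

Lemma cls_plus (f g : BC X) : cls HF (plus f g) = plus (cls HF f) (cls HF g) :> Q.
Proof. symmetry. exact (class_plus _ _ F (Fplus_subspace F HF) f g). Qed.

Lemma cls_scal (k : C) (f : BC X) : cls HF (scal k f) = scal k (cls HF f) :> Q.
Proof. symmetry. exact (class_scal _ _ F (Fplus_subspace F HF) k f). Qed.

Lemma cls_minus (f g : BC X) : cls HF (minus f g) = minus (cls HF f) (cls HF g) :> Q.
Proof.
  replace (minus f g) with (plus f (scal (- (1))%C g) : BC_NormedModule X)
    by module_ring (BC_NormedModule X).
  eapply eq_trans; [apply cls_plus|]. eapply eq_trans; [apply f_equal, cls_scal|]. module_ring Q.
Qed.

Lemma cls_eq (f g : BC X) : cls HF f = cls HF g <-> F (minus f g).
Proof. exact (class_eq _ _ F (Fplus_subspace F HF) f g). Qed.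

Lemma cls_surj (p : Q) (e : R) : 0 < e -> exists f, cls HF f = p /\ sup_norm X f < norm p + e.
Proof. exact (quot_norm_approx _ _ F (Fplus_subspace F HF) p e). Qed.

Lemma cls_norm (f : BC X) : norm (cls HF f) <= sup_norm X f.
Proof. exact (quot_norm_le _ _ F (Fplus_subspace F HF) f). Qed.

Lemma Dtilde_linear (k : C) (p q p' q' : Q) : Dtilde HF p q -> Dtilde HF p' q' ->
  Dtilde HF (plus p (scal k p')) (plus q (scal k q')).
Proof.
  intros [g [g' [Hg [<- <-]]]] [h [h' [Hh [<- <-]]]].
  exists (plus g (scal k h)), (plus g' (scal k h')). split.
  - apply (derivative_on_Rplus_intro _ _
      (fun t => plus (linear_extension g g' t) (scal k (linear_extension h h' t)))).
    + intros t Ht. unfold linear_extension. rewrite Rmin_right by exact Ht.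
      change (plus (plus (g t : V) (scal (RtoC 0) (g' 0 : V)))
        (scal k (plus (h t : V) (scal (RtoC 0) (h' 0 : V)))) = plus (g t : V) (scal k (h t : V))).
      module_ring V.
    + intros t _.
      assert (D1 := linear_extension_derive g g' t Hg).
      assert (D2 := scal_derive (fun _ => k) (linear_extension h h') t 0%C (h' t)
        (is_derive_const (V := R_NormedModule) (Re k) t)
        (is_derive_const (V := R_NormedModule) (Im k) t) (linear_extension_derive h h' t Hh)).
      assert (D3 := is_derive_plus (V := restrict_scalars X) _ _ t _ _ D1 D2). cbv beta in D3.
      assert (Eq : plus (g' t : V) (plus (scal (RtoC 0) (linear_extension h h' t)) (scal k (h' t : V)))
        = plus (g' t : V) (scal k (h' t : V))) by module_ring V.
      exact (eq_ind _ (fun d => is_derive (V := restrict_scalars X) _ t d) D3 _ Eq).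
  - split; (eapply eq_trans; [apply cls_plus|]; apply f_equal, cls_scal).
Qed.

Lemma Dtilde_minus (p q p' q' : Q) : Dtilde HF p q -> Dtilde HF p' q' ->
  Dtilde HF (minus p p') (minus q q').
Proof.
  intros H H'. assert (K := Dtilde_linear (- (1))%C p q p' q' H H').
  replace (minus p p') with (plus p (scal (- (1))%C p')) by module_ring Q.
  replace (minus q q') with (plus q (scal (- (1))%C q')) by module_ring Q. exact K.
Qed.

(** A representative [g] satisfies [l g - g'] in [F], hence lies in [F] by [solution_in_F].
    Multivaluedness does no harm off the axis. *)
Lemma Dtilde_eigen_zero (l : C) (p : Q) : Re l <> 0 -> Dtilde HF p (scal l p) -> p = zero.
Proof.
  intros Hl [g [g' [Hg [<- Hp]]]].
  assert (Fq : F (minus (scal l g) g')).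
  { apply cls_eq. rewrite Hp. apply cls_scal. }
  assert (Fg : F g).
  { apply (solution_in_F F HF g g' (minus (scal l g) g') l Hl Hg); [|exact Fq].
    intro t. change (plus (scal l (g t : V)) (scal (- (1))%C (g' t : V)) = minus (scal l (g t : V)) (g' t)).
    module_ring V. }
  change (cls HF g = cls HF zero). apply cls_eq.
  exact (eq_ind_r F Fg (minus_zero_r (G := BC_AbelianGroup X) g)).
Qed.

Lemma Dtilde_resolvent_unique (l : C) (f p q : Q) : Re l <> 0 ->
  Dtilde HF p (minus (scal l p) f) -> Dtilde HF q (minus (scal l q) f) -> p = q.
Proof.
  intros Hl Hp Hq. apply (minus_zero_eq (V := Q)). apply (Dtilde_eigen_zero l _ Hl).
  replace (scal l (minus p q)) with (minus (minus (scal l p) f) (minus (scal l q) f))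
    by module_ring Q.
  apply Dtilde_minus; assumption.
Qed.

Lemma Dtilde_solution (l : C) (f : Q) (e : R) : Re l <> 0 -> 0 < e ->
  exists p, Dtilde HF p (minus (scal l p) f) /\ norm p <= (norm f + e) / Rabs (Re l).
Proof.
  intros Hl He. destruct (cls_surj f e He) as [h [<- Hh]].
  destruct (resolvent_solution h l Hl) as [g [g' [Hg [Hg' Hn]]]].
  exists (cls HF g). split.
  - exists g, g'. split; [exact Hg|]. split; [reflexivity|].
    replace g' with (minus (scal l g) h : BC X).
    { eapply eq_trans; [apply cls_minus|].
      apply (f_equal (fun v => minus v (cls HF h))), cls_scal. }
    apply BC_ext. intro t. rewrite Hg'.
    change (plus (scal l (g t : V)) (scal (- (1))%C (h t : V)) = minus (scal l (g t : V)) (h t)).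
    module_ring V.
  - eapply Rle_trans; [apply cls_norm|]. eapply Rle_trans; [apply sup_norm_le, Hn|].
    apply Rmult_le_compat_r; [apply Rlt_le, Rinv_0_lt_compat, Rabs_pos_lt, Hl | lra].
Qed.

Lemma resolvent_spec (l : C) (f : Q) : Re l <> 0 ->
  Dtilde HF (resolvent (Dtilde HF) l f) (minus (scal l (resolvent (Dtilde HF) l f)) f).
Proof.
  intro Hl. unfold resolvent.
  apply (epsilon_spec (inhabits zero) (fun g => Dtilde HF g (minus (scal l g) f))).
  destruct (Dtilde_solution l f 1 Hl Rlt_0_1) as [p [Hp _]]. exists p. exact Hp.
Qed.

Lemma resolvent_eq (l : C) (f p : Q) : Re l <> 0 ->
  Dtilde HF p (minus (scal l p) f) -> resolvent (Dtilde HF) l f = p.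
Proof.
  intros Hl Hp. apply (Dtilde_resolvent_unique l f); [exact Hl | apply resolvent_spec, Hl | exact Hp].
Qed.

Lemma Dtilde_pseudo_resolvent : pseudo_resolvent (V := Q) (resolvent (Dtilde HF)).
Proof.
  constructor.
  - intros z x y Hz. apply resolvent_eq; [exact Hz|].
    assert (K := Dtilde_linear 1%C _ _ _ _ (resolvent_spec z x Hz) (resolvent_spec z y Hz)).
    set (a := resolvent (Dtilde HF) z x) in *. set (b := resolvent (Dtilde HF) z y) in *.
    replace (plus a b) with (plus a (scal (RtoC 1) b)) by module_ring Q.
    replace (minus (scal z (plus a (scal (RtoC 1) b))) (plus x y)) with
      (plus (minus (scal z a) x) (scal (RtoC 1) (minus (scal z b) y))) by module_ring Q.
    exact K.
  - intros z k x Hz. apply resolvent_eq; [exact Hz|].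
    assert (H0 : Dtilde HF (zero : Q) zero).
    { assert (K := Dtilde_minus _ _ _ _ (resolvent_spec z x Hz) (resolvent_spec z x Hz)).
      rewrite !(minus_eq_zero (G := Q)) in K. exact K. }
    assert (K := Dtilde_linear k _ _ _ _ H0 (resolvent_spec z x Hz)).
    set (a := resolvent (Dtilde HF) z x) in *.
    replace (scal k a) with (plus zero (scal k a)) by module_ring Q.
    replace (minus (scal z (plus zero (scal k a))) (scal k x)) with
      (plus zero (scal k (minus (scal z a) x))) by module_ring Q.
    exact K.
  - intros z x Hz. apply le_epsilon. intros e He.
    assert (P : 0 < Rabs (Re z)) by apply Rabs_pos_lt, Hz.
    destruct (Dtilde_solution z x (e * Rabs (Re z)) Hz) as [p [Hp Hn]]; [nra|].
    rewrite (resolvent_eq z x p Hz Hp). eapply Rle_trans; [exact Hn|].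
    apply Req_le. field. lra.
  (* The defect of the resolvent identity is an eigenvector for [z], hence zero. *)
  - intros z w x Hz Hw. apply (minus_zero_eq (V := Q)).
    apply (Dtilde_eigen_zero z _ Hz).
    assert (S1 := resolvent_spec z x Hz). assert (S2 := resolvent_spec w x Hw).
    assert (S3 := resolvent_spec z (resolvent (Dtilde HF) w x) Hz).
    set (b := resolvent (Dtilde HF) w x) in *. set (a := resolvent (Dtilde HF) z x) in *.
    set (c := resolvent (Dtilde HF) z b) in *.
    assert (K := Dtilde_linear (- (w - z))%C _ _ _ _ (Dtilde_minus _ _ _ _ S1 S2) S3).
    replace (minus (minus a b) (scal (w - z)%C c)) with
      (plus (minus a b) (scal (- (w - z))%C c)) by module_ring Q.
    replace (scal z (plus (minus a b) (scal (- (w - z))%C c))) with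
      (plus (minus (minus (scal z a) x) (minus (scal w b) x))
        (scal (- (w - z))%C (minus (scal z c) b))) by module_ring Q.
    exact K.
Qed.

End DerivationResolvent.

(** * The space Lambda_e *)

Section Vanishing.
Context {E : CompleteNormedModule C_AbsRing}.
Notation V := (CompleteNormedModule.NormedModule C_AbsRing E).
Context {Res : C -> V -> V} (HR : pseudo_resolvent Res).

Definition vanishing (xi : R) (p : V) : Prop :=
  filterlim (fun a : R => scal (RtoC a) (Res (a, xi) p)) (at_right 0) (locally (zero : V)).

Lemma vanishing_elim xi p e : vanishing xi p -> 0 < e ->
  at_right 0 (fun a => norm (scal (RtoC a) (Res (a, xi) p)) < e).
Proof.
  intros H He. generalize (filterlim_norm_elim _ _ H e He). apply filter_imp. intros a Ha.
  replace (scal (RtoC a) (Res (a, xi) p)) with (minus (scal (RtoC a) (Res (a, xi) p)) zero)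
    by module_ring V. exact Ha.
Qed.

Lemma vanishing_intro xi p :
  (forall e, 0 < e -> at_right 0 (fun a => norm (scal (RtoC a) (Res (a, xi) p)) < e)) ->
  vanishing xi p.
Proof.
  intro H. apply filterlim_norm_intro. intros e He. generalize (H e He). apply filter_imp.
  intros a Ha.
  assert (Eq : minus (scal (RtoC a) (Res (a, xi) p)) zero = scal (RtoC a) (Res (a, xi) p))
    by module_ring V.
  exact (Rle_lt_trans _ _ _ (Req_le _ _ (f_equal norm Eq)) Ha).
Qed.

Lemma at_right_pos (P : R -> Prop) : (forall a, 0 < a -> P a) -> at_right 0 P.
Proof. intro H. exists (mkposreal 1 Rlt_0_1). intros a _ Ha. exact (H a Ha). Qed.

(** These maps are contractions uniformly in [a], which makes the vanishing condition closed under
    limits in [p]. *)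
Lemma norm_scal_pr_le xi p a : 0 < a -> norm (scal (RtoC a) (Res (a, xi) p)) <= norm p.
Proof.
  intro Ha. rewrite norm_scal_eq, Cmod_R, Rabs_pos_eq by lra.
  assert (B := pr_bound_le HR (a, xi) p a Ha). simpl in B.
  rewrite Rabs_pos_eq in B by lra. specialize (B (Rle_refl a)).
  apply Rmult_le_compat_l with (r := a) in B; [|lra].
  rewrite <- Rmult_assoc, Rinv_r, Rmult_1_l in B by lra. exact B.
Qed.

Lemma vanishing_subspace xi : closed_subspace (vanishing xi).
Proof.
  constructor.
  - apply vanishing_intro. intros e He. apply at_right_pos. intros a Ha.
    eapply Rle_lt_trans; [apply norm_scal_pr_le, Ha|]. rewrite (norm_zero (V := V)). exact He.
  - intros x y Hx Hy. apply vanishing_intro. intros e He.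
    assert (He2 : 0 < e / 2) by lra.
    assert (K := filter_and _ _ (filter_and _ _ (vanishing_elim xi x _ Hx He2)
      (vanishing_elim xi y _ Hy He2)) (at_right_pos (fun a => 0 < a) (fun a Ha => Ha))).
    revert K. apply filter_imp. intros a [[Ax Ay] Ha].
    rewrite (pr_plus _ HR) by (simpl; lra).
    replace (scal (RtoC a) (plus (Res (a, xi) x) (Res (a, xi) y))) with
      (plus (scal (RtoC a) (Res (a, xi) x)) (scal (RtoC a) (Res (a, xi) y))) by module_ring V.
    eapply Rle_lt_trans; [apply (norm_triangle (V := V))|]. lra.
  - intros k x Hx. apply vanishing_intro. intros e He.
    assert (Hk := Cmod_ge_0 k).
    assert (He2 : 0 < e / (Cmod k + 1)) by (apply Rdiv_lt_0_compat; lra).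
    assert (K := filter_and _ _ (vanishing_elim xi x _ Hx He2)
      (at_right_pos (fun a => 0 < a) (fun a Ha => Ha))).
    revert K. apply filter_imp. intros a [Ax Ha].
    rewrite (pr_scal _ HR) by (simpl; lra).
    replace (scal (RtoC a) (scal k (Res (a, xi) x))) with
      (scal k (scal (RtoC a) (Res (a, xi) x))) by module_ring V.
    rewrite norm_scal_eq. set (n := norm _) in *.
    assert (0 <= n) by apply norm_ge_0.
    apply Rmult_lt_compat_l with (r := Cmod k + 1) in Ax; [|lra].
    replace ((Cmod k + 1) * (e / (Cmod k + 1))) with e in Ax by (field; lra). nra.
  - apply closed_norm. intros x Hx. apply vanishing_intro. intros e He.
    destruct (Hx (e / 2)) as [y [Hy Hxy]]; [lra|].
    assert (He2 : 0 < e / 2) by lra.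
    assert (K := filter_and _ _ (vanishing_elim xi y _ Hy He2)
      (at_right_pos (fun a => 0 < a) (fun a Ha => Ha))).
    revert K. apply filter_imp. intros a [Ay Ha].
    assert (B := norm_scal_pr_le xi (minus x y) a Ha).
    rewrite (pr_minus HR) in B by (simpl; lra).
    replace (scal (RtoC a) (Res (a, xi) x)) with
      (plus (scal (RtoC a) (minus (Res (a, xi) x) (Res (a, xi) y)))
        (scal (RtoC a) (Res (a, xi) y))) by module_ring V.
    eapply Rle_lt_trans; [apply (norm_triangle (V := V))|]. lra.
Qed.

(** Resolvents commute, and [Res z] is bounded. *)
Lemma vanishing_pr xi z p : Re z <> 0 -> vanishing xi p -> vanishing xi (Res z p).
Proof.
  intros Hz Hp. apply vanishing_intro. intros e He.
  assert (Pz : 0 < Rabs (Re z)) by apply Rabs_pos_lt, Hz.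
  assert (He2 : 0 < e * Rabs (Re z)) by nra.
  assert (K := filter_and _ _ (vanishing_elim xi p _ Hp He2)
    (at_right_pos (fun a => 0 < a) (fun a Ha => Ha))).
  revert K. apply filter_imp. intros a [Ay Ha].
  rewrite (pr_comm HR) by (simpl; lra || exact Hz).
  rewrite <- (pr_scal _ HR) by exact Hz.
  eapply Rle_lt_trans; [apply (pr_bound _ HR), Hz|].
  apply Rmult_lt_reg_r with (Rabs (Re z)); [exact Pz|].
  unfold Rdiv. rewrite Rmult_assoc, Rinv_l, Rmult_1_r by lra. exact Ay.
Qed.

Lemma regular_subspace {J : R -> Prop} (HJ : open J) : closed_subspace (regular (Res := Res) (J := J)).
Proof.
  constructor.
  - intros t _. exists zero. unfold axis_limit.
    apply filterlim_within_ext with (fun _ => zero).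
    + intros z Hz. symmetry. replace (zero : V) with (scal (RtoC 0) (zero : V)) at 1 by module_ring V.
      rewrite (pr_scal _ HR) by exact Hz. module_ring V.
    + apply filterlim_const.
  - intros x y Hx Hy t Ht. destruct (Hx t Ht) as [v Hv]. destruct (Hy t Ht) as [w Hw].
    exists (plus v w). apply (axis_limit_plus Res HR); assumption.
  - intros k x Hx t Ht. destruct (Hx t Ht) as [v Hv].
    exists (scal k v). apply (axis_limit_scal Res HR); assumption.
  - apply (regular_closed HR HJ).
Qed.

Lemma axis_limit_in_closed (W : V -> Prop) f eta v : closed W ->
  (forall z, Re z <> 0 -> W (Res z f)) -> axis_limit Res f eta v -> W v.
Proof.
  intros HW Hf Hv. apply HW. intro Hloc.
  assert (K := Hv _ Hloc). apply off_axis_elim in K. destruct K as [d [Hd K]].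
  destruct (filter_ex (F := off_axis eta) (fun z => Re z <> 0 /\ Cmod (z - (0, eta)) < d)) as [z [Z1 Z2]].
  { apply (off_axis_intro eta _ d Hd). tauto. }
  exact (K z Z1 Z2 (Hf z Z1)).
Qed.

End Vanishing.

Lemma closed_subspace_and {V : NormedModule C_AbsRing} (A B : V -> Prop) :
  closed_subspace A -> closed_subspace B -> closed_subspace (fun x => A x /\ B x).
Proof.
  intros [A0 A1 A2 A3] [B0 B1 B2 B3]. constructor.
  - split; assumption.
  - intros x y [] []. split; auto.
  - intros k x []. split; auto.
  - apply closed_and; assumption.
Qed.

Lemma closed_subspace_forall {V : NormedModule C_AbsRing} {I : Type} (P : I -> Prop) (A : I -> V -> Prop) :
  (forall i, closed_subspace (A i)) -> closed_subspace (fun x => forall i, P i -> A i x).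
Proof.
  intro H. constructor.
  - intros i _. apply (subspace_zero _ (H i)).
  - intros x y Hx Hy i Hi. apply (subspace_plus _ (H i)); auto.
  - intros k x Hx i Hi. apply (subspace_scal _ (H i)); auto.
  - intros x Hx i Hi. apply (subspace_closed _ (H i)). intro K. apply Hx.
    revert K. apply filter_imp. intros y Hy Hy'. exact (Hy (Hy' i Hi)).
Qed.

(** * The subspace Lambda_e and the spectrum of the derivation on it *)

Section LambdaE.
Context {X : CompleteNormedModule C_AbsRing} {F : BC X -> Prop} (HF : condition_Fplus F).
Context {Lambda : R -> Prop} (HLambda : closed Lambda).
Notation YC := (Y_complete HF).
Notation Q := (CompleteNormedModule.NormedModule C_AbsRing YC).

Let Res : C -> Q -> Q := resolvent (Dtilde HF).
Let HR : pseudo_resolvent Res := Dtilde_pseudo_resolvent HF.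
Let J (t : R) : Prop := ~ Lambda t.
Let HJ : open J := open_not _ HLambda.

(** Holomorphic extensions, each on its own neighbourhood, are traded for limits at the points of
    the axis off [Lambda]: conditions that are linear, closed and stable under resolvents. *)
Lemma Lambda_e_iff (p : Q) : Lambda_e HF Lambda p <->
  regular (Res := Res) (J := J) p /\ forall xi, Lambda xi -> vanishing (Res := Res) xi p.
Proof.
  split.
  - intros [H1 H2]. split; [|exact H2].
    intros t Ht.
    assert (K : ~ reduced_spectrum HF p t) by (intro K; exact (Ht (H1 t K))).
    apply NNPP in K. destruct K as [U [Phi [HU [Hxi [Hh Heq]]]]].
    exists (Phi (0, t)). exact (extension_axis_limit (Res := Res) U Phi t p HU Hxi Hh Heq).
  - intros [H1 H2]. split; [|exact H2].
    intros xi Hxi. apply NNPP. intro N. apply Hxi.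
    destruct (regular_extension HR HJ p H1) as [Phi [Hh Heq]].
    exists (fun z => Re z <> 0 \/ J (Im z)), Phi. split; [|split; [right; exact N | split; [exact Hh|]]].
    + apply open_or.
      * apply (open_comp (fun z : C => Re z) (fun r : R => r <> 0)).
        { intros z _. apply (continuous_fst (U := R_UniformSpace) (V := R_UniformSpace)). }
        exact (open_neq 0).
      * apply (open_comp (fun z : C => Im z) J); [|exact HJ].
        intros z _. apply (continuous_snd (U := R_UniformSpace) (V := R_UniformSpace)).
    + intros lam _ Hlam. exact (Heq lam Hlam).
Qed.

Lemma Lambda_e_subspace : closed_subspace (Lambda_e HF Lambda).
Proof.
  replace (Lambda_e HF Lambda) with (fun p : Q =>
    regular (Res := Res) (J := J) p /\ forall xi, Lambda xi -> vanishing (Res := Res) xi p).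
  - apply closed_subspace_and.
    + apply (regular_subspace HR HJ).
    + apply (closed_subspace_forall Lambda). intro xi. apply (vanishing_subspace HR).
  - apply functional_extensionality. intro p. apply propositional_extensionality.
    symmetry. apply Lambda_e_iff.
Qed.

Lemma Lambda_e_resolvent (z : C) (p : Q) : Re z <> 0 ->
  Lambda_e HF Lambda p -> Lambda_e HF Lambda (Res z p).
Proof.
  intros Hz Hp. apply Lambda_e_iff in Hp. destruct Hp as [H1 H2]. apply Lambda_e_iff. split.
  - apply (regular_pr HR); assumption.
  - intros xi Hxi. apply (vanishing_pr HR); [exact Hz | apply H2, Hxi].
Qed.

Lemma Lambda_e_minus_scal (z : C) (p q : Q) :
  Lambda_e HF Lambda p -> Lambda_e HF Lambda q -> Lambda_e HF Lambda (minus (scal z p) q).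
Proof.
  intros Hp Hq. replace (minus (scal z p) q) with (plus (scal z p) (scal (- (1))%C q))
    by module_ring Q.
  apply (subspace_plus _ Lambda_e_subspace); apply (subspace_scal _ Lambda_e_subspace); assumption.
Qed.

Lemma resolvent_set_off_axis (z : C) : Re z <> 0 ->
  resolvent_set (Lambda_e HF Lambda) (D_Lambda HF Lambda) z.
Proof.
  intro Hz. split.
  - intros f Hf. exists (resolvent (Dtilde HF) z f). split.
    + assert (Hr := Lambda_e_resolvent z f Hz Hf).
      split; [exact Hr|]. split; [exact Hr|]. split.
      * apply Lambda_e_minus_scal; assumption.
      * apply resolvent_spec, Hz.
    + intros g [_ [_ [_ Hg]]]. apply resolvent_eq; assumption.
  - exists (/ Rabs (Re z)). intros f g _ _ [_ [_ Hg]].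
    rewrite <- (resolvent_eq HF z f g Hz Hg), Rmult_comm.
    apply (pr_bound _ HR), Hz.
Qed.

(** No limit is taken inside the graph of the derivation: [axis_limit_eq] at the point 1 writes [v]
    as the resolvent of [f + (1 - i xi) v], so [v] is in the domain. *)
Lemma Dtilde_axis_limit (xi : R) (f v : Q) : axis_limit Res f xi v ->
  Dtilde HF v (minus (scal ((0, xi) : C) v) f).
Proof.
  intro Hv. assert (H1 : Re (RtoC 1) <> 0) by (simpl; lra).
  assert (K := axis_limit_eq HR f xi v (RtoC 1) H1 Hv).
  assert (E1 : Res (RtoC 1) (plus f (scal (1 - (0, xi))%C v)) = v).
  { rewrite (pr_plus _ HR), (pr_scal _ HR) by exact H1.
    replace (Res (RtoC 1) f) with (plus (minus (Res (RtoC 1) f) v) v) by module_ring Q.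
    rewrite K. module_ring Q. }
  assert (S1 := resolvent_spec HF (RtoC 1) (plus f (scal (1 - (0, xi))%C v)) H1).
  change (Dtilde HF (Res (RtoC 1) (plus f (scal (1 - (0, xi))%C v)))
    (minus (scal (RtoC 1) (Res (RtoC 1) (plus f (scal (1 - (0, xi))%C v))))
      (plus f (scal (1 - (0, xi))%C v)))) in S1.
  rewrite E1 in S1.
  replace (minus (scal ((0, xi) : C) v) f) with
    (minus (scal (RtoC 1) v) (plus f (scal (1 - (0, xi))%C v))) by module_ring Q.
  exact S1.
Qed.

(** On an eigenvector [Res (s + i xi)] acts as [1 / s], against the bound [M] valid near [i xi] on
    regular vectors; [s <= 1 / (2 M)] leaves [norm d <= norm d / 2]. *)
Lemma axis_eigen_zero (xi : R) (d : Q) : ~ Lambda xi -> Lambda_e HF Lambda d ->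
  Dtilde HF d (scal ((0, xi) : C) d) -> d = zero.
Proof.
  intros Hxi Hd Heig. apply Lambda_e_iff in Hd. destruct Hd as [Hd _].
  destruct (regular_local_bound HR HJ xi Hxi) as [r [M [Hr [HM HB]]]].
  assert (Hs : 0 < Rmin (r / 2) (/ (2 * M)))
    by (apply Rmin_glb_lt; [lra | apply Rinv_0_lt_compat; lra]).
  assert (S1 := Rmin_l (r / 2) (/ (2 * M))). assert (S2 := Rmin_r (r / 2) (/ (2 * M))).
  set (s := Rmin (r / 2) (/ (2 * M))) in *.
  assert (Es : ((s, xi) - (0, xi))%C = RtoC s)
    by (unfold RtoC, Cminus, Cplus, Copp; simpl; f_equal; ring).
  assert (Hsz : Re (s, xi) <> 0) by (simpl; lra).
  assert (E1 : Res (s, xi) (scal (RtoC s) d) = d).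
  { apply (resolvent_eq HF); [exact Hsz|].
    rewrite <- Es.
    assert (Eq : scal ((0, xi) : C) d = minus (scal ((s, xi) : C) d) (scal ((s, xi) - (0, xi))%C d))
      by module_ring Q.
    exact (eq_ind _ (Dtilde HF d) Heig _ Eq). }
  rewrite (pr_scal _ HR) in E1 by exact Hsz.
  assert (B := HB d (s, xi) Hd Hsz). rewrite Es, Cmod_R, Rabs_pos_eq in B by lra.
  specialize (B ltac:(lra)).
  apply (norm_eq_zero (V := Q)). apply Rle_antisym; [|apply norm_ge_0].
  assert (E2 : norm d = s * norm (Res (s, xi) d)).
  { rewrite <- E1 at 1. rewrite norm_scal_eq, Cmod_R, Rabs_pos_eq; lra. }
  assert (Hn : 0 <= norm d) by apply norm_ge_0.
  assert (HsM : s * M <= 1 / 2).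
  { apply Rmult_le_compat_r with (r := M) in S2; [|lra].
    replace (/ (2 * M) * M) with (1 / 2) in S2 by (field; lra). exact S2. }
  nra.
Qed.

Lemma resolvent_set_axis (xi : R) : ~ Lambda xi ->
  resolvent_set (Lambda_e HF Lambda) (D_Lambda HF Lambda) (0, xi).
Proof.
  intro Hxi.
  (* The boundary value stays in Lambda_e as a limit of resolvents, the subspace being closed and
     resolvent-invariant. *)
  assert (Hex : forall f : Q, Lambda_e HF Lambda f -> exists v : Q,
    axis_limit Res f xi v /\ Lambda_e HF Lambda v).
  { intros f Hf. destruct (proj1 (Lambda_e_iff f) Hf) as [Hreg _].
    destruct (Hreg xi Hxi) as [v Hv]. exists v. split; [exact Hv|].
    apply (axis_limit_in_closed (Res := Res) (Lambda_e HF Lambda) f xi v); [| |exact Hv].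
    - apply (subspace_closed _ Lambda_e_subspace).
    - intros z Hz. apply Lambda_e_resolvent; assumption. }
  assert (Huniq : forall f v g : Q, axis_limit Res f xi v -> Lambda_e HF Lambda v ->
    Lambda_e HF Lambda g -> Dtilde HF g (minus (scal ((0, xi) : C) g) f) -> v = g).
  { intros f v g Hv Ev Eg Hg. apply (minus_zero_eq (V := Q)).
    apply (axis_eigen_zero xi _ Hxi).
    - replace (minus v g) with (minus (scal (RtoC 1) v) g) by module_ring Q.
      apply Lambda_e_minus_scal; assumption.
    - assert (K := Dtilde_minus HF _ _ _ _ (Dtilde_axis_limit xi f v Hv) Hg).
      replace (scal ((0, xi) : C) (minus v g)) with
        (minus (minus (scal ((0, xi) : C) v) f) (minus (scal ((0, xi) : C) g) f))
        by module_ring Q.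
      exact K. }
  split.
  - intros f Hf. destruct (Hex f Hf) as [v [Hv Ev]]. exists v. split.
    + split; [exact Ev|]. split; [exact Ev|]. split.
      * apply (Lambda_e_minus_scal (0, xi)); assumption.
      * apply Dtilde_axis_limit, Hv.
    + intros g [Eg [_ [_ Hg]]]. exact (Huniq f v g Hv Ev Eg Hg).
  - destruct (regular_bound HR HJ xi Hxi) as [M [_ HM]]. exists M.
    intros f g Hf Eg [_ [_ Hg]]. destruct (Hex f Hf) as [v [Hv Ev]].
    rewrite <- (Huniq f v g Hv Ev Eg Hg).
    apply HM; [apply Lambda_e_iff, Hf | exact Hv].
Qed.

End LambdaE.

Theorem theorem3p5
  (X : CompleteNormedModule C_AbsRing)
  (F : BC X -> Prop) (HF : condition_Fplus F)
  (Lambda : R -> Prop) (HLambda : closed Lambda) :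
  closed_subspace (Lambda_e HF Lambda) /\
  (forall z : C, spectrum (Lambda_e HF Lambda) (D_Lambda HF Lambda) z ->
     exists xi : R, Lambda xi /\ z = (0, xi)).
Proof.
  split; [exact (Lambda_e_subspace HF HLambda)|].
  intros [x xi] Hz. exists xi.
  destruct (Req_dec x 0) as [->|Hx].
  - split; [|reflexivity]. apply NNPP. intro N. apply Hz.
    exact (resolvent_set_axis HF HLambda xi N).
  - exfalso. apply Hz. exact (resolvent_set_off_axis HF HLambda (x, xi) Hx).
Qed.
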